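(* Suppose that for every $t\in[0,1]$ the operator $\mathcal A_t$ is the self-adjoint extension of $A$ with $\mathrm{dom}(\mathcal A_t)=\{u\in\mathcal H_+:[X_t,Y_t]\mathrm T_tu=0\}$ and $$\mathrm T_t(\mathrm{dom}(\mathcal A_t))=\mathrm{ran}(Q_t)=\ker([X_t,Y_t]),\quad X_t,Y_t\in\mathcal B(\mathfrak H),\quad X_tY_t^*=Y_tX_t^*,\quad 0\notin\mathrm{Spec}\begin{bmatrix}X_t&Y_t\\-Y_t&X_t\end{bmatrix},$$ and let $H_t=\mathcal A_t+V_t$, $R_t(\zeta)=(H_t-\zeta)^{-1}$. Then for $s,t\in[0,1]$, $\zeta\notin\mathrm{Spec}(H_t)\cup\mathrm{Spec}(H_s)$, $$R_t(\zeta)-R_s(\zeta)=R_t(\zeta)(V_s-V_t)R_s(\zeta)+(\mathrm T_tR_t(\overline\zeta))^*Z_{t,s}\mathrm T_sR_s(\zeta)+(\mathrm T_tR_t(\overline\zeta))^*J(\mathrm T_t-\mathrm T_s)R_s(\zeta),$$ with $Z_{t,s}:=(W(X_t,Y_t))^*(X_tY_s^*-Y_tX_s^* )W(X_s,Y_s)$. Moreover, if $t\mapsto\mathrm T_t,V_t,X_t,Y_t$ are continuous at $t_0\in[0,1]$ in the respective spaces of operators, then $t\mapsto R_t(\zeta_0)$ is continuous at $t=t_0$ for any $\zeta_0\notin\mathrm{Spec}(H_{t_0})$. Further, if $t\mapsto\mathrm T_t,V_t,X_t,Y_t$ are differentiable at $t_0\in[0,1]$, then $t\mapsto R_t(\zeta_0)$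 is differentiable at $t_0$, and the following two assertions hold: (1) For $\zeta_0\notin\mathrm{Spec}(H_{t_0})$, $$\dot R_{t_0}(\zeta_0)=-R_{t_0}(\zeta_0)\dot V_{t_0}R_{t_0}(\zeta_0)+(\mathrm T_{t_0}R_{t_0}(\overline{\zeta_0}))^*(W(X_{t_0},Y_{t_0}))^*(\dot X_{t_0}Y_{t_0}^*-\dot Y_{t_0}X_{t_0}^* )W(X_{t_0},Y_{t_0})\mathrm T_{t_0}R_{t_0}(\zeta_0)+(\mathrm T_{t_0}R_{t_0}(\overline{\zeta_0}))^*J\dot{\mathrm T}_{t_0}R_{t_0}(\zeta_0).$$ (2) If $\lambda(t_0)\in\mathrm{Spec}(H_{t_0})$ is an isolated eigenvalue of multiplicity $m\ge1$, then there exist a choice of orthonormal eigenfunctions $\{u_j\}_{j=1}^m\subset\ker(H_{t_0}-\lambda(t_0))$ and a labeling $\{\lambda_j(t)\}_{j=1}^m$ of the eigenvalues of $H_t$ bifurcating from $\lambda(t_0)$, for $t$ near $t_0$, such that $$\dot\lambda_j(t_0)=\langle\dot V_{t_0}u_j,u_j\rangle_{\mathcal H}+\langle(X_{t_0}\dot Y_{t_0}^*-Y_{t_0}\dot X_{t_0}^* )\phi_j,\phi_j\rangle_{\mathfrak H}+\omega(\mathrm T_{t_0}u_j,\dot{\mathrm T}_{t_0}u_j),\quad 1\le j\le m,$$ where $\phi_j=W(X_{t_0},Y_{t_0})\mathrm T_{t_0}u_j$, or, equivalently, $\phi_j$ is the unique vector in $\mathfrak H$ with $\Gamma_{0t_0}u_j=-Y_{t_0}^*\phi_j$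 and $\Gamma_{1t_0}u_j=X_{t_0}^*\phi_j$.
   Context: Inner products are linear in the first argument. $\mathcal H,\mathfrak H$ are complex separable Hilbert spaces; $A$ is a densely defined, closed, symmetric operator in $\mathcal H$ with equal (possibly infinite) deficiency indices; $\mathcal H_+:=\mathrm{dom}(A^* )$ carries the graph inner product $\langle u,v\rangle_{\mathcal H}+\langle A^*u,A^*v\rangle_{\mathcal H}$. $(\mathfrak H,\Gamma_0,\Gamma_1)$ is an ordinary boundary triplet if $\mathrm T=(\Gamma_0,\Gamma_1):\mathcal H_+\to\mathfrak H\times\mathfrak H$ is linear, surjective, and $\langle A^*u,v\rangle_{\mathcal H}-\langle u,A^*v\rangle_{\mathcal H}=\langle\Gamma_1u,\Gamma_0v\rangle_{\mathfrak H}-\langle\Gamma_0u,\Gamma_1v\rangle_{\mathfrak H}$ for all $u,v\in\mathcal H_+$. For each $t\in[0,1]$: $\mathrm T_t=[\Gamma_{0t},\Gamma_{1t}]^\top\in\mathcal B(\mathcal H_+,\mathfrak H\times\mathfrak H)$ and $(\mathfrak H,\Gamma_{0t},\Gamma_{1t})$ is an ordinary boundary triplet; $Q_t$ is an orthogonal projection in $\mathfrak H\times\mathfrak H$ with Lagrangian range; $V_t\in\mathcal B(\mathcal H)$ is self-adjoint. $J=\begin{bmatrix}0&I_{\mathfrak H}\\-I_{\mathfrak H}&0\end{bmatrix}$, $\omega(f,g)=\langle Jf,g\rangle_{\mathfrak H\times\mathfrak H}$; a subspace $\mathcal F\subset\mathfrak H\times\mathfrak H$ is Lagrangian if it equals $\{f:\omega(f,g)=0\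 \forall g\in\mathcal F\}$. $[X,Y](f_1,f_2)^\top=Xf_1+Yf_2$, $W(X,Y):=(XX^*+YY^* )^{-1}[-Y,X]\in\mathcal B(\mathfrak H\times\mathfrak H,\mathfrak H)$. Operators $\mathrm T_tR_t(\zeta)$ are viewed in $\mathcal B(\mathcal H,\mathfrak H\times\mathfrak H)$. Continuity and differentiability of $\mathrm T_t,V_t,X_t,Y_t$ are in the norms of $\mathcal B(\mathcal H_+,\mathfrak H\times\mathfrak H)$, $\mathcal B(\mathcal H)$, $\mathcal B(\mathfrak H)$, $\mathcal B(\mathfrak H)$, and that of $R_t(\zeta_0)$ in $\mathcal B(\mathcal H)$; the dot is the $t$-derivative. The eigenvalues of $H_t$ bifurcating from $\lambda(t_0)$ are the $m$ eigenvalues (with multiplicity) of $H_t$, $t$ near $t_0$, lying in a small disc centered at $\lambda(t_0)$ that contains no other point of $\mathrm{Spec}(H_{t_0})$; multiplicity $m$ is finite. *)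

(* Defs.v *)
From HB Require Import structures.
From mathcomp Require Import all_boot all_order all_algebra.
From mathcomp Require Import complex.
From mathcomp Require Import all_classical all_reals all_analysis.

Set Implicit Arguments.
Unset Strict Implicit.
Unset Printing Implicit Defensive.

Import Order.TTheory GRing.Theory Num.Theory.
Import numFieldNormedType.Exports.

Local Open Scope classical_set_scope.
Local Open Scope complex_scope.
Local Open Scope ring_scope.

(* [{dot E for Num.conj}] is linear in its first argument and conjugate-linear
   in the second one. *)
HB.mixin Record hasInner (R : realType) E of GRing.Lmodule R[i] E := {
  inner : {dot E for Num.conj} }.

#[short(type="innerType")]
HB.structure Definition Inner (R : realType) :=
  { E of GRing.Lmodule R[i] E & hasInner R E }.

Notation "''[' u , v ]" := (inner u v) : ring_scope.

HB.mixin Record isHilbert (R : realType) E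
    of CompleteNormedModule R[i] E & hasInner R E := {
  norm_inner : forall x : E, `|x| ^+ 2 = '[x, x] }.

#[short(type="hilbertType")]
HB.structure Definition Hilbert (R : realType) :=
  { E of CompleteNormedModule R[i] E & hasInner R E & isHilbert R E }.

Definition separable_space (T : topologicalType) : Prop :=
  exists S : set T, countable S /\ dense S.

(* The inner product of the orthogonal sum of E and F. The library's normed
   module structure on [E * F] carries the (equivalent) max norm; only its
   topology is used below, norms on [E * F] always being [hnorm]. *)
Section ProdInner.
Variables (R : realType) (E F : innerType R).

Definition prod_inner (f g : E * F) : R[i] := '[f.1, g.1] + '[f.2, g.2].

Let prod_inner_bilinear :
  bilinear_for (GRing.Scale.Law.clone _ _ *%R _)
               (GRing.Scale.Law.clone _ _ (Num.conj \; *%R) _) prod_inner.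
Proof.
split=> [g|f] a x y; rewrite /prod_inner /=.
  by rewrite !linearPl /= mulrDr addrACA.
by rewrite !linearPr /= mulrDr addrACA.
Qed.

HB.instance Definition _ :=
  bilinear_isBilinear.Build R[i] (E * F)%type (E * F)%type R[i]
    *%R (Num.conj \; *%R) prod_inner prod_inner_bilinear.

Let prod_inner_hermitian (f g : E * F) :
  prod_inner f g = (-1) ^+ false * Num.conj (prod_inner g f).
Proof.
rewrite /prod_inner rmorphD expr0 mul1r.
by congr (_ + _); rewrite hermC expr0 mul1r.
Qed.

HB.instance Definition _ :=
  isHermitianSesquilinear.Build R[i] (E * F)%type false Num.conj prod_inner
    prod_inner_hermitian.

Let prod_inner_gt0 (f : E * F) : f != 0 -> 0 < prod_inner f f.
Proof.
case: f => x y xy0; rewrite /prod_inner /= lt_def addr_ge0 ?dnorm_ge0 // andbT.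
rewrite paddr_eq0 ?dnorm_ge0 // !dnorm_eq0.
by apply: contra xy0 => /andP[/eqP-> /eqP->].
Qed.

HB.instance Definition _ :=
  isDotProduct.Build R[i] (E * F)%type prod_inner prod_inner_gt0.

HB.instance Definition _ :=
  hasInner.Build R (E * F)%type (prod_inner : {dot (E * F)%type for Num.conj}).

End ProdInner.

Section LinearOperators.
Variable R : realType.
Implicit Types E F : innerType R.

Definition hnorm E (u : E) : R := Num.sqrt (complex.Re '[u, u]).

Definition subspace E (D : set E) : Prop :=
  D 0 /\ forall (a : R[i]) u v, D u -> D v -> D (a *: u + v).

Definition linear_on E F (D : set E) (f : E -> F) : Prop :=
  subspace D /\
  forall (a : R[i]) u v, D u -> D v -> f (a *: u + v) = a *: f u + f v.

Definition has_dim E (S : set E) (n : nat) : Prop :=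
  exists e : 'I_n -> E,
    (forall c : 'I_n -> R[i], \sum_i c i *: e i = 0 -> forall i, c i = 0) /\
    S = [set x | exists c : 'I_n -> R[i], x = \sum_i c i *: e i].

(* Possibly unbounded operators: the values outside [dom] are irrelevant. *)
Record operator E F := Operator { dom : set E ; app :> E -> F }.

Definition full E F (f : E -> F) : operator E F := Operator setT f.

(* dom(S^* ) consists of the v such that u |-> <S u, v> is represented by some
   vector w, which is unique when S is densely defined; then S^* v = w. *)
Definition adjoint E F (S : operator E F) : operator F E :=
  let rep v := [set w | forall u, dom S u -> '[S u, v] = '[u, w]] in
  Operator [set v | rep v !=set0] (fun v => xget 0 (rep v)).

Definition adj E F (f : E -> F) : F -> E := adjoint (full f).

Definition op_inv E F (S : operator E F) : F -> E :=
  fun f => xget 0 [set u | dom S u /\ S u = f].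

Definition inverse E F (f : E -> F) : F -> E := op_inv (full f).

Definition op_shift E (B : operator E E) (z : R[i]) : operator E E :=
  Operator (dom B) (fun u => B u - z *: u).

Definition add_op E F (B : operator E F) (f : E -> F) : operator E F :=
  Operator (dom B) (fun u => B u + f u).

(* The space of bounded operators from (D, N) to F, and its norm: N is the norm
   of the subspace D, which need not be the one inherited from E. *)
Definition bounded_on E F (D : set E) (N : E -> R) (f : E -> F) : Prop :=
  linear_on D f /\ exists M : R, forall u, D u -> hnorm (f u) <= M * N u.

Definition opnorm_on E F (D : set E) (N : E -> R) (f : E -> F) : R :=
  sup [set hnorm (f u) | u in [set u | D u /\ N u <= 1]].

Definition bounded_op E F (f : E -> F) : Prop := bounded_on setT (@hnorm E) f.

Definition resolvent E (B : operator E E) (z : R[i]) : E -> E :=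
  op_inv (op_shift B z).

Definition resolvent_set E (B : operator E E) : set R[i] :=
  [set z | set_bij (dom B) setT (op_shift B z) /\ bounded_op (resolvent B z)].

Definition Spec E (B : operator E E) : set R[i] := ~` resolvent_set B.

Definition eigen_ker E (B : operator E E) (z : R[i]) : set E :=
  [set u | dom B u /\ B u = z *: u].

Definition extends E F (A B : operator E F) : Prop :=
  dom A `<=` dom B /\ forall u, dom A u -> B u = A u.

Definition symmetric_op E (A : operator E E) : Prop :=
  forall u v, dom A u -> dom A v -> '[A u, v] = '[u, A v].

(* The deficiency indices are the dimensions, in {0, 1, ..., oo}, of the kernels
   of A^* - i and A^* + i. *)
Definition equal_deficiency E (A : operator E E) : Prop :=
  forall n : nat,
    has_dim (eigen_ker (adjoint A) 'i) n <->
    has_dim (eigen_ker (adjoint A) (- 'i)) n.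

Definition graph_norm E (A : operator E E) (u : E) : R :=
  Num.sqrt (complex.Re ('[u, u] + '[A u, A u])).

End LinearOperators.

Section HilbertOperators.
Variable R : realType.
Implicit Types H : hilbertType R.

Definition closed_op H (A : operator H H) : Prop :=
  closed [set p : H * H | dom A p.1 /\ p.2 = A p.1].

Definition self_adjoint H (A : operator H H) : Prop :=
  [/\ linear_on (dom A) A, dense (dom A),
      dom A = dom (adjoint A) & forall u, dom A u -> A u = adjoint A u].

End HilbertOperators.

Section BoundaryTriplets.
Variable R : realType.
Implicit Types E h : innerType R.

Definition boundary_triplet E h (A : operator E E) (G0 G1 : E -> h) : Prop :=
  let Hp := dom (adjoint A) in
  [/\ linear_on Hp (fun u => (G0 u, G1 u)),
      forall f : h * h, exists2 u, Hp u & (G0 u, G1 u) = f &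
      forall u v, Hp u -> Hp v ->
        '[adjoint A u, v] - '[u, adjoint A v] =
        '[G1 u, G0 v] - '[G0 u, G1 v]].

Definition J h (f : h * h) : h * h := (f.2, - f.1).

Definition omega h (f g : h * h) : R[i] := '[J f, g].

Definition lagrangian h (F : set (h * h)) : Prop :=
  subspace F /\ F = [set f | forall g, F g -> omega f g = 0].

Definition orthogonal_projection E (Q : E -> E) : Prop :=
  [/\ bounded_op Q, forall f, Q (Q f) = Q f &
      forall f g, '[Q f, g] = '[f, Q g]].

Definition row_op h (X Y : h -> h) (f : h * h) : h := X f.1 + Y f.2.

Definition block_op h (X Y : h -> h) (f : h * h) : h * h :=
  (X f.1 + Y f.2, - Y f.1 + X f.2).

Definition W h (X Y : h -> h) (f : h * h) : h :=
  inverse (fun x => X (adj X x) + Y (adj Y x)) (- Y f.1 + X f.2).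

End BoundaryTriplets.

Section Families.
Variable R : realType.

Definition nbhs01 (t0 : R) : set_system R := within `[0, 1] (nbhs t0).

Definition dnbhs01 (t0 : R) : set_system R := within `[0, 1] (dnbhs t0).

Definition diff_quot (V : lmodType R[i]) (f : R -> V) (t0 t : R) : V :=
  ((t - t0)^-1)%:C *: (f t - f t0).

(* At the endpoints of [0, 1] these are one-sided notions. *)
Definition continuous_on01 (E F : innerType R) (D : set E) (N : E -> R)
    (f : R -> E -> F) (t0 : R) : Prop :=
  opnorm_on D N (fun u => f t u - f t0 u) @[t --> nbhs01 t0] --> (0 : R).

Definition derivative_on01 (E F : innerType R) (D : set E) (N : E -> R)
    (f : R -> E -> F) (t0 : R) (f' : E -> F) : Prop :=
  bounded_on D N f' /\
  opnorm_on D N (fun u => diff_quot (f ^~ u) t0 t - f' u)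
    @[t --> dnbhs01 t0] --> (0 : R).

Definition continuous01 (E F : innerType R) (f : R -> E -> F) (t0 : R) : Prop :=
  continuous_on01 setT (@hnorm R E) f t0.

Definition derivative01 (E F : innerType R) (f : R -> E -> F) (t0 : R)
    (f' : E -> F) : Prop :=
  derivative_on01 setT (@hnorm R E) f t0 f'.

Definition scalar_derivative01 (l : R -> R[i]) (t0 : R) (l' : R[i]) : Prop :=
  let C : numFieldType := R[i] in
  (diff_quot (l : R -> R[i]^o) t0 t : C) @[t --> dnbhs01 t0] --> (l' : C).

Definition isolates (S : set R[i]) (z : R[i]) (r : R) : Prop :=
  0 < r /\ forall w, S w -> `|w - z| <= r%:C -> w = z.

Definition isolated_eigenvalue (E : innerType R) (B : operator E E) (z : R[i])
    (m : nat) : Prop :=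
  [/\ (0 < m)%N, Spec B z, exists r, isolates (Spec B) z r &
      has_dim (eigen_ker B z) m].

(* The spectrum of B in the closed disc of center z and radius r consists of the
   eigenvalues mu_1, ..., mu_m, listed with multiplicity. *)
Definition eigenvalues_in_disc (E : innerType R) (B : operator E E) (z : R[i])
    (r : R) (m : nat) (mu : 'I_m -> R[i]) : Prop :=
  [/\ forall j, `|mu j - z| <= r%:C,
      forall w, Spec B w -> `|w - z| <= r%:C -> exists j, w = mu j &
      forall w, `|w - z| <= r%:C ->
        has_dim (eigen_ker B w) #|[set j | mu j == w]%SET|].

End Families.

(* Main.v *)
(* For u in dom(A_t) the vector T_t u lies in ker [X_t, Y_t], hence equals
   (- Y_t^* phi, X_t^* phi) with phi = W(X_t, Y_t) T_t u. Inserting this into the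
   Green identity expresses <H_s u, v> - <u, H_t v>, for u in dom(A_s) and v in
   dom(A_t), through V_s - V_t, X_t Y_s^* - Y_t X_s^* and T_t - T_s; Krein's formula
   is the case u = R_s(z) f, v = R_t(conj z) g. It is used throughout in this weak
   form: since |phi| <= C |T_t u| uniformly in t near t_0, and the resolvents at a
   non-real point are uniformly bounded, it yields first the continuity and then
   the derivative of R_t.

   The eigenvalues near lambda are read off the bounded symmetric operators
   S_t = 1 + rho R_t(lambda + rho), a Moebius function of H_t that maps lambda to 0.
   No spectral projection is needed. S_t has m orthonormal eigenvectors e_i with
   small eigenvalues a_i, and is bounded below on their complement. If u_j is an
   orthonormal basis of ker(H_{t_0} - lambda) diagonalizing the derivative S' with
   entries d_j, then (a_i - tau d_j) <u_j, e_i> = o(tau) for tau = t - t_0. The matrix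
   (<u_j, e_i>) is almost unitary, so its Leibniz determinant has a large term; the
   permutation of that term gives the labeling with a_i = tau d_i + o(tau). *)
Require Import Defs.
From mathcomp Require Import all_boot all_order all_algebra.
From mathcomp Require Import complex.
From mathcomp Require Import all_classical all_reals all_analysis.
From mathcomp Require Import perm ring lra.

Import Order.TTheory GRing.Theory Num.Theory.
Import numFieldNormedType.Exports.

Local Open Scope classical_set_scope.
Local Open Scope complex_scope.
Local Open Scope ring_scope.

Set Implicit Arguments.
Unset Strict Implicit.
Unset Printing Implicit Defensive.

(** Differentiability is assumed at the single point t_0, so analytic perturbation theory does not
    apply: the eigenvalues are chosen separately at each t, and only an o(t - t_0) estimate ties
    them together. The domains of the H_t vary with t, so these operators are compared through their
    resolvents only. Self-adjointness bounds the resolvents uniformly in t at non-real points. The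
    argument therefore bootstraps: continuity is proved at points with uniformly bounded resolvents,
    applied at i, and continuity at i then shows that every point of the resolvent set of H_{t_0} is
    of this kind. In place of a functional calculus, spectral information is kept as lower bounds
    |(S - b) u| >= c |u|. They survive small perturbations, and also the addition of finitely many
    dimensions as long as injectivity is known. The number rho is an isolating radius: the pole
    lambda + rho lies in the resolvent set, and every b with 0 < |b| < 1/2 corresponds to a point of
    the disc other than lambda. This is the origin of the gap 1/2 of S_{t_0} at 0. *)

Local Notation normc := Normc.normc.
Local Notation re := complex.Re.
Local Notation lsubspace := Defs.subspace.

(** * Complex numbers and inner products *)

Section ComplexFacts.
Variable R : realType.
Implicit Types (a b : R[i]) (x y : R).

Lemma normcEC a : `|a| = (normc a)%:C. Proof. by []. Qed.

Lemma normc_ge0 a : 0 <= normc a.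
Proof. by rewrite -ler0c -normcEC. Qed.

Lemma normc_eq0 a : (normc a == 0) = (a == 0).
Proof. by rewrite -[RHS]normr_eq0 normcEC -(inj_eq (@complexI R)). Qed.

Lemma normcM a b : normc (a * b) = normc a * normc b.
Proof. by apply: complexI; rewrite rmorphM -!normcEC normrM. Qed.

Lemma normcD a b : normc (a + b) <= normc a + normc b.
Proof. by rewrite -lecR rmorphD -!normcEC ler_normD. Qed.

Lemma normc_sum (I : Type) (r : seq I) (P : pred I) (f : I -> R[i]) :
  normc (\sum_(i <- r | P i) f i) <= \sum_(i <- r | P i) normc (f i).
Proof.
by rewrite -lecR rmorph_sum -normcEC; apply: le_trans (ler_norm_sum _ _ _) _.
Qed.

Lemma normc_prod (I : Type) (r : seq I) (P : pred I) (f : I -> R[i]) :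
  normc (\prod_(i <- r | P i) f i) = \prod_(i <- r | P i) normc (f i).
Proof. by apply: complexI; rewrite rmorph_prod -normcEC normr_prod. Qed.

Lemma normcN a : normc (- a) = normc a.
Proof. by apply: complexI; rewrite -!normcEC normrN. Qed.

Lemma normcC a : normc (Num.conj a) = normc a.
Proof. by apply: complexI; rewrite -!normcEC norm_conjC. Qed.

Lemma normcR x : normc x%:C = `|x|.
Proof. by rewrite /= expr0n addr0 sqrtr_sqr. Qed.

Lemma normc1 : normc (1 : R[i]) = 1.
Proof. by apply: complexI; rewrite -!normcEC normr1. Qed.

Lemma conjCR x : Num.conj (x%:C) = x%:C :> R[i].
Proof. by apply: conj_Creal; rewrite complex_real. Qed.

Lemma sqr_normcE a : ((normc a) ^+ 2)%:C = a * Num.conj a.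
Proof. by rewrite rmorphXn -normCK normcEC. Qed.

Lemma reD a b : re (a + b) = re a + re b.
Proof. by case: a b => [? ?] []. Qed.

Lemma reN a : re (- a) = - re a. Proof. by case: a. Qed.

Lemma reB a b : re (a - b) = re a - re b. Proof. by rewrite reD reN. Qed.

Lemma reMl x a : re (x%:C * a) = x * re a.
Proof. by case: a => p q /=; rewrite mul0r subr0. Qed.

Lemma re_conj a : re (Num.conj a) = re a. Proof. by case: a. Qed.

Lemma im_conj a : complex.Im (Num.conj a) = - complex.Im a. Proof. by case: a. Qed.

Lemma normc_ge_re a : `|re a| <= normc a.
Proof. by rewrite -lecR normc_ge_Re. Qed.

Lemma real_im0 a : complex.Im a = 0 -> a = (re a)%:C.
Proof. by case: a => x y /= ->. Qed.

End ComplexFacts.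

Section InnerFacts.
Variable R : realType.
Implicit Types E F : innerType R.

Lemma inDl E (u v w : E) : '[u + v, w] = '[u, w] + '[v, w].
Proof. exact: linearDl. Qed.
Lemma inDr E (u v w : E) : '[w, u + v] = '[w, u] + '[w, v].
Proof. exact: linearDr. Qed.
Lemma inNl E (u w : E) : '[- u, w] = - '[u, w].
Proof. exact: linearNl. Qed.
Lemma inNr E (u w : E) : '[w, - u] = - '[w, u].
Proof. exact: linearNr. Qed.
Lemma inBl E (u v w : E) : '[u - v, w] = '[u, w] - '[v, w].
Proof. exact: linearBl. Qed.
Lemma inBr E (u v w : E) : '[w, u - v] = '[w, u] - '[w, v].
Proof. exact: linearBr. Qed.
Lemma in0l E (w : E) : '[0, w] = 0.
Proof. exact: linear0l. Qed.
Lemma in0r E (w : E) : '[w, 0] = 0.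
Proof. exact: linear0r. Qed.
Lemma inZl E (a : R[i]) (u w : E) : '[a *: u, w] = a * '[u, w].
Proof. exact: linearZl_LR. Qed.
Lemma inZr E (a : R[i]) (u w : E) : '[w, a *: u] = Num.conj a * '[w, u].
Proof. exact: linearZr_LR. Qed.
Lemma inC E (u v : E) : '[u, v] = Num.conj '[v, u].
Proof. by rewrite {1}hermC expr0 mul1r. Qed.
Lemma in_suml E (I : Type) (r : seq I) (P : pred I) (f : I -> E) (w : E) :
  '[\sum_(i <- r | P i) f i, w] = \sum_(i <- r | P i) '[f i, w].
Proof.
elim/big_rec2: _ => [|i x y _ <-]; first exact: in0l.
by rewrite inDl.
Qed.
Lemma in_sumr E (I : Type) (r : seq I) (P : pred I) (f : I -> E) (w : E) :
  '[w, \sum_(i <- r | P i) f i] = \sum_(i <- r | P i) '[w, f i].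
Proof.
elim/big_rec2: _ => [|i x y _ <-]; first exact: in0r.
by rewrite inDr.
Qed.

Lemma hnorm_ge0 E (u : E) : 0 <= hnorm u. Proof. exact: sqrtr_ge0. Qed.
Hint Resolve hnorm_ge0 : core.

Lemma sqr_hnorm E (u : E) : (hnorm u ^+ 2)%:C = '[u, u].
Proof.
have /[dup] h : 0 <= '[u, u] := dnorm_ge0 _ u.
rewrite lecE => /andP[/eqP i0 r0].
by rewrite sqr_sqrtr// [RHS]real_im0.
Qed.

Lemma re_inner E (u : E) : re '[u, u] = hnorm u ^+ 2.
Proof. by rewrite -sqr_hnorm. Qed.

Lemma hnorm_eq0 E (u : E) : (hnorm u == 0) = (u == 0).
Proof.
rewrite -(dnorm_eq0 (inner : {dot E for Num.conj}) u) -[X in _ = (X == _)]sqr_hnorm.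
by rewrite -[0 in RHS]/((0 : R)%:C) (inj_eq (@complexI R)) sqrf_eq0.
Qed.

Lemma hnorm0_eq0 E (u : E) : hnorm u <= 0 -> u = 0.
Proof. by move=> u0; apply/eqP; rewrite -hnorm_eq0 eq_le u0/=. Qed.

Lemma hnorm0 E : hnorm (0 : E) = 0.
Proof. by apply/eqP; rewrite hnorm_eq0. Qed.

Lemma hnorm_gt0 E (u : E) : (0 < hnorm u) = (u != 0).
Proof. by rewrite lt_def hnorm_eq0 hnorm_ge0 andbT. Qed.

Lemma hnormZ E (a : R[i]) (u : E) : hnorm (a *: u) = normc a * hnorm u.
Proof.
apply/eqP; rewrite -(@eqrXn2 _ 2) ?mulr_ge0 ?normc_ge0//.
rewrite -(inj_eq (@complexI R)) sqr_hnorm inZl inZr exprMn rmorphM /=.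
by rewrite sqr_normcE sqr_hnorm mulrA.
Qed.

Lemma hnormZR E (a : R) (u : E) : hnorm (a%:C *: u) = `|a| * hnorm u.
Proof. by rewrite hnormZ normcR. Qed.

Lemma hnormN E (u : E) : hnorm (- u) = hnorm u.
Proof. by rewrite /hnorm inNl inNr opprK. Qed.

Lemma hnormBC E (u v : E) : hnorm (u - v) = hnorm (v - u).
Proof. by rewrite -hnormN opprB. Qed.

Lemma hnormD_sqr E (u v : E) :
  hnorm (u + v) ^+ 2 = hnorm u ^+ 2 + 2 * re '[u, v] + hnorm v ^+ 2.
Proof.
rewrite -!re_inner inDl !inDr !reD (inC v u) re_conj.
by ring.
Qed.

Lemma hnormB_sqr E (u v : E) :
  hnorm (u - v) ^+ 2 = hnorm u ^+ 2 - 2 * re '[u, v] + hnorm v ^+ 2.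
Proof. by rewrite hnormD_sqr hnormN inNr reN mulrN. Qed.

Lemma parallelogram E (u v : E) :
  hnorm (u + v) ^+ 2 + hnorm (u - v) ^+ 2 = 2 * hnorm u ^+ 2 + 2 * hnorm v ^+ 2.
Proof. rewrite hnormD_sqr hnormB_sqr; by ring. Qed.

Lemma pythagoras E (u v : E) : '[u, v] = 0 ->
  hnorm (u + v) ^+ 2 = hnorm u ^+ 2 + hnorm v ^+ 2.
Proof. by move=> uv0; rewrite hnormD_sqr uv0 mulr0 addr0. Qed.

Lemma cauchy_schwarz E (u v : E) : normc '[u, v] <= hnorm u * hnorm v.
Proof.
have [->|v0] := eqVneq v 0; first by rewrite in0r hnorm0 mulr0 -lecR -normcEC normr0.
pose c := '[u, v]; pose n := hnorm v ^+ 2.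
have n0 : 0 < n by rewrite exprn_gt0// hnorm_gt0.
(* This vector is |v|^2 times the component of u orthogonal to v; the factor avoids a division. *)
have : 0 <= hnorm (n%:C *: u - c *: v) ^+ 2 by exact: sqr_ge0.
rewrite hnormB_sqr hnormZR hnormZ inZl inZr -/c -/n exprMn exprMn.
rewrite [Num.conj c * c]mulrC -sqr_normcE -rmorphM /= gtr0_norm// -/n => h.
have {h}: 0 <= n * (n * hnorm u ^+ 2 - normc c ^+ 2).
  by apply: le_trans h _; rewrite le_eqVlt; apply/orP; left; apply/eqP; ring.
rewrite pmulr_rge0// subr_ge0 => h.
by rewrite -(@ler_pXn2r _ 2) ?nnegrE ?mulr_ge0 ?normc_ge0// exprMn mulrC.
Qed.

Lemma hnorm_triangle E (u v : E) : hnorm (u + v) <= hnorm u + hnorm v.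
Proof.
rewrite -(@ler_pXn2r _ 2) ?nnegrE ?addr_ge0// hnormD_sqr sqrrD.
have := le_trans (ler_norm _) (le_trans (normc_ge_re _) (cauchy_schwarz u v)).
by lra.
Qed.

Lemma hnorm_triangleB E (u v : E) : hnorm (u - v) <= hnorm u + hnorm v.
Proof. by rewrite -(hnormN v); exact: hnorm_triangle. Qed.

Lemma hnorm_distD E (u v w : E) : hnorm (u - w) <= hnorm (u - v) + hnorm (v - w).
Proof. by rewrite (le_trans _ (hnorm_triangle _ _))// addrA subrK. Qed.

Lemma hnorm_sub E (u v : E) : hnorm u - hnorm v <= hnorm (u - v).
Proof.
by rewrite lerBlDr -[in leLHS](subrK v u); exact: hnorm_triangle.
Qed.

(** Test with [u = w]. Bounds for adjoints and for operators known only weakly are obtained this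
    way. *)
Lemma hnorm_le_rep E (w : E) (M : R) : 0 <= M ->
  (forall u, normc '[u, w] <= M * hnorm u) -> hnorm w <= M.
Proof.
move=> M0 h; have [->|w0] := eqVneq w 0; first by rewrite hnorm0.
have := h w; rewrite -sqr_hnorm normcR ger0_norm ?sqr_ge0// expr2.
by rewrite ler_pM2r// hnorm_gt0.
Qed.

Lemma inner_eq E (v w : E) : (forall u, '[u, v] = '[u, w]) -> v = w.
Proof.
move=> h; apply/eqP; rewrite -subr_eq0; apply/eqP/hnorm0_eq0.
by apply: hnorm_le_rep => // u; rewrite inBr h subrr mul0r -lecR -normcEC normr0.
Qed.

Lemma inner_eql E (v w : E) : (forall u, '[v, u] = '[w, u]) -> v = w.
Proof. by move=> h; apply: inner_eq => u; rewrite inC h -inC. Qed.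

Lemma inner0_eq0 E (v : E) : (forall u, '[u, v] = 0) -> v = 0.
Proof. by move=> h; apply: inner_eq => u; rewrite h in0r. Qed.

Lemma prod_innerE E F (f g : (E * F)%type) : '[f, g] = '[f.1, g.1] + '[f.2, g.2].
Proof. by []. Qed.

Lemma hnorm_prod E F (f : (E * F)%type) : hnorm f ^+ 2 = hnorm f.1 ^+ 2 + hnorm f.2 ^+ 2.
Proof. by rewrite -!re_inner prod_innerE reD. Qed.

Lemma hnorm_pair E F (f : (E * F)%type) : hnorm f <= hnorm f.1 + hnorm f.2.
Proof.
rewrite -(@ler_pXn2r _ 2) ?nnegrE ?addr_ge0// hnorm_prod sqrrD.
have := mulr_ge0 (hnorm_ge0 f.1) (hnorm_ge0 f.2); lra.
Qed.

Lemma hnorm_J E (f : (E * E)%type) : hnorm (J f) = hnorm f.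
Proof.
apply/eqP; rewrite -(@eqrXn2 _ 2)// !hnorm_prod /= hnormN addrC.
exact: eqxx.
Qed.

End InnerFacts.
#[export] Hint Resolve hnorm_ge0 : core.
#[export] Hint Resolve normc_ge0 : core.

(** * Convergence and completeness in terms of [hnorm] *)

Section Sequences.
Variable R : realType.
Implicit Types E F : innerType R.

(** Stated through [hnorm] so that it makes sense in every [innerType], in particular in products
    with their inner product norm. *)
Definition hcvg E (u : nat -> E) (l : E) : Prop :=
  forall e : R, 0 < e -> exists N, forall n, (N <= n)%N -> hnorm (u n - l) < e.

Definition hcauchy E (u : nat -> E) : Prop :=
  forall e : R, 0 < e -> exists N, forall m n, (N <= m)%N -> (N <= n)%N ->
    hnorm (u m - u n) < e.

Definition hcomplete E (D : set E) : Prop :=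
  forall u : nat -> E, (forall n, D (u n)) -> hcauchy u ->
    exists2 l, D l & hcvg u l.

Definition hclosed E (D : set E) : Prop :=
  forall (u : nat -> E) l, (forall n, D (u n)) -> hcvg u l -> D l.

Lemma small_inv_nat (e : R) : 0 < e ->
  exists N, forall n, (N <= n)%N -> n.+1%:R^-1 < e.
Proof.
move=> e0; pose N := Num.Def.truncn e^-1; exists N => n Nn.
rewrite -[e]invrK ltf_pV2 ?posrE ?invr_gt0// ?ltr0n//.
rewrite (lt_le_trans (truncnS_gt _))// ler_nat ltnS//.
Qed.

Lemma le_of_sqr (a b : R) : 0 <= b -> a ^+ 2 <= b ^+ 2 -> a <= b.
Proof.
move=> b0 ab; rewrite (le_trans (ler_norm a))// -(ger0_norm b0).
by rewrite -(@ler_pXn2r _ 2) ?nnegrE ?normr_ge0// !real_normK ?num_real.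
Qed.

Lemma eps_le0 (x : R) : (forall e, 0 < e -> x <= e) -> x <= 0.
Proof.
move=> h; rewrite leNgt; apply/negP => x0.
by have := h (x / 2); rewrite divr_gt0// => /(_ isT); lra.
Qed.

Lemma hcvg_bounded_image E F (D : set E) (f : E -> F) (M : R) (u : nat -> E) l :
  (forall x y, D x -> D y -> hnorm (f x - f y) <= M * hnorm (x - y)) ->
  (forall n, D (u n)) -> D l -> hcvg u l -> hcvg (f \o u) (f l).
Proof.
move=> fM Du Dl ul e e0.
have M0 : 0 < `|M| + 1 by rewrite ltr_wpDl.
have [|N hN] := ul (e / (`|M| + 1)); first by rewrite divr_gt0.
exists N => n /hN; rewrite ltr_pdivlMr// => h /=.
rewrite (le_lt_trans (fM _ _ _ _))// (le_lt_trans _ h)// mulrC.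
by apply: ler_wpM2l; rewrite ?hnorm_ge0// ler_wpDr// ler_norm.
Qed.

Lemma hcvgD E (u v : nat -> E) l k :
  hcvg u l -> hcvg v k -> hcvg (fun n => u n + v n) (l + k).
Proof.
move=> ul vk e e0; have e2 : 0 < e / 2 by rewrite divr_gt0.
have [N hN] := ul _ e2; have [K hK] := vk _ e2.
exists (maxn N K) => n; rewrite geq_max => /andP[/hN h1 /hK h2].
by rewrite opprD addrACA (le_lt_trans (hnorm_triangle _ _))// (splitr e) ltrD.
Qed.

Lemma hcvgZ E (a : R[i]) (u : nat -> E) l :
  hcvg u l -> hcvg (fun n => a *: u n) (a *: l).
Proof.
move=> ul.
apply: (@hcvg_bounded_image _ _ setT ( *:%R a) (normc a)) => // x y _ _.
by rewrite -scalerBr hnormZ.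
Qed.

Lemma hcvg_cst E (x : E) : hcvg (fun=> x) x.
Proof. by move=> e e0; exists 0%N => n _; rewrite subrr hnorm0. Qed.

Lemma hcvgB E (u v : nat -> E) l k :
  hcvg u l -> hcvg v k -> hcvg (fun n => u n - v n) (l - k).
Proof.
move=> ul vk e e0; have [N hN] := hcvgD ul (hcvgZ (-1) vk) e0.
by exists N => n /hN; rewrite !scaleN1r.
Qed.

Lemma hcvg_inner E (u : nat -> E) l (v : E) :
  hcvg u l -> (forall n, '[u n, v] = 0) -> '[l, v] = 0.
Proof.
move=> ul uv; apply/eqP; rewrite -normc_eq0 eq_le normc_ge0 andbT.
apply: eps_le0 => e e0.
have v0 : 0 < hnorm v + 1 by rewrite ltr_wpDl ?hnorm_ge0.
have [|N hN] := ul (e / (hnorm v + 1)); first by rewrite divr_gt0.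
have := hN N (leqnn _); rewrite ltr_pdivlMr// => h.
have -> : '[l, v] = - '[u N - l, v] by rewrite inBl uv sub0r opprK.
rewrite normcN (le_trans (cauchy_schwarz _ _))// (le_trans _ (ltW h))//.
by apply: ler_wpM2l; rewrite ?hnorm_ge0// lerDl.
Qed.

Lemma hcvg_innerE E (u v : nat -> E) l k (x y : E) :
  hcvg u l -> hcvg v k -> (forall n, '[u n, x] = '[v n, y]) -> '[l, x] = '[k, y].
Proof.
move=> ul vk h.
(* Equality of the two inner products is orthogonality of the pair to (x, - y), which passes to the
   limit. *)
have w : hcvg (fun n => (u n, v n) : (E * E)%type) (l, k).
  move=> e e0; have e2 : 0 < e / 2 by rewrite divr_gt0.
  have [N hN] := ul _ e2; have [K hK] := vk _ e2.
  exists (maxn N K) => n; rewrite geq_max => /andP[/hN h1 /hK h2].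
  by rewrite (le_lt_trans (hnorm_pair _))// (splitr e) ltrD.
have /= := hcvg_inner w (v := (x, - y)).
rewrite prod_innerE /= inNr => h0; apply/eqP; rewrite -subr_eq0 h0// => n.
by rewrite prod_innerE /= inNr h subrr.
Qed.

Lemma hnorm_hcvg_le E (u : nat -> E) l (M : R) :
  hcvg u l -> (forall e : R, 0 < e -> exists N, forall n, (N <= n)%N -> hnorm (u n) <= M + e) ->
  hnorm l <= M.
Proof.
move=> ul h; rewrite -subr_le0; apply: eps_le0 => e e0.
have e2 : 0 < e / 2 by rewrite divr_gt0.
have [N hN] := ul _ e2; have [K hK] := h _ e2.
have := hN _ (leq_maxl N K); have := hK _ (leq_maxr N K).
set w := u _ => h1; rewrite hnormBC => h2.
have := hnorm_triangle w (l - w); rewrite addrC subrK; lra.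
Qed.

Lemma hclosed_complete E (D : set E) :
  hcomplete [set: E] -> hclosed D -> hcomplete D.
Proof.
move=> cE cD u Du cu; have [//|l _ ul] := cE u _ cu.
by exists l => //; exact: cD ul.
Qed.

End Sequences.

(** * Orthogonal projection and adjoints *)

Section Projection.
Variable R : realType.
Implicit Types E F : innerType R.

(** A minimizing sequence is Cauchy by the parallelogram identity, and a variation of its limit
    gives orthogonality. *)
Lemma projection E (D : set E) (x : E) : lsubspace D -> hcomplete D ->
  exists2 p, D p & forall y, D y -> '[x - p, y] = 0.
Proof.
move=> [D0 Dlin] cD.
have DD u v : D u -> D v -> D (u + v).
  by move=> Du Dv; rewrite -[u]scale1r; exact: Dlin.
have DZ a u : D u -> D (a *: u).
  by move=> Du; rewrite -[_ *: _]addr0; exact: Dlin.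
pose S := [set hnorm (x - y) ^+ 2 | y in D].
have infS : has_inf S.
  split; first by exists (hnorm (x - 0) ^+ 2), 0.
  by exists 0 => _ [y _ <-]; exact: sqr_ge0.
pose d := inf S.
have dle y : D y -> d <= hnorm (x - y) ^+ 2.
  by move=> Dy; apply: ge_inf; [case: infS | exists y].
have ex n : exists y, D y /\ hnorm (x - y) ^+ 2 < d + n.+1%:R^-1.
  have [|_ [y Dy <-] h] := @inf_adherent _ S n.+1%:R^-1 _ infS.
    by rewrite invr_gt0 ltr0n.
  by exists y.
have [y hy] := choice ex.
have dist m n : hnorm (y m - y n) ^+ 2 <= 2 * m.+1%:R^-1 + 2 * n.+1%:R^-1.
  have [Dm hm] := hy m; have [Dn hn] := hy n.
  have := parallelogram (x - y m) (x - y n).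
  rewrite (_ : x - y m - (x - y n) = y n - y m); last first.
    by rewrite opprB addrC addrA subrK.
  have -> : x - y m + (x - y n) = (2%:R)%:C *: (x - (2%:R^-1)%:C *: (y m + y n)).
    rewrite scalerBr scalerA -rmorphM /= mulfV ?pnatr_eq0// scale1r.
    by rewrite rmorph_nat scaler_nat mulr2n opprD addrACA.
  rewrite hnormZR exprMn normr_nat (hnormBC (y n)).
  have := dle _ (DZ (2%:R^-1)%:C _ (DD _ _ Dm Dn)).
  move: hm hn; set a := _.+1%:R^-1; set b := _.+1%:R^-1; lra.
have cy : hcauchy y.
  move=> e e0; have [|N hN] := @small_inv_nat R (e ^+ 2 / 4).
    by rewrite divr_gt0// exprn_gt0.
  exists N => m n /hN hm /hN hn.
  have : hnorm (y m - y n) ^+ 2 < e ^+ 2.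
    apply: le_lt_trans (dist _ _) _.
    move: hm hn; move: (m.+1%:R^-1) (n.+1%:R^-1) (e ^+ 2) => a b q; lra.
  by rewrite ltr_pXn2r ?nnegrE ?hnorm_ge0 ?(ltW e0).
have [|p Dp yp] := cD y _ cy; first by move=> n; case: (hy n).
have pd : hnorm (x - p) ^+ 2 <= d.
  have d0 : 0 <= d by apply: lb_le_inf; [case: infS | move=> _ [? _ <-]; exact: sqr_ge0].
  rewrite -[d]sqr_sqrtr// ler_pXn2r ?nnegrE ?sqrtr_ge0//.
  have c : hcvg (fun n => x - y n) (x - p).
    exact: hcvgB (hcvg_cst x) yp.
  apply: (hnorm_hcvg_le c) => e e0.
  have [|N hN] := @small_inv_nat R (e ^+ 2); first by rewrite exprn_gt0.
  exists N => n /hN h; have [_ h2] := hy n.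
  have s0 := sqrtr_ge0 d.
  apply: le_of_sqr; first by rewrite addr_ge0// ltW.
  rewrite sqrrD (sqr_sqrtr d0).
  by move: h h2 (mulr_ge0 s0 (ltW e0)); move: (n.+1%:R^-1) => b; lra.
exists p => // v Dv; apply/eqP; rewrite -normc_eq0.
set c := '[x - p, v]; pose k := normc c ^+ 2.
have k0 : 0 <= k by exact: sqr_ge0.
(* Moving from p to p + s c v changes the squared distance by - s |c|^2 (2 - s |v|^2); this [s]
   keeps the bracket positive, so c must vanish. *)
pose s := (hnorm v ^+ 2 + 1)^-1.
have s0 : 0 < s by rewrite invr_gt0 ltr_wpDl// sqr_ge0.
have sv : s * hnorm v ^+ 2 <= 1.
  by rewrite mulrC ler_pdivrMr ?ltr_wpDl ?sqr_ge0// mul1r lerDl.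
have := le_trans pd (dle _ (DD _ _ Dp (DZ (s%:C * c) _ Dv))).
rewrite opprD addrA [hnorm (x - p - _) ^+ 2]hnormB_sqr inZr -/c rmorphM /= conjCR -mulrA [Num.conj c * c]mulrC.
rewrite -sqr_normcE -/k reMl /= hnormZ normcM normcR gtr0_norm// exprMn exprMn -/k.
move=> h; rewrite -sqrf_eq0 -/k eq_le k0 andbT.
have : s * k * (2 - s * hnorm v ^+ 2) <= 0 by nra.
rewrite -mulrA pmulr_rle0// => h2.
by nra.
Qed.

Lemma riesz E (f : E -> R[i]) (M : R) : hcomplete [set: E] ->
  (forall a u v, f (a *: u + v) = a * f u + f v) ->
  (forall u, normc (f u) <= M * hnorm u) -> exists w, forall u, f u = '[u, w].
Proof.
move=> cE fl fM.
have f0 : f 0 = 0.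
  have := fl 1 0 0; rewrite scaler0 addr0 mul1r => /eqP.
  by rewrite -subr_eq0 opprD addrA subrr add0r oppr_eq0 => /eqP.
have fB u v : f (u - v) = f u - f v.
  by rewrite addrC -scaleN1r fl mulN1r addrC.
have sK : lsubspace [set u | f u = 0].
  by split=> // a u v /= fu fv; rewrite fl fu fv mulr0 addr0.
have cK : hcomplete [set u | f u = 0].
  apply: hclosed_complete => // u l /= fu ul; apply/eqP.
  rewrite -normc_eq0 eq_le normc_ge0 andbT; apply: eps_le0 => e e0.
  have M0 : 0 < `|M| + 1 by rewrite ltr_wpDl.
  have [|N hN] := ul (e / (`|M| + 1)); first by rewrite divr_gt0.
  have := hN N (leqnn _); rewrite ltr_pdivlMr// => h.
  have -> : f l = - f (u N - l) by rewrite fB fu sub0r opprK.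
  rewrite normcN (le_trans (fM _))// (le_trans _ (ltW h))// mulrC.
  by apply: ler_wpM2l; rewrite ?hnorm_ge0// ler_wpDr// ler_norm.
have [h|/existsNP[x fx]] := pselect (forall u, f u = 0).
  by exists 0 => u; rewrite h in0r.
have [p /= fp hp] := projection x sK cK.
set n := x - p in hp; have fn : f n = f x by rewrite fB fp subr0.
have n0 : '[n, n] != 0.
  rewrite -sqr_hnorm -[0]/((0 : R)%:C) (inj_eq (@complexI R)) sqrf_eq0 hnorm_eq0.
  by apply/eqP => n0; apply: fx; rewrite -fn n0 f0.
exists ((Num.conj (f n) / '[n, n]) *: n) => u.
have fn0 : f n != 0 by rewrite fn; apply/eqP.
rewrite inZr rmorphM /= conjCK fmorphV /= -[Num.conj '[n, n]]inC.
have : '[u - (f u / f n) *: n, n] = 0.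
  rewrite inC hp ?conjC0//= fB -[_ *: n]addr0 fl f0 addr0 divfK ?subrr//.
rewrite inBl inZl => /eqP; rewrite subr_eq0 => /eqP ->.
by field; rewrite fn0 n0.
Qed.

End Projection.

(** * Hilbert spaces as complete inner product spaces; dense sets *)

Section HilbertBridge.
Variable R : realType.
Implicit Types H : hilbertType R.

Lemma normr_hnorm H (x : H) : `|x| = (hnorm x)%:C.
Proof.
apply/eqP; rewrite -(@eqrXn2 _ 2) ?ler0c ?hnorm_ge0//.
by rewrite norm_inner -rmorphXn /= sqr_hnorm.
Qed.

Lemma hilbert_complete H : hcomplete [set: H].
Proof.
move=> u _ cu.
have cF : cauchy (u @ \oo).
  apply: cauchy_exP => e e0.
  have ee : e = (re e)%:C by rewrite [LHS]real_im0// ger0_Im// ltW.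
  have re0 : 0 < re e by move: e0; rewrite {1}ee ltcR.
  have [N hN] := cu _ re0.
  exists (u N); exists N => // n /= Nn; rewrite -ball_normE /=.
  by rewrite normr_hnorm ee ltcR hN.
have /cauchy_cvgP/cvg_ex[l ul] := cF.
exists l => // e e0.
have /cvgrPdist_lt/(_ e%:C) := ul; rewrite ltcR => /(_ e0)[N _ hN].
by exists N => n Nn; have := hN n Nn; rewrite /= normr_hnorm ltcR hnormBC.
Qed.

Lemma dense_hnorm H (D : set H) : dense D ->
  forall (u : H) (e : R), 0 < e -> exists2 v, D v & hnorm (u - v) < e.
Proof.
move=> dD u e e0.
have [||v [/= bv Dv]] := dD (ball u e%:C).
- by exists u; apply: ballxx; rewrite ltcR.
- by apply: ball_open; rewrite ltcR.
exists v => //; move: bv; rewrite -ball_normE /= normr_hnorm ltcR //.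
Qed.

(** For v in D close to w, |w|^2 = <w - v, w> <= |w - v| |w|. *)
Lemma dense_orth H (D : set H) (w : H) : dense D ->
  (forall u, D u -> '[u, w] = 0) -> w = 0.
Proof.
move=> dD h; apply/hnorm0_eq0/eps_le0 => e e0.
have [v Dv wv] := dense_hnorm dD w e0.
have [->|w0] := eqVneq w 0; first by rewrite hnorm0 ltW.
have : (hnorm w ^+ 2)%:C = '[w - v, w] by rewrite sqr_hnorm inBl (h _ Dv) subr0.
move=> /(congr1 (@normc R)); rewrite normcR ger0_norm ?sqr_ge0// => hw.
have := cauchy_schwarz (w - v) w; rewrite -hw expr2 ler_pM2r ?hnorm_gt0// => h2.
by rewrite ltW// (le_lt_trans h2).
Qed.

End HilbertBridge.

(** * Linear maps, bounds and adjoints *)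

Section LinearFacts.
Variable R : realType.
Implicit Types E F G : innerType R.

Lemma ler_hn E (a b : R) (u : E) : a <= b -> a * hnorm u <= b * hnorm u.
Proof. by move=> ab; apply: ler_wpM2r => //; exact: hnorm_ge0. Qed.

Lemma sub0 E (D : set E) : lsubspace D -> D 0. Proof. by case. Qed.
Lemma subD E (D : set E) u v : lsubspace D -> D u -> D v -> D (u + v).
Proof. by move=> [_ h] Du Dv; rewrite -[u]scale1r; exact: h. Qed.
Lemma subZ E (D : set E) a u : lsubspace D -> D u -> D (a *: u).
Proof. by move=> [D0 h] Du; rewrite -[_ *: _]addr0; exact: h. Qed.
Lemma subN E (D : set E) u : lsubspace D -> D u -> D (- u).
Proof. by move=> hD Du; rewrite -scaleN1r; exact: subZ. Qed.
Lemma subB E (D : set E) u v : lsubspace D -> D u -> D v -> D (u - v).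
Proof. by move=> hD Du Dv; apply: subD => //; exact: subN. Qed.
Lemma sub_sum E (D : set E) (I : Type) (r : seq I) (P : pred I) (f : I -> E) :
  lsubspace D -> (forall i, D (f i)) -> D (\sum_(i <- r | P i) f i).
Proof.
move=> hD Df; elim/big_rec: _ => [|i x _ Dx]; first exact: sub0.
exact: subD.
Qed.

Section On.
Variables (E F : innerType R) (D : set E) (f : E -> F).
Hypothesis fl : linear_on D f.

Lemma lin_onD u v : D u -> D v -> f (u + v) = f u + f v.
Proof. by move=> Du Dv; rewrite -{1}[u]scale1r fl.2// scale1r. Qed.
Lemma lin_on0 : f 0 = 0.
Proof.
have D0 := sub0 fl.1; have := lin_onD D0 D0; rewrite addr0 => /eqP.
by rewrite -subr_eq0 opprD addrA subrr sub0r oppr_eq0 => /eqP.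
Qed.
Lemma lin_onZ a u : D u -> f (a *: u) = a *: f u.
Proof.
by move=> Du; have := fl.2 a u 0 Du (sub0 fl.1); rewrite lin_on0 !addr0.
Qed.
Lemma lin_onN u : D u -> f (- u) = - f u.
Proof. by move=> Du; rewrite -scaleN1r lin_onZ// scaleN1r. Qed.
Lemma lin_onB u v : D u -> D v -> f (u - v) = f u - f v.
Proof. by move=> Du Dv; rewrite lin_onD ?lin_onN//; exact: subN fl.1 _. Qed.
End On.

Definition lin E F (f : E -> F) : Prop := linear_on setT f.

Lemma lin_sum E F (f : E -> F) (I : Type) (r : seq I) (P : pred I) (g : I -> E) :
  lin f -> f (\sum_(i <- r | P i) g i) = \sum_(i <- r | P i) f (g i).
Proof.
move=> fl; elim/big_rec2: _ => [|i x y _ <-]; first exact: lin_on0 fl.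
by rewrite (lin_onD fl).
Qed.

Lemma linP E F (f : E -> F) :
  (forall a u v, f (a *: u + v) = a *: f u + f v) -> lin f.
Proof. by move=> h; split => // a u v _ _; exact: h. Qed.

Lemma lin_add E F (f g : E -> F) : lin f -> lin g -> lin (fun x => f x + g x).
Proof.
by move=> fl gl; apply: linP => a u v; rewrite fl.2// gl.2// scalerDr addrACA.
Qed.

Lemma lin_scale E F (a : R[i]) (f : E -> F) : lin f -> lin (fun x => a *: f x).
Proof.
move=> fl; apply: linP => b u v.
by rewrite fl.2// scalerDr !scalerA mulrC.
Qed.

Lemma lin_opp E F (f : E -> F) : lin f -> lin (fun x => - f x).
Proof.
by move=> fl; apply: linP => a u v; rewrite fl.2// opprD scalerN.
Qed.

Lemma lin_sub E F (f g : E -> F) : lin f -> lin g -> lin (fun x => f x - g x).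
Proof. by move=> fl gl; exact: lin_add fl (lin_opp gl). Qed.

Lemma lin_id E : lin (@id E). Proof. exact: linP. Qed.

Definition bnd E F (f : E -> F) (M : R) : Prop :=
  forall u, hnorm (f u) <= M * hnorm u.

Lemma bnd_ex E F (f : E -> F) : bounded_op f -> exists2 M, 0 < M & bnd f M.
Proof.
move=> [fl [M hM]]; exists (`|M| + 1); first by rewrite ltr_wpDl.
move=> u; rewrite (le_trans (hM u I))//; apply: ler_hn.
by rewrite ler_wpDr// ler_norm.
Qed.

Lemma bounded_opP E F (f : E -> F) M : lin f -> bnd f M -> bounded_op f.
Proof. by move=> fl fM; split=> //; exists M => u _; exact: fM. Qed.

Lemma lin_hnormB E F (f : E -> F) M (x y : E) : lin f -> bnd f M ->
  hnorm (f x - f y) <= M * hnorm (x - y).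
Proof. by move=> fl fM; rewrite -(lin_onB fl)//; exact: fM. Qed.

Lemma hcvg_lin E F (f : E -> F) M (u : nat -> E) l : lin f -> bnd f M ->
  hcvg u l -> hcvg (fun n => f (u n)) (f l).
Proof.
move=> fl fM; apply: (@hcvg_bounded_image _ _ _ setT f M) => // x y _ _.
exact: lin_hnormB.
Qed.

(** Whereas [adj] is defined by a choice, this relation can be reversed, passes to sums and limits,
    and forces both maps to be linear. *)
Definition adjoint_pair E F (f : E -> F) (g : F -> E) : Prop :=
  forall u v, '[f u, v] = '[u, g v].

Lemma adjoint_pairC E F (f : E -> F) g : adjoint_pair f g -> adjoint_pair g f.
Proof. by move=> h u v; rewrite inC -h -inC. Qed.

Lemma adjoint_pair_lin E F (f : E -> F) g : adjoint_pair f g -> lin g.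
Proof.
move=> h; apply: linP => a u v; apply: inner_eq => w.
by rewrite -h !inDr !inZr !h.
Qed.

Lemma adjoint_pair_lin_l E F (f : E -> F) g : adjoint_pair f g -> lin f.
Proof. by move=> /adjoint_pairC; exact: adjoint_pair_lin. Qed.

Lemma adjoint_pair_bnd E F (f : E -> F) g M : 0 <= M ->
  adjoint_pair f g -> bnd f M -> bnd g M.
Proof.
move=> M0 h fM v; apply: hnorm_le_rep; first by rewrite mulr_ge0 ?hnorm_ge0.
move=> u; rewrite -h (le_trans (cauchy_schwarz _ _))//.
by rewrite mulrAC; apply: ler_hn; exact: fM.
Qed.

Lemma adjointE E F (S : operator E F) v w :
  (forall w', (forall u, dom S u -> '[u, w'] = 0) -> w' = 0) ->
  (forall u, dom S u -> '[S u, v] = '[u, w]) ->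
  dom (adjoint S) v /\ adjoint S v = w.
Proof.
move=> dS h; split; first by exists w.
rewrite /adjoint /=; case: xgetP => [w' -> h'|/(_ w)//].
apply/eqP; rewrite -subr_eq0; apply/eqP/dS => u Du.
by rewrite inBr -h// -h'// subrr.
Qed.

Lemma adjoint_rep E F (S : operator E F) v : dom (adjoint S) v ->
  forall u, dom S u -> '[S u, v] = '[u, adjoint S v].
Proof.
move=> -[w hw]; rewrite /adjoint /=; case: xgetP => [w' -> h'|/(_ w)//].
exact: h'.
Qed.

Lemma adjE E F (f : E -> F) g : adjoint_pair f g -> adj f = g.
Proof.
move=> h; apply/funext => v; rewrite /adj.
have [] // := @adjointE _ _ (full f) v (g v).
by move=> w' hw'; apply: inner0_eq0 => u; exact: hw'.
Qed.

Lemma adj_pair E F (f : E -> F) : hcomplete [set: E] -> bounded_op f ->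
  adjoint_pair f (adj f).
Proof.
move=> cE fb u v; have [M M0 fM] := bnd_ex fb; have [fl _] := fb.
apply: (@adjoint_rep _ _ (full f)) => //.
have [||w hw] := @riesz _ _ (fun u => '[f u, v]) (M * hnorm v) cE.
- by move=> a x y; rewrite fl.2// inDl inZl.
- move=> x; rewrite (le_trans (cauchy_schwarz _ _))// mulrAC.
  by apply: ler_hn; exact: fM.
by exists w => x _; exact: hw.
Qed.

Lemma adj_bnd E F (f : E -> F) M : hcomplete [set: E] -> lin f -> 0 <= M ->
  bnd f M -> bnd (adj f) M.
Proof.
move=> cE fl M0 fM; apply: (adjoint_pair_bnd M0 _ fM).
by apply: adj_pair => //; exact: bounded_opP fM.
Qed.

End LinearFacts.

(** * Self-adjoint operators and their resolvents *)

Section SelfAdjoint.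
Variable R : realType.
Implicit Types H : innerType R.

(* For densely defined operators, self-adjointness is symmetry together with the
   maximality clause [sa_max]; the latter also forces the domain to be dense. *)
Record selfadj H (B : operator H H) : Prop := SelfAdj {
  sa_lin : linear_on (dom B) B;
  sa_sym : forall u v, dom B u -> dom B v -> '[B u, v] = '[u, B v];
  sa_max : forall v w, (forall u, dom B u -> '[B u, v] = '[u, w]) ->
    dom B v /\ B v = w }.

Lemma self_adjoint_selfadj (H : hilbertType R) (B : operator H H) :
  self_adjoint B -> selfadj B.
Proof.
move=> [Bl dB domB Badj]; split=> //.
  move=> u v Du Dv; rewrite (Badj _ Dv); apply: adjoint_rep => //.
  by rewrite -domB.
move=> v w h; have [] := @adjointE _ _ _ B v w _ h.
  by move=> w'; exact: dense_orth dB.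
by rewrite -domB => Dv; rewrite -Badj.
Qed.

Lemma selfadj_add H (B : operator H H) (V : H -> H) :
  selfadj B -> adjoint_pair V V -> selfadj (add_op B V).
Proof.
move=> [[Bs Bl] Bsym Bmax] Vs; have Vl := adjoint_pair_lin Vs; split.
- split=> // a u v Du Dv /=.
  by rewrite Bl// Vl.2// scalerDr addrACA.
- by move=> u v Du Dv /=; rewrite inDl inDr Bsym// Vs.
- move=> v w h; have [|Dv Bv] := Bmax v (w - V v).
    by move=> u Du; have := h u Du; rewrite /= inDl Vs inBr => <-; rewrite addrK.
  by split=> //=; rewrite Bv subrK.
Qed.

Lemma selfadj_full H (V : H -> H) : selfadj (full V) -> adjoint_pair V V.
Proof. by move=> h u v; exact: (sa_sym h). Qed.

Section OneOperator.
Variables (H : innerType R) (B : operator H H).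
Hypothesis Bsa : selfadj B.
Let Bl := sa_lin Bsa.

(** The symmetry relation against a fixed vector of the domain survives the limit, and maximality
    turns it back into membership in the graph. *)
Lemma sa_closed (u v : nat -> H) x y : (forall n, dom B (u n)) ->
  (forall n, B (u n) = v n) -> hcvg u x -> hcvg v y -> dom B x /\ B x = y.
Proof.
move=> Du Bu ux vy; apply: (sa_max Bsa) => w Dw; rewrite inC [RHS]inC.
congr Num.conj; apply: (hcvg_innerE ux vy) => n.
by rewrite -Bu (sa_sym Bsa).
Qed.

Lemma sa_inner_real u : dom B u -> complex.Im '[B u, u] = 0.
Proof.
move=> Du; have := inC (B u) u; rewrite -(sa_sym Bsa Du Du).
by case: '[B u, u] => a b /= [] /eqP; rewrite -addr_eq0 -mulr2n mulrn_eq0 => /eqP.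
Qed.

(** Because <B u, u> is real, the imaginary part of z contributes nothing to the real part of the
    cross term. Both the bound at non-real points and the symmetry under conjugation of z follow. *)
Lemma sa_shift_norm u (z : R[i]) : dom B u ->
  hnorm (B u - z *: u) ^+ 2 =
  hnorm (B u - (re z)%:C *: u) ^+ 2 + (complex.Im z * hnorm u) ^+ 2.
Proof.
move=> Du; rewrite ![hnorm (_ - _) ^+ 2]hnormB_sqr !inZr !hnormZ conjCR normcR.
rewrite [(re z)%:C * _](_ : _ = (re z * re '[B u, u])%:C); last first.
  by rewrite {1}(real_im0 (sa_inner_real Du)) -rmorphM.
rewrite (real_im0 (sa_inner_real Du)).
have n2 : normc z ^+ 2 = re z ^+ 2 + complex.Im z ^+ 2.
  by case: z => a b /=; rewrite sqr_sqrtr// addr_ge0// sqr_ge0.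
rewrite !exprMn n2 real_normK ?num_real//.
by case: z n2 => a b _ /=; ring.
Qed.

Lemma sa_shift_conj u (z : R[i]) : dom B u ->
  hnorm (B u - Num.conj z *: u) = hnorm (B u - z *: u).
Proof.
move=> Du; apply/eqP; rewrite -(@eqrXn2 _ 2) ?hnorm_ge0//.
by rewrite (sa_shift_norm (Num.conj z) Du) (sa_shift_norm z Du) re_conj im_conj mulNr sqrrN.
Qed.

Lemma sa_nonreal u (z : R[i]) : dom B u ->
  `|complex.Im z| * hnorm u <= hnorm (B u - z *: u).
Proof.
move=> Du; apply: le_of_sqr => //; rewrite sa_shift_norm//.
by rewrite !exprMn real_normK ?num_real// lerDr sqr_ge0.
Qed.

Lemma sa_shift_sym u v (z : R[i]) : dom B u -> dom B v ->
  '[B u - z *: u, v] = '[u, B v - Num.conj z *: v].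
Proof.
by move=> Du Dv; rewrite inBl inBr inZl inZr conjCK (sa_sym Bsa).
Qed.

(** On a complete space such a bound with c > 0 characterizes the resolvent set ([res_below],
    [below_resolvent_set]). Unlike mere membership it records the resolvent bound 1/c and is easily
    perturbed. *)
Definition below (z : R[i]) (c : R) : Prop :=
  forall u, dom B u -> c * hnorm u <= hnorm (B u - z *: u).

Lemma below_conj z c : below z c -> below (Num.conj z) c.
Proof. by move=> h u Du; rewrite sa_shift_conj//; exact: h. Qed.

Section Resolvent.
Variable z : R[i].
Hypothesis rz : resolvent_set B z.
Let Rz := resolvent B z.

Lemma resP f : dom B (Rz f) /\ B (Rz f) - z *: Rz f = f.
Proof.
have [[_ _ surj] _] := rz; have [|u Du uf] := surj f; first by [].
by rewrite /Rz /resolvent /op_inv; case: xgetP => [x ->//|/(_ u)] [].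
Qed.

Lemma res_dom f : dom B (Rz f). Proof. exact: (resP f).1. Qed.

Lemma res_eq f : B (Rz f) = f + z *: Rz f.
Proof. by rewrite -{2}(resP f).2 subrK. Qed.

Lemma resK u : dom B u -> Rz (B u - z *: u) = u.
Proof.
move=> Du; have [[_ inj _] _] := rz.
have [D1 E1] := resP (B u - z *: u).
by apply: inj; rewrite ?inE.
Qed.

Lemma res_bounded : bounded_op Rz. Proof. exact: rz.2. Qed.
Lemma res_lin : lin Rz. Proof. exact: rz.2.1. Qed.

Lemma res_below : exists2 c, 0 < c & below z c.
Proof.
have [M M0 hM] := bnd_ex res_bounded; exists M^-1; first by rewrite invr_gt0.
move=> u Du; rewrite mulrC ler_pdivrMr// mulrC.
by rewrite -{1}(resK Du); exact: hM.
Qed.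

Lemma res_bnd_of_below c : 0 < c -> below z c -> bnd Rz c^-1.
Proof.
move=> c0 h f; rewrite mulrC ler_pdivlMr// mulrC.
by rewrite (le_trans (h _ (res_dom f)))// (resP f).2.
Qed.

End Resolvent.

Lemma res_adj z : resolvent_set B z -> resolvent_set B (Num.conj z) ->
  adjoint_pair (resolvent B z) (resolvent B (Num.conj z)).
Proof.
move=> rz rz' f g.
rewrite -{1}(resP rz' g).2 -sa_shift_sym; last 2 first.
- exact: res_dom.
- exact: res_dom.
by rewrite (resP rz f).2.
Qed.

(** The bound makes the range of B - z complete. By maximality, a vector orthogonal to the range is
    an eigenvector for conj z, and [below_conj] excludes nonzero ones. *)
Lemma below_resolvent_set z c : hcomplete [set: H] -> 0 < c -> below z c ->
  resolvent_set B z.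
Proof.
move=> cH c0 bz.
have inj0 z' : below z' c -> forall u, dom B u -> B u - z' *: u = 0 -> u = 0.
  move=> h u Du Bu; have := h u Du; rewrite Bu hnorm0 pmulr_rle0//.
  exact: hnorm0_eq0.
have inj : set_inj (dom B) (op_shift B z).
  move=> u v; rewrite !inE => Du Dv /= uv; apply/eqP; rewrite -subr_eq0; apply/eqP.
  apply: (inj0 z) => //; first exact: subB Bl.1 _ _.
  by rewrite (lin_onB Bl)// scalerBr opprD addrACA -opprD uv subrr.
pose F := [set B u - z *: u | u in dom B].
have sF : lsubspace F.
  split; first by exists 0; [exact: sub0 Bl.1 | rewrite (lin_on0 Bl) scaler0 subr0].
  move=> a _ _ [u Du <-] [v Dv <-]; exists (a *: u + v); first exact: Bl.1.2.
  by rewrite Bl.2// !scalerDr scalerN !scalerA [z * a]mulrC opprD addrACA.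
have cF : hcomplete F.
  move=> w Fw cw.
  have [u hu] := choice (fun n => let: ex_intro2 u Du Bu := Fw n in
                          ex_intro (fun u => dom B u /\ _) u (conj Du Bu)).
  have cu : hcauchy u.
    move=> e e0; have [|N hN] := cw (c * e); first by rewrite mulr_gt0.
    exists N => m n Nm Nn; have := hN m n Nm Nn.
    have [[Dm <-] [Dn <-]] := (hu m, hu n).
    rewrite [B _ - _ - _](_ : _ = B (u m - u n) - z *: (u m - u n)); last first.
      by rewrite (lin_onB Bl)// scalerBr [in RHS]opprD [RHS]addrACA -opprD.
    move=> /(le_lt_trans (bz _ (subB Bl.1 Dm Dn))).
    by rewrite ltr_pM2l.
  have [x _ ux] := cH _ (fun=> I) cu; have [y _ wy] := cH _ (fun=> I) cw.
  have [||||Dx Bx] := @sa_closed u (fun n => w n + z *: u n) x (y + z *: x).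
  - by move=> n; case: (hu n).
  - by move=> n; case: (hu n) => _ <-; rewrite subrK.
  - exact: ux.
  - exact: hcvgD wy (hcvgZ z ux).
  by exists y => //; exists x => //; rewrite Bx addrK.
have surj : set_surj (dom B) setT (op_shift B z).
  move=> x _; have [_ [u Du <-] hp] := projection x sF cF.
  exists u => //=; apply/eqP; rewrite -subr_eq0 -oppr_eq0 opprB; apply/eqP.
  set q := x - _; have hq v : dom B v -> '[B v - z *: v, q] = 0.
    by move=> Dv; rewrite inC hp ?conjC0//; exists v.
  have [|Dq Bq] := sa_max Bsa (v := q) (w := Num.conj z *: q).
    move=> v /hq; rewrite inBl inZl inZr conjCK => /eqP.
    by rewrite subr_eq0 => /eqP.
  by apply: (inj0 _ (below_conj bz)) => //; rewrite Bq subrr.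
have bij : set_bij (dom B) setT (op_shift B z) by split.
split=> //; have rP f : dom B (resolvent B z f) /\
    B (resolvent B z f) - z *: resolvent B z f = f.
  have [|u Du uf] := surj f; first by [].
  by rewrite /resolvent /op_inv; case: xgetP => [x ->//|/(_ u)] [].
have rl : lin (resolvent B z).
  apply: linP => a f g; apply: inj; rewrite ?inE.
  - exact: (rP _).1.
  - by apply: Bl.1.2; exact: (rP _).1.
  rewrite /= (rP _).2 Bl.2; [|exact: (rP _).1|exact: (rP _).1].
  rewrite -{1}(rP f).2 -{1}(rP g).2.
  by rewrite !scalerDr scalerN !scalerA [a * z]mulrC opprD addrACA.
apply: (bounded_opP (M := c^-1) rl) => f.
rewrite mulrC ler_pdivlMr// mulrC -{2}(rP f).2.
exact: bz (rP f).1.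
Qed.

End OneOperator.
End SelfAdjoint.

(** * Spectral gaps of bounded symmetric operators *)

Section BoundedSymmetric.
Variable R : realType.
Variable H : innerType R.
Implicit Types (C S : H -> H) (M : set H).

Definition bnd_below M C : Prop :=
  exists2 c : R, 0 < c & forall u, M u -> c * hnorm u <= hnorm (C u).

Lemma ler_nc (a : R[i]) (x y : R) : x <= y -> normc a * x <= normc a * y.
Proof. by move=> xy; apply: ler_wpM2l => //; exact: normc_ge0. Qed.

Lemma le_sqr (a b : R) : 0 <= a -> a <= b -> a ^+ 2 <= b ^+ 2.
Proof. by move=> a0 ab; rewrite ler_sqr ?nnegrE// (le_trans a0). Qed.

Lemma shift_factor S (r : R) u : lin S ->
  S (S u + r%:C *: u) - r%:C *: (S u + r%:C *: u) = S (S u) - (r ^+ 2)%:C *: u.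
Proof.
move=> Sl; rewrite (lin_onD Sl)// (lin_onZ Sl)// scalerDr scalerA opprD addrA addrK.
by rewrite expr2 rmorphM.
Qed.

(* If k is the infimum of |C u| over unit vectors and k < d, then the form
   |C u|^2 - k^2 |u|^2 of P = C^2 - k^2 is nonnegative, so that it dominates a
   multiple of |P u|^2 by Cauchy-Schwarz; but P = (C - k)(C + k) is bounded below,
   which contradicts the definition of k. *)
Lemma spectral_distance0 M C (K d : R) : lsubspace M ->
  (forall u, M u -> M (C u)) -> adjoint_pair C C -> bnd C K ->
  (forall b : R, `|b| < d -> bnd_below M (fun u => C u - b%:C *: u)) ->
  forall u, M u -> d * hnorm u <= hnorm (C u).
Proof.
move=> sM MC Cs CK hb u0 Mu0; have Cl := adjoint_pair_lin Cs.
rewrite leNgt; apply/negP => lt0.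
have u00 : u0 != 0 by apply/eqP => h; move: lt0; rewrite h (lin_on0 Cl) !hnorm0 mulr0 ltxx.
pose A := [set hnorm (C u) | u in [set u | M u /\ hnorm u = 1]].
have nz u : u != 0 -> M u -> A (hnorm (C u) / hnorm u).
  move=> un Mu; have un0 : 0 < hnorm u by rewrite hnorm_gt0.
  exists ((hnorm u)^-1%:C *: u).
    split; first exact: subZ.
    by rewrite hnormZR ger0_norm ?invr_ge0 ?hnorm_ge0// mulVf ?gt_eqF.
  by rewrite (lin_onZ Cl)// hnormZR ger0_norm ?invr_ge0 ?hnorm_ge0// mulrC.
have infA : has_inf A.
  split; first by exists (hnorm (C u0) / hnorm u0); exact: nz.
  by exists 0 => _ [y _ <-]; exact: hnorm_ge0.
pose k := inf A.
have k0 : 0 <= k by apply: lb_le_inf; [case: infA | move=> _ [? _ <-]; exact: hnorm_ge0].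
have kle u : M u -> k * hnorm u <= hnorm (C u).
  move=> Mu; have [->|un] := eqVneq u 0; first by rewrite hnorm0 mulr0 hnorm_ge0.
  rewrite -ler_pdivlMr ?hnorm_gt0//; apply: ge_inf; first by case: infA.
  exact: nz.
have kd : k < d.
  rewrite (@le_lt_trans _ _ (hnorm (C u0) / hnorm u0))//.
    by apply: ge_inf; [case: infA | exact: nz].
  by rewrite ltr_pdivrMr ?hnorm_gt0.
have k2 : `|k| < d by rewrite ger0_norm.
have k2' : `|- k| < d by rewrite normrN.
have [c1 c10 h1] := hb _ k2; have [c2 c20 h2] := hb _ k2'.
pose P u := C (C u) - (k ^+ 2)%:C *: u.
have PE u : P u = C (C u + k%:C *: u) - k%:C *: (C u + k%:C *: u).
  by rewrite shift_factor.
have MP u : M u -> M (P u).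
  by move=> Mu; apply: subB => //; [exact/MC/MC | exact: subZ].
pose c := c1 * c2.
have c0 : 0 < c by rewrite mulr_gt0.
have Pc u : M u -> c * hnorm u <= hnorm (P u).
  move=> Mu; rewrite PE; have Mw : M (C u + k%:C *: u).
    by apply: subD => //; [exact: MC | exact: subZ].
  apply: le_trans (h1 _ Mw); rewrite -mulrA ler_pM2l//.
  by have := h2 _ Mu; rewrite rmorphN scaleNr opprK.
pose L := K ^+ 2 + 1.
have L0 : 0 < L by rewrite ltr_wpDl// sqr_ge0.
pose q u := hnorm (C u) ^+ 2 - k ^+ 2 * hnorm u ^+ 2.
have q0 u : M u -> 0 <= q u.
  move=> Mu; rewrite subr_ge0 -exprMn; move: (kle u Mu).
  by apply: le_sqr; rewrite mulr_ge0 ?hnorm_ge0.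
have qL u : q u <= L * hnorm u ^+ 2.
  have h : hnorm (C u) ^+ 2 <= K ^+ 2 * hnorm u ^+ 2.
    by rewrite -exprMn; apply: le_sqr (CK u); exact: hnorm_ge0.
  rewrite /q /L; have := mulr_ge0 (sqr_ge0 k) (sqr_ge0 (hnorm u)).
  by have := sqr_ge0 (hnorm u); nra.
have qP u : M u -> hnorm (P u) ^+ 2 <= L * q u.
  move=> Mu; pose s := L^-1.
  have s0 : 0 < s by rewrite invr_gt0.
  (* Cauchy-Schwarz for the form [q], in the shape of its nonnegativity at u - P u / L; the identity
     <P u, u> = q u is behind it. *)
  have := q0 (u - s%:C *: P u) (subB sM Mu (subZ _ sM (MP _ Mu))).
  have -> : q (u - s%:C *: P u) = q u - 2 * s * hnorm (P u) ^+ 2 + s ^+ 2 * q (P u).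
    rewrite /q (lin_onB Cl)// (lin_onZ Cl)// (hnormB_sqr (C u)) (hnormB_sqr u).
    rewrite !inZr !conjCR !reMl !hnormZR !exprMn !(ger0_norm (ltW s0)).
    have -> : re '[C u, C (P u)] = hnorm (P u) ^+ 2 + k ^+ 2 * re '[u, P u].
      by rewrite -Cs -re_inner {2}/P inBl inZl reB reMl subrK.
    by ring.
  have := qL (P u); have := q0 _ (MP _ Mu).
  have sL : s * L = 1 by rewrite mulVf ?gt_eqF.
  move=> _ qPL; rewrite -(pmulr_rge0 _ L0) => h.
  have : s ^+ 2 * q (P u) <= s * hnorm (P u) ^+ 2.
    rewrite expr2 -mulrA ler_pM2l// -[leRHS]mul1r -sL -mulrA.
    by rewrite ler_pM2l.
  by nra.
(* On unit vectors c^2 <= |P u|^2 <= L (|C u|^2 - k^2), so [k'] is a lower bound for |C u| that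
   exceeds the infimum [k]. *)
pose k' := Num.sqrt (k ^+ 2 + c ^+ 2 / L).
have kk : k < k'.
  have cL : 0 < c ^+ 2 / L by rewrite divr_gt0// exprn_gt0.
  by rewrite -[ltLHS]ger0_norm// -sqrtr_sqr ltr_sqrt ?ltrDl// ltr_wpDl ?sqr_ge0.
have : k' <= k.
  apply: lb_le_inf; first by case: infA.
  move=> _ [u [Mu u1] <-]; apply: le_of_sqr; first exact: hnorm_ge0.
  rewrite sqr_sqrtr; last by rewrite addr_ge0 ?sqr_ge0// divr_ge0 ?sqr_ge0// ltW.
  have := Pc u Mu; rewrite u1 mulr1 => hc.
  have := qP u Mu; rewrite /q u1 expr1n mulr1 => hq.
  have : c ^+ 2 <= hnorm (P u) ^+ 2 by rewrite ler_sqr ?nnegrE ?hnorm_ge0// ltW.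
  move=> hc2; rewrite -lerBrDl ler_pdivrMr// mulrC.
  exact: le_trans hc2 hq.
by rewrite leNgt kk.
Qed.

Lemma sym_shift S (a : R) : adjoint_pair S S ->
  adjoint_pair (fun u => S u - a%:C *: u) (fun u => S u - a%:C *: u).
Proof. by move=> Ss u v; rewrite inBl inBr inZl inZr conjCR Ss. Qed.

Lemma bnd_shift S (a K : R) : bnd S K -> bnd (fun u => S u - a%:C *: u) (K + `|a|).
Proof.
by move=> SK u; rewrite (le_trans (hnorm_triangleB _ _))// hnormZR mulrDl lerD2r.
Qed.

Lemma spectral_distance M S (K a d : R) : lsubspace M ->
  (forall u, M u -> M (S u)) -> adjoint_pair S S -> bnd S K ->
  (forall b : R, `|b - a| < d -> bnd_below M (fun u => S u - b%:C *: u)) ->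
  forall u, M u -> d * hnorm u <= hnorm (S u - a%:C *: u).
Proof.
move=> sM MS Ss SK hb.
apply: (@spectral_distance0 M (fun u => S u - a%:C *: u) (K + `|a|) d) => //.
- by move=> u Mu; apply: subB => //; [exact: MS | exact: subZ].
- exact: sym_shift.
- exact: bnd_shift.
move=> b bd; have [|c c0 hc] := hb (a + b); first by rewrite addrAC subrr add0r.
by exists c => // u Mu; rewrite -addrA -opprD -scalerDl -rmorphD; exact: hc.
Qed.

(** S^2 has no spectrum in ]0, g^2[, hence |(S^2 - w) u| >= w |u| for the midpoint w = g^2 / 2.
    After squaring, the terms w^2 |u|^2 cancel and |S^2 u|^2 >= 2 w |S u|^2 remains. *)
Lemma square_gap S (K g : R) : 0 < g -> adjoint_pair S S -> bnd S K ->
  (forall b : R, 0 < `|b| < g -> bnd_below setT (fun u => S u - b%:C *: u)) ->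
  forall u, g * hnorm (S u) <= hnorm (S (S u)).
Proof.
move=> g0 Ss SK hb u; have Sl := adjoint_pair_lin Ss.
pose w := g ^+ 2 / 2; have w0 : 0 < w by rewrite divr_gt0// exprn_gt0.
have K0 : 0 <= `|K| by [].
have SK' : bnd S `|K| by move=> v; rewrite (le_trans (SK v))// ler_hn ?ler_norm.
have h : w * hnorm u <= hnorm (S (S u) - w%:C *: u).
  apply: (@spectral_distance setT (fun u => S (S u)) (`|K| * `|K|) w w) => //.
  - by move=> x y; rewrite !Ss.
  - move=> x; rewrite (le_trans (SK' _))// -mulrA ler_wpM2l//.
  move=> b; rewrite ltr_distl subrr => /andP[b0 bw].
  pose r := Num.sqrt b; have r0 : 0 < r by rewrite sqrtr_gt0.
  have rg : r < g.
    rewrite -[g]ger0_norm ?(ltW g0)// -sqrtr_sqr ltr_sqrt ?exprn_gt0//.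
    by rewrite (lt_le_trans bw)// /w -splitr.
  have [|c1 c10 h1] := hb r; first by rewrite gtr0_norm// r0.
  have [|c2 c20 h2] := hb (- r); first by rewrite normrN gtr0_norm// r0.
  exists (c1 * c2); first by rewrite mulr_gt0.
  move=> x _.
  rewrite -[b](sqr_sqrtr (ltW b0)) -shift_factor//.
  apply: le_trans (h1 _ I); rewrite -mulrA ler_pM2l//.
  by have := h2 x I; rewrite rmorphN scaleNr opprK.
apply: le_of_sqr; first exact: hnorm_ge0.
have gw : g ^+ 2 = 2 * w by rewrite /w; field.
have wu0 : 0 <= w * hnorm u by rewrite mulr_ge0 ?hnorm_ge0// ltW.
move: (le_sqr wu0 h); rewrite [(g * _) ^+ 2]exprMn gw; clearbody w.
rewrite [hnorm (_ - _) ^+ 2]hnormB_sqr inZr conjCR reMl Ss re_inner hnormZR !exprMn.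
rewrite (ger0_norm (ltW w0)) => {}h.
by nra.
Qed.

Hypothesis cH : hcomplete [set: H].

(** The estimate on the range of S extends to its closure [F], and the orthogonal complement of the
    kernel lies in [F]. *)
Lemma orth_gap S (K g : R) : 0 < g -> adjoint_pair S S -> bnd S K ->
  (forall u, g * hnorm (S u) <= hnorm (S (S u))) ->
  forall v, (forall n, S n = 0 -> '[v, n] = 0) -> g * hnorm v <= hnorm (S v).
Proof.
move=> g0 Ss SK hg v hv; have Sl := adjoint_pair_lin Ss.
pose F := [set y | forall e : R, 0 < e -> exists u, hnorm (S u - y) < e].
have sF : lsubspace F.
  split; first by move=> e e0; exists 0; rewrite (lin_on0 Sl) subrr hnorm0.
  move=> a x y Fx Fy e e0; have a0 : 0 < normc a + 1 by rewrite ltr_wpDl.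
  have [|u hu] := Fx (e / 2 / (normc a + 1)); first by rewrite !divr_gt0.
  have [|w hw] := Fy (e / 2); first by rewrite divr_gt0.
  exists (a *: u + w); rewrite Sl.2// opprD addrACA -scalerBr.
  rewrite (le_lt_trans (hnorm_triangle _ _))// (splitr e) ltrD// hnormZ.
  move: hu; rewrite ltr_pdivlMr//; apply: le_lt_trans.
  by rewrite mulrC; apply: ler_wpM2l; rewrite ?hnorm_ge0// lerDl.
have cF : hcomplete F.
  apply: hclosed_complete => // x l Fx xl e e0.
  have [|N hN] := xl (e / 2); first by rewrite divr_gt0.
  have [|u hu] := Fx N (e / 2); first by rewrite divr_gt0.
  exists u; rewrite (le_lt_trans (hnorm_distD _ (x N) _))// (splitr e) ltrD//.
  exact: hN.
have [p Fp hp] := projection v sF cF.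
have Sq : S (v - p) = 0.
  apply: inner0_eq0 => u; rewrite -Ss inC hp ?conjC0//.
  by move=> e e0; exists u; rewrite subrr hnorm0.
have vp : v = p.
  apply/eqP; rewrite -subr_eq0 -hnorm_eq0 -sqrf_eq0 -re_inner inBr (hp _ Fp) subr0.
  by rewrite inC hv// conjC0.
have Fv : F v by rewrite vp.
rewrite -subr_le0; apply: eps_le0 => e e0.
have L0 : 0 < g + `|K| by rewrite ltr_pwDl.
have [|u hu] := Fv (e / (g + `|K|)); first by rewrite divr_gt0.
have := hg u; have := lin_hnormB (S u) v Sl SK.
have h1 := hnorm_sub v (S u); have h2 := hnorm_sub (S (S u)) (S v).
rewrite hnormBC in h1; move: hu; rewrite ltr_pdivlMr// => hu h3 h4.
have h5 : K * hnorm (S u - v) <= `|K| * hnorm (S u - v) by rewrite ler_hn// ler_norm.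
by nra.
Qed.

(* Adding one dimension to the subspace preserves a lower bound, as long as C stays
   injective. *)
Lemma fredholm_step M C (K : R) (n : H) : lsubspace M -> hcomplete M ->
  lin C -> bnd C K -> (forall u, M u -> C u = 0 -> u = 0) ->
  bnd_below [set u | M u /\ '[u, n] = 0] C -> bnd_below M C.
Proof.
move=> sM cM Cl CK Cinj [c c0 hc].
have [h|/existsNP[e0 /not_implyP[Me0 e0n]]] := pselect (forall u, M u -> '[u, n] = 0).
  by exists c => // u Mu; apply: hc; split=> //; exact: h.
(* With <e, n> = 1, every u of M is <u, n> e plus a vector of [M']. *)
pose e := '[e0, n]^-1 *: e0; have Me : M e by exact: subZ.
have en : '[e, n] = 1 by rewrite inZl mulVf//; exact/eqP.
pose M' := [set u | M u /\ '[u, n] = 0].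
have sM' u v : M' u -> M' v -> M' (u - v).
  move=> [Mu un] [Mv vn]; split; first exact: subB.
  by rewrite inBl un vn subrr.
(* If C (e + w_k) tends to 0, the lower bound on [M'] makes (w_k) Cauchy; its limit l gives C (e +
   l) = 0, although <e + l, n> = 1. *)
have [d d0 hd] : exists2 d : R, 0 < d & forall w, M' w -> d <= hnorm (C (e + w)).
  apply: contrapT => h; have ex k : exists w, M' w /\ hnorm (C (e + w)) < k.+1%:R^-1.
    have /existsNP[w /not_implyP[Mw /negP]] : ~ forall w, M' w -> k.+1%:R^-1 <= hnorm (C (e + w)).
      by move=> h'; apply: h; exists k.+1%:R^-1; rewrite ?invr_gt0 ?ltr0n.
    by rewrite -ltNge => hw; exists w.
  have [w hw] := choice ex.
  have Mw k : M (w k) by case: (hw k) => -[].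
  have cw : hcauchy w.
    move=> r r0; have [|N hN] := @small_inv_nat R (c * r / 2).
      by rewrite divr_gt0// mulr_gt0.
    exists N => i j Ni Nj; rewrite -(ltr_pM2l c0).
    have [Wi hi] := hw i; have [Wj hj] := hw j.
    apply: le_lt_trans (hc _ (sM' _ _ Wi Wj)) _.
    rewrite (_ : w i - w j = (e + w i) - (e + w j)); last first.
      by rewrite opprD addrACA subrr add0r.
    rewrite (lin_onB Cl)// (le_lt_trans (hnorm_triangleB _ _))// [ltRHS]splitr.
    by rewrite ltrD//; [exact: lt_trans hi (hN _ Ni) | exact: lt_trans hj (hN _ Nj)].
  have [l Ml wl] := cM w Mw cw.
  have ln : '[l, n] = 0 by apply: hcvg_inner wl _ => k; case: (hw k) => -[].
  have Cel : C (e + l) = 0.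
    apply: hnorm0_eq0.
    apply: (hnorm_hcvg_le (hcvg_lin Cl CK (hcvgD (hcvg_cst e) wl))).
    move=> r r0; have [N hN] := small_inv_nat r0; exists N => k /hN hk.
    by rewrite add0r ltW// (lt_trans (hw k).2).
  have el : e + l = 0 by apply: Cinj => //; exact: subD.
  by move: (in0l n); rewrite -el inDl en ln addr0 => /eqP; rewrite oner_eq0.
(* For u = a e + w, |a| is bounded by |C u| / d and |w| through c; the first two summands collect
   the coefficients of |a|, and the last one makes [B] positive. *)
pose B := `|K| * hnorm e + c * hnorm e + c.
have B0 : 0 < B by rewrite /B ltr_wpDl// addr_ge0// mulr_ge0 ?hnorm_ge0// ltW.
have BD : 0 < B + d by exact: addr_gt0.
exists (c * d / (B + d)) => [|u Mu].
  by rewrite divr_gt0// mulr_gt0.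
pose a := '[u, n]; pose w := u - a *: e.
have M'w : M' w.
  split; first by apply: subB => //; exact: subZ.
  by rewrite inBl inZl en mulr1 subrr.
have uE : u = a *: e + w by rewrite addrC subrK.
have h1 : d * normc a <= hnorm (C u).
  have [->|a0] := eqVneq a 0.
    by rewrite -[normc 0]/(normc (0 : R[i])) (eqP (_ : normc 0 == 0 :> R)) ?normc_eq0// mulr0 hnorm_ge0.
  have -> : u = a *: (e + a^-1 *: w) by rewrite scalerDr [a *: (_ *: w)]scalerA mulfV// scale1r -uE.
  rewrite (lin_onZ Cl)// hnormZ mulrC; apply: ler_nc; apply: hd.
  case: M'w => Mw wn; split; first exact: subZ.
  by rewrite inZl wn mulr0.
have h2 : c * hnorm w <= hnorm (C u) + normc a * (`|K| * hnorm e).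
  rewrite (le_trans (hc _ M'w))// /w (lin_onB Cl)// (lin_onZ Cl)//.
  rewrite (le_trans (hnorm_triangleB _ _))// lerD2l hnormZ; apply: ler_nc.
  by rewrite (le_trans (CK _))// ler_hn// ler_norm.
have h3 : hnorm u <= normc a * hnorm e + hnorm w.
  by rewrite {1}uE (le_trans (hnorm_triangle _ _))// hnormZ.
rewrite mulrAC (ler_pdivrMr _ _ BD).
have := hnorm_ge0 e; have := hnorm_ge0 w; have := normc_ge0 a; rewrite /B.
move: h1 h2 h3; have := normr_ge0 K.
move: (hnorm (C u)) (normc a) (hnorm u) (hnorm e) (hnorm w) (`|K|) => x y z p q k.
move=> k0 h1 h2 h3 y0 q0 p0.
have h4 : c * z <= c * (y * p) + x + y * (k * p).
  by have : c * z <= c * (y * p + q) by [rewrite ler_pM2l]; lra.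
have h5 : d * (c * z) <= d * (c * (y * p) + x + y * (k * p)) by rewrite ler_pM2l.
have h6 : (d * y) * (c * p + k * p) <= x * (c * p + k * p).
  by apply: ler_wpM2r => //; rewrite addr_ge0// mulr_ge0// ltW.
have x0 : 0 <= x by apply: le_trans h1; rewrite mulr_ge0// ltW.
have := mulr_ge0 (ltW c0) x0; lra.
Qed.

Lemma fredholm M C (K : R) (s : seq H) : lsubspace M -> hcomplete M ->
  lin C -> bnd C K -> (forall u, M u -> C u = 0 -> u = 0) ->
  bnd_below [set u | M u /\ forall n, n \in s -> '[u, n] = 0] C -> bnd_below M C.
Proof.
elim: s M => [|n s IHs] M sM cM Cl CK Cinj h.
  by case: h => c c0 hc; exists c => // u Mu; apply: hc.
apply: (fredholm_step (n := n) sM cM Cl CK Cinj); apply: IHs => //.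
- split; first by split; [exact: sub0 | exact: in0l].
  move=> a u v [Mu un] [Mv vn]; split; first exact: sM.2.
  by rewrite inDl inZl un vn mulr0 addr0.
- move=> u Mu cu; have [|l Ml ul] := cM u _ cu; first by move=> k; case: (Mu k).
  by exists l => //; split=> //; apply: hcvg_inner ul _ => k; case: (Mu k).
- by move=> u [Mu _]; exact: Cinj.
case: h => c c0 hc; exists c => // u [[Mu un] us]; apply: hc; split=> // k.
by rewrite inE => /predU1P[->|/us].
Qed.

End BoundedSymmetric.

(** * Perturbation of an isolated eigenvalue *)

Section Families.
Variable R : realType.
Variable H : innerType R.
Local Notation C := R[i].

Definition orthonormal_fam k (e : 'I_k -> H) : Prop :=
  forall i j, '[e i, e j] = (i == j)%:R.

Definition orthc k (e : 'I_k -> H) : set H := [set u | forall i, '[u, e i] = 0].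

Lemma orthc_subspace k (e : 'I_k -> H) : lsubspace (orthc e).
Proof.
split=> [i|a u v hu hv i]; first exact: in0l.
by rewrite inDl inZl hu hv mulr0 addr0.
Qed.

Lemma orthc_complete k (e : 'I_k -> H) : hcomplete [set: H] -> hcomplete (orthc e).
Proof.
move=> cH; apply: hclosed_complete => // u l hu ul i.
by apply: hcvg_inner ul _ => n; exact: hu.
Qed.

Section Orthonormal.
Variables (k : nat) (e : 'I_k -> H).
Hypothesis eo : orthonormal_fam e.

Lemma comb_inner (c : 'I_k -> C) j : '[\sum_i c i *: e i, e j] = c j.
Proof.
rewrite in_suml (bigD1 j)//= inZl eo eqxx mulr1 big1 ?addr0// => i ij.
by rewrite inZl eo (negPf ij) mulr0.
Qed.

Lemma comb_inner2 (c d : 'I_k -> C) :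
  '[\sum_i c i *: e i, \sum_i d i *: e i] = \sum_i c i * Num.conj (d i).
Proof.
rewrite in_sumr; apply: eq_bigr => j _.
by rewrite inZr comb_inner mulrC.
Qed.

Lemma comb_norm (c : 'I_k -> C) :
  hnorm (\sum_i c i *: e i) ^+ 2 = \sum_i normc (c i) ^+ 2.
Proof.
apply: complexI; rewrite sqr_hnorm comb_inner2 rmorph_sum /=.
by apply: eq_bigr => i _; rewrite sqr_normcE.
Qed.

Lemma comb_eq0 (c : 'I_k -> C) : \sum_i c i *: e i = 0 -> forall i, c i = 0.
Proof. by move=> h i; rewrite -(comb_inner c i) h in0l. Qed.

Lemma fam_norm i : hnorm (e i) = 1.
Proof.
apply/eqP; rewrite -(@eqrXn2 _ 2) ?hnorm_ge0// -re_inner eo eqxx expr1n.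
exact/eqP.
Qed.

Lemma comb_rest (u : H) : orthc e (u - \sum_i '[u, e i] *: e i).
Proof. by move=> j; rewrite inBl comb_inner subrr. Qed.

End Orthonormal.

(** k linear equations in n > k unknowns have a nonzero solution. All comparisons of dimensions
    below rest on this. *)
Lemma exists_orth n k (e : 'I_n -> H) (f : 'I_k -> H) : (k < n)%N ->
  exists c : 'I_n -> C, (exists j, c j != 0) /\ orthc f (\sum_j c j *: e j).
Proof.
move=> kn; pose A : 'M[C]_(n, k) := \matrix_(j, i) '[e j, f i].
have : kermx A != 0.
  by rewrite -mxrank_eq0 mxrank_ker subn_eq0 -ltnNge (leq_ltn_trans (rank_leq_col A)).
move=> /rowV0Pn[v /sub_kermxP vA v0].
exists (fun j => v 0 j); split.
  apply: contrapT => /forallNP h; move/eqP: v0; apply; apply/rowP => j.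
  by rewrite mxE; apply/eqP; apply: contrapT => /negP; exact: h.
move=> i; rewrite in_suml; have := congr1 (fun M : 'rV[C]_k => M 0 i) vA.
rewrite !mxE => h; rewrite -[RHS]h; apply: eq_bigr => j _.
by rewrite inZl mxE.
Qed.

Lemma fam_extend k (e : 'I_k -> H) (u : H) :
  orthonormal_fam e -> orthc e u -> hnorm u = 1 ->
  orthonormal_fam (fun i : 'I_k.+1 => if unlift ord0 i is Some j then e j else u).
Proof.
move=> eo eu u1 i j.
case: (unliftP ord0 i) => [i' ->|->]; case: (unliftP ord0 j) => [j' ->|->].
- by rewrite eo (inj_eq lift_inj).
- by rewrite inC eu conjC0 eq_sym (negPf (neq_lift _ _)).
- by rewrite eu (negPf (neq_lift _ _)).
- by rewrite -sqr_hnorm u1 expr1n eqxx.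
Qed.

Hypothesis cH : hcomplete [set: H].

(* A maximal orthonormal family of eigenvectors with eigenvalues in ]-beta, beta[:
   it cannot have fewer than m elements, since S would otherwise be bounded below
   on the complement, which contains a combination of the f_j. *)
Lemma eigen_family m (f : 'I_m -> H) (S : H -> H) (K g eta beta : R) :
  adjoint_pair S S -> bnd S K -> orthonormal_fam f ->
  (forall x, orthc f x -> g * hnorm x <= hnorm (S x)) ->
  (forall c : 'I_m -> C, hnorm (S (\sum_j c j *: f j)) <=
                         eta * hnorm (\sum_j c j *: f j)) ->
  eta < beta -> 0 < beta -> beta < g ->
  exists (e : 'I_m -> H) (a : 'I_m -> R),
    [/\ orthonormal_fam e, forall i, S (e i) = (a i)%:C *: e i,
        forall i, `|a i| < beta &
        forall u, orthc e u -> beta * hnorm u <= hnorm (S u)].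
Proof.
move=> Ss SK fo fg feta eb b0 bg; have Sl := adjoint_pair_lin Ss.
pose P k := exists (e : 'I_k -> H) (a : 'I_k -> R),
    [/\ orthonormal_fam e, forall i, S (e i) = (a i)%:C *: e i &
        forall i, `|a i| < beta].
(* In a longer family some nonzero combination is orthogonal to all f_j; there S is bounded below by
   g, yet above by beta < g. *)
have Pm k : P k -> (k <= m)%N.
  move=> [e [a [eo Se ab]]]; rewrite leqNgt; apply/negP => mk.
  have [c [[j cj] co]] := exists_orth e f mk.
  set v := \sum_j _ in co.
  have v0 : v != 0 by apply/eqP => /(comb_eq0 eo)/(_ j) cj0; rewrite cj0 eqxx in cj.
  have := fg _ co; apply/negP; rewrite -ltNge.
  apply: (@le_lt_trans _ _ (beta * hnorm v)); last by rewrite ltr_pM2r ?hnorm_gt0.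
  apply: le_of_sqr; first by rewrite mulr_ge0 ?hnorm_ge0// ltW.
  rewrite /v (lin_sum _ _ _ Sl).
  under eq_bigr do rewrite (lin_onZ Sl)// Se scalerA.
  rewrite exprMn !comb_norm// mulr_sumr; apply: ler_sum => i _.
  rewrite normcM exprMn mulrC normcR; apply: ler_wpM2r; first exact: sqr_ge0.
  by apply: le_sqr => //; exact: ltW.
have P0 : P 0%N.
  by exists (fun=> 0), (fun=> 0); split=> -[].
pose p k := `[< P k >].
have ep : exists k, p k by exists 0%N; exact/asboolP.
have pm k : p k -> (k <= m)%N by move/asboolP; exact: Pm.
case: (ex_maxnP ep pm) => k /asboolP[e [a [eo Se ab]]] kmax.
have MS u : orthc e u -> orthc e (S u).
  by move=> hu i; rewrite Ss Se inZr hu mulr0.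
have below_e u : orthc e u -> beta * hnorm u <= hnorm (S u).
  move=> Mu; have := @spectral_distance0 R H (orthc e) S K beta (orthc_subspace e) MS Ss SK.
  apply=> // b bb.
  have Cl : lin (fun u => S u - b%:C *: u) by apply: lin_sub => //; apply: lin_scale; exact: lin_id.
  apply: (fredholm (K := K + `|b|) (s := codom f)) => //.
  - exact: orthc_subspace.
  - exact: orthc_complete.
  - exact: bnd_shift.
  (* A nonzero kernel vector of S - b in the complement, once normalized, would extend the maximal
     family. *)
  - move=> w Mw /eqP; rewrite subr_eq0 => /eqP Sw; apply/eqP/negPn/negP => w0.
    have := kmax k.+1; rewrite ltnn => hF; apply: notF; apply: hF; apply/asboolP.
    pose w1 := (hnorm w)^-1%:C *: w.
    exists (fun i => if unlift ord0 i is Some j then e j else w1).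
    exists (fun i => if unlift ord0 i is Some j then a j else b); split.
    + apply: fam_extend => //; first exact: subZ (orthc_subspace e) Mw.
      rewrite /w1 hnormZR ger0_norm ?invr_ge0 ?hnorm_ge0//.
      by rewrite mulVf// hnorm_eq0.
    + move=> i; case: unliftP => [j _|_]; first exact: Se.
      by rewrite /w1 (lin_onZ Sl)// Sw !scalerA mulrC.
    + by move=> i; case: unliftP.
  - exists (g - `|b|); first by rewrite subr_gt0 (lt_trans bb).
    move=> x [_ xf]; have xo : orthc f x by move=> i; apply: xf; exact: codom_f.
    rewrite mulrBl (le_trans _ (hnorm_sub _ _))// hnormZR lerD2r.
    exact: fg.
have km : k = m.
  apply/eqP; rewrite eqn_leq Pm//=; last by exists e, a.
  rewrite leqNgt; apply/negP => ltkm.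
  have [c [[j cj] co]] := exists_orth f e ltkm.
  set v := \sum_j _ in co.
  have v0 : v != 0 by apply/eqP => /(comb_eq0 fo)/(_ j) cj0; rewrite cj0 eqxx in cj.
  have := below_e _ co; apply/negP; rewrite -ltNge.
  by rewrite (le_lt_trans (feta c))// ltr_pM2r ?hnorm_gt0.
by case: _ / km in f fo fg feta Pm pm kmax *; exists e, a.
Qed.

Section EigenBasis.
Variables (m : nat) (e : 'I_m -> H) (a : 'I_m -> R) (S : H -> H) (K beta : R).
Hypotheses (Ss : adjoint_pair S S) (SK : bnd S K) (eo : orthonormal_fam e).
Hypotheses (Se : forall i, S (e i) = (a i)%:C *: e i).
Hypothesis (be : forall u, orthc e u -> beta * hnorm u <= hnorm (S u)).

(** On the complement of the e_i, which has finite codimension, S - b is bounded below by beta -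
    |b|; it is injective since b is none of the a_i, and [fredholm] applies. *)
Lemma eigen_basis_below (b : R) : `|b| < beta -> (forall i, a i != b) ->
  bnd_below setT (fun u => S u - b%:C *: u).
Proof.
move=> bb ab; have Sl := adjoint_pair_lin Ss.
apply: (fredholm (K := K + `|b|) (s := codom e)) => //.
- by apply: lin_sub => //; apply: lin_scale; exact: lin_id.
- exact: bnd_shift.
- move=> u _ /eqP; rewrite subr_eq0 => /eqP Su.
  have ou : orthc e u.
    move=> i; have : '[S u, e i] = '[u, S (e i)] by rewrite Ss.
    rewrite Su Se inZl inZr conjCR => /eqP; rewrite -subr_eq0 -mulrBl mulf_eq0.
    rewrite -rmorphB /= => /orP[|/eqP//].
    by rewrite -[0]/((0 : R)%:C) (inj_eq (@complexI R)) subr_eq0 eq_sym (negPf (ab i)).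
  apply: hnorm0_eq0; have := be ou; rewrite Su hnormZR -subr_le0 -mulrBl.
  by rewrite pmulr_rle0// subr_gt0.
- exists (beta - `|b|); first by rewrite subr_gt0.
  move=> x [_ xe]; have xo : orthc e x by move=> i; apply: xe; exact: codom_f.
  rewrite mulrBl (le_trans _ (hnorm_sub _ _))// hnormZR lerD2r.
  exact: be.
Qed.

(** The part of an eigenvector orthogonal to all e_i is again an eigenvector for b, so the bound
    beta > |b| kills it. The e_i with a_i = b remain as a basis. *)
Lemma eigen_basis_dim (b : R) : `|b| < beta ->
  has_dim [set u | S u = b%:C *: u] #|[set j | a j == b]%SET|.
Proof.
move=> bb; have Sl := adjoint_pair_lin Ss.
pose I := [set j | a j == b]%SET.
exists (fun i => e (enum_val (i : 'I_#|I|))); split.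
  move=> c h i; have := congr1 (fun v => '[v, e (enum_val i)]) h.
  rewrite in0l in_suml (bigD1 i)//= inZl eo eqxx mulr1 big1 ?addr0// => j ji.
  by rewrite inZl eo (inj_eq enum_val_inj) (negPf ji) mulr0.
apply/seteqP; split=> [u /= Su|u [c ->] /=].
  have hi i : a i != b -> '[u, e i] = 0.
    move=> ab; have : '[S u, e i] = '[u, S (e i)] by rewrite Ss.
    rewrite Su Se inZl inZr conjCR => /eqP; rewrite -subr_eq0 -mulrBl mulf_eq0.
    rewrite -rmorphB /= => /orP[|/eqP//].
    by rewrite -[0]/((0 : R)%:C) (inj_eq (@complexI R)) subr_eq0 eq_sym (negPf ab).
  exists (fun i => '[u, e (enum_val i)]).
  have -> : \sum_(i < #|I|) '[u, e (enum_val i)] *: e (enum_val i) =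
            \sum_i '[u, e i] *: e i.
    rewrite -(big_enum_val (fun i => '[u, e i] *: e i)) [RHS](bigID (mem I))/=.
    rewrite [X in _ + X]big1 ?addr0// => i; rewrite inE => /hi ->.
    by rewrite scale0r.
  apply/eqP; rewrite -subr_eq0; apply/eqP.
  have ow := comb_rest eo u; set w := u - _ in ow *.
  have Sw : S w = b%:C *: w.
    rewrite /w (lin_onB Sl)// Su scalerBr; congr (_ - _).
    rewrite (lin_sum _ _ _ Sl) scaler_sumr; apply: eq_bigr => i _.
    rewrite (lin_onZ Sl)// Se !scalerA mulrC.
    by have [->//|/hi ->] := eqVneq (a i) b; rewrite !mulr0.
  apply: hnorm0_eq0; have := be ow; rewrite Sw hnormZR -subr_le0 -mulrBl.
  by rewrite pmulr_rle0// subr_gt0.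
rewrite (lin_sum _ _ _ Sl) scaler_sumr; apply: eq_bigr => i _.
rewrite (lin_onZ Sl)// Se !scalerA mulrC.
by have := enum_valP i; rewrite inE => /eqP ->.
Qed.

End EigenBasis.
End Families.

(** * Almost unitary matrices and a large Leibniz term *)

Section PermutationChoice.
Variable R : realType.
Local Notation C := R[i].

(** Telescoping, one factor at a time. The bound 2 suits the entries of a matrix within distance 1
    of the identity. *)
Lemma prod_dist (I : Type) (r : seq I) (x y : I -> C) (d : R) :
  (forall i, normc (x i) <= 2) -> (forall i, normc (y i) <= 2) ->
  (forall i, normc (x i - y i) <= d) ->
  normc (\prod_(i <- r) x i - \prod_(i <- r) y i) <= (size r)%:R * d * 2 ^+ size r.
Proof.
move=> x2 y2 xy; elim: r => [|i r IH].
  by rewrite !big_nil subrr mul0r mul0r -[0 : C]/((0 : R)%:C) normcR normr0.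
have d0 : 0 <= d := le_trans (normc_ge0 _) (xy i).
rewrite !big_cons (_ : _ - _ = (x i - y i) * \prod_(j <- r) x j +
  y i * (\prod_(j <- r) x j - \prod_(j <- r) y j)); last by ring.
rewrite (le_trans (normcD _ _))// !normcM.
have h1 : normc (\prod_(j <- r) x j) <= 2 ^+ size r.
  rewrite normc_prod; elim: (r) => [|k s IHs]; first by rewrite big_nil.
  by rewrite big_cons exprS ler_pM ?normc_ge0// prodr_ge0// => l _; exact: normc_ge0.
have h2 : normc (x i - y i) * normc (\prod_(j <- r) x j) <= d * 2 ^+ size r.
  by rewrite ler_pM ?normc_ge0.
have h3 := ler_pM (normc_ge0 _) (normc_ge0 _) (y2 i) IH.
rewrite (le_trans (lerD h2 h3))//= exprS (_ : (size r).+1%:R = (size r)%:R + 1); last by rewrite natr1.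
have := mulr_ge0 d0 (exprn_ge0 (size r) (ler0n R 2)).
move: (2 ^+ size r) ((size r)%:R) => p n dp; lra.
Qed.

Lemma det_near_id m : exists2 d : R, 0 < d & forall G : 'M[C]_m,
  (forall i j, normc (G i j - (i == j)%:R) <= d) -> 2^-1 <= normc (\det G).
Proof.
(* Each of the m! Leibniz terms moves by at most m d 2^m; the added 1 keeps [B] positive and d below
   1. *)
pose B : R := m`!%:R * (m%:R * 2 ^+ m) + 1.
have B0 : 0 < B by rewrite ltr_wpDl// !mulr_ge0// exprn_ge0.
exists (2^-1 / B); first by rewrite divr_gt0.
move=> G hG; set d := _ / _ in hG.
have d0 : 0 < d by rewrite divr_gt0.
have d1 : d <= 1.
  rewrite ler_pdivrMr// mul1r /B.
  have : 0 <= (m`!%:R * (m%:R * 2 ^+ m) : R) by rewrite !mulr_ge0// exprn_ge0.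
  by lra.
have b2 (b : bool) : normc (b%:R : C) <= 2.
  by case: b; rewrite ?normc1 -?[0 : C]/((0 : R)%:C) ?normcR ?normr0; lra.
have G2 i j : normc (G i j) <= 2.
  rewrite -[G i j](subrK (i == j)%:R) (le_trans (normcD _ _))//.
  have : normc ((i == j)%:R : C) <= 1.
    by case: (i == j); rewrite ?normc1 -?[0 : C]/((0 : R)%:C) ?normcR ?normr0; lra.
  have := hG i j; lra.
have dist : normc (\det G - \det (1%:M : 'M[C]_m)) <= 2^-1.
  rewrite /determinant -sumrB (le_trans (normc_sum _ _ _))//.
  apply: (@le_trans _ _ (\sum_(s : {perm 'I_m}) m%:R * d * 2 ^+ m)).
    apply: ler_sum => s _; rewrite -mulrBr normcM.
    have -> : normc ((-1) ^+ s : C) = 1.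
      by case: (odd_perm s); rewrite ?expr1 ?normcN ?expr0 normc1.
    have sz : size (index_enum 'I_m) = m.
      by rewrite -[RHS](card_ord m) cardT enumT; congr size; rewrite /index_enum; unlock.
    rewrite mul1r -[in leRHS]sz; apply: prod_dist => i; first exact: G2.
      by rewrite mxE.
    by rewrite mxE.
  rewrite sumr_const cardT -cardE card_Sn.
  have -> : m%:R * d * 2 ^+ m *+ m`! = d * (m`!%:R * (m%:R * 2 ^+ m)).
    by rewrite -[LHS]mulr_natl; move: (_ ^+ _) (m`!%:R) (m%:R) => p q n; ring.
  rewrite /d mulrAC ler_pdivrMr// ler_pM2l ?invr_gt0// /B lerDl//.
have := normcD (\det G - \det (1%:M : 'M[C]_m)) (- \det G).
by rewrite addrAC subrr add0r !normcN; move: dist; rewrite det1 normc1; lra.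
Qed.

Lemma perm_large m : exists d kappa : R, [/\ 0 < d, 0 < kappa &
  forall U : 'M[C]_m, (forall i j, normc (U i j) <= 1) ->
  (forall i k, normc (\sum_j U i j * Num.conj (U k j) - (i == k)%:R) <= d) ->
  exists s : {perm 'I_m}, forall i, kappa <= normc (U i (s i))].
Proof.
have [d d0 hd] := det_near_id m.
pose N : R := m`!%:R; have N0 : 0 < N by rewrite ltr0n fact_gt0.
pose kappa := (4 * N)^-1; have kp0 : 0 < kappa by rewrite invr_gt0 mulr_gt0.
exists d, kappa; split=> // U U1 hU.
pose Uc := map_mx Num.conj U^T.
have detU : 2^-1 <= normc (\det U).
  have := hd (U *m Uc); rewrite det_mulmx /Uc det_map_mx det_tr normcM normcC.
  have h : forall i j, normc ((U *m Uc) i j - (i == j)%:R) <= d.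
    move=> i k; rewrite mxE; under eq_bigr do rewrite !mxE.
    exact: hU.
  move=> /(_ h); have := normc_ge0 (\det U); move: (normc _) => x x0 xx; nra.
apply: contrapT => /forallNP hs.
have small (s : {perm 'I_m}) : normc ((-1) ^+ s * \prod_i U i (s i)) <= kappa.
  have /existsNP[i /negP] := hs s; rewrite -ltNge => Ui.
  rewrite normcM (_ : normc _ = 1) ?mul1r; last first.
    by case: (odd_perm s); rewrite ?expr1 ?normcN ?expr0 normc1.
  rewrite normc_prod (bigD1 i)//= -[leRHS]mulr1.
  apply: ler_pM; rewrite ?normc_ge0 ?(ltW Ui)//.
    by apply: prodr_ge0 => k _; exact: normc_ge0.
  by apply: prodr_ile1 => k _; rewrite normc_ge0 U1.
have : normc (\det U) <= N * kappa.
  rewrite /determinant (le_trans (normc_sum _ _ _))//.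
  apply: (le_trans (ler_sum _ (fun s _ => small s))).
  by rewrite sumr_const cardT -cardE card_Sn mulr_natl.
rewrite /kappa invfM mulrCA mulfV ?gt_eqF// mulr1; lra.
Qed.

End PermutationChoice.

(** * First-order splitting of the eigenvalue 0 *)

Section Splitting.
Variable R : realType.
Variable H : innerType R.
Hypothesis cH : hcomplete [set: H].
Local Notation C := R[i].

(* In the last clause tau is the time increment and S' the derivative of S at S0.
   The relabeling that makes it hold for each j depends on S only, not on tau. *)
Lemma spectral_splitting m (f : 'I_m -> H) (S0 S' : H -> H) (K' g : R) (d : 'I_m -> R) :
  0 < g -> 0 <= K' -> adjoint_pair S0 S0 -> orthonormal_fam f ->
  (forall j, S0 (f j) = 0) ->
  (forall x, orthc f x -> g * hnorm x <= hnorm (S0 x)) ->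
  bnd S' K' -> (forall j k, '[S' (f j), f k] = (d j)%:C * (j == k)%:R) ->
  exists eta0 B : R, [/\ 0 < eta0, 0 <= B & forall (S : H -> H) (K eta : R),
    adjoint_pair S S -> bnd S K -> bnd (fun u => S u - S0 u) eta ->
    0 <= eta <= eta0 ->
    exists (e : 'I_m -> H) (a : 'I_m -> R),
    [/\ orthonormal_fam e, forall i, S (e i) = (a i)%:C *: e i,
        forall u, orthc e u -> g / 2 * hnorm u <= hnorm (S u) &
        forall tau eps : R, bnd (fun u => S u - S0 u - tau%:C *: S' u) eps ->
          forall j, `|a j - tau * d j| <= B * (eps + `|tau| * eta)]].
Proof.
move=> g0 K'0 S0s fo S0f S0g S'K S'd.
have [dl [kappa [dl0 kp0 hperm]]] := @perm_large R m.
have S0l := adjoint_pair_lin S0s.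
(* With eta <= g/8 one has eta < g/2 < g - eta, as [eigen_family] requires. The other bound gives r
   = 2 eta / g <= min (1, dl), hence r^2 <= dl, the closeness asked by [perm_large]. *)
exists (Num.min (g / 8) (g / 2 * Num.min 1 dl)), ((1 + 2 * K' / g) / kappa); split.
- by rewrite !lt_min !divr_gt0// !mulr_gt0// lt_min ltr01.
- by rewrite divr_ge0 ?addr_ge0 ?divr_ge0 ?mulr_ge0 ?(ltW g0) ?(ltW kp0).
move=> S K eta Ss SK SS0 /andP[eta0].
rewrite le_min => /andP[eta8 etad]; have Sl := adjoint_pair_lin Ss.
have fg x : orthc f x -> (g - eta) * hnorm x <= hnorm (S x).
  move=> xf; have := SS0 x; have := S0g x xf; have := hnorm_sub (S0 x) (S x).
  by rewrite (hnormBC (S0 x)); nra.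
have feta (c : 'I_m -> C) : hnorm (S (\sum_j c j *: f j)) <= eta * hnorm (\sum_j c j *: f j).
  have := SS0 (\sum_j c j *: f j); rewrite (lin_sum _ _ _ S0l).
  rewrite [X in _ - X]big1 ?subr0// => j _.
  by rewrite (lin_onZ S0l)// S0f scaler0.
have [||| e [a [eo Se ab be]]] := @eigen_family R H cH m f S K (g - eta) eta (g / 2) Ss SK fo fg feta; try lra.
have e1 i : hnorm (e i) = 1 := fam_norm eo i.
have f1 i : hnorm (f i) = 1 := fam_norm fo i.
pose P i := \sum_j '[e i, f j] *: f j.
pose x i := e i - P i.
have xf i : orthc f (x i) by exact: comb_rest.
have S0P i : S0 (P i) = 0.
  rewrite /P (lin_sum _ _ _ S0l) big1// => j _.
  by rewrite (lin_onZ S0l)// S0f scaler0.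
have orthP u i : orthc f u -> '[u, P i] = 0.
  by move=> uf; rewrite in_sumr big1// => j _; rewrite inZr uf mulr0.
pose r := 2 * eta / g.
have r0 : 0 <= r by rewrite divr_ge0 ?mulr_ge0// ltW.
have rdl : r <= Num.min 1 dl.
  by rewrite ler_pdivrMr//; move: etad; move: (Num.min 1 dl) => q; lra.
(* (S0 - a_i) x_i is the component of (S0 - S) e_i orthogonal to the f_j, of norm at most eta; there
   S0 is bounded below by g, while |a_i| < g/2. *)
have xr i : hnorm (x i) <= r.
  pose y := S0 (x i) - (a i)%:C *: x i.
  have yf : orthc f y.
    by move=> j; rewrite inBl inZl S0s S0f in0r xf mulr0 subrr.
  have zE : y + - ((a i)%:C *: P i) = S0 (e i) - S (e i).
    rewrite /y /x Se (lin_onB S0l)// S0P subr0 scalerBr opprB addrA.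
    by rewrite [LHS]addrAC addrK.
  have yP : '[y, - ((a i)%:C *: P i)] = 0 by rewrite inNr inZr orthP// mulr0 oppr0.
  have ye : hnorm y <= eta.
    apply: le_of_sqr => //.
    apply: (@le_trans _ _ (hnorm (S0 (e i) - S (e i)) ^+ 2)).
      by rewrite -zE (pythagoras yP) lerDl sqr_ge0.
    apply: le_sqr; first exact: hnorm_ge0.
    by rewrite hnormBC (le_trans (SS0 _))// e1 mulr1.
  have := hnorm_sub (S0 (x i)) ((a i)%:C *: x i); rewrite -/y hnormZR.
  have := S0g _ (xf i); have := ler_hn (x i) (ltW (ab i)).
  rewrite /r ler_pdivlMr//; lra.
pose U : 'M[C]_m := \matrix_(i, j) '[f j, e i].
have U1 i j : normc (U i j) <= 1.
  by rewrite mxE (le_trans (cauchy_schwarz _ _))// e1 f1 mulr1.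
have [|s hs] := hperm U U1.
  move=> i k.
  (* U U^* is the Gram matrix of the projections P_i, that is, the identity minus the Gram matrix of
     the x_i, whose entries are at most r^2. *)
  have -> : \sum_j U i j * Num.conj (U k j) = '[P k, P i].
    rewrite comb_inner2//; apply: eq_bigr => j _.
    by rewrite !mxE mulrC -!inC.
  have -> : '[P k, P i] = (i == k)%:R - '[x k, x i].
    have -> : '[P k, P i] = '[e k, P i].
      by rewrite -[e k](subrK (P k)) inDl (orthP _ _ (xf k)) add0r.
    have <- : '[e k, x i] = '[x k, x i].
      rewrite -{1}[e k](subrK (P k)) inDl [X in _ + X]inC orthP; last exact: xf.
      by rewrite conjC0 addr0.
    by rewrite [in RHS]inBr eo (eq_sym k) opprB addrC subrK.
  rewrite addrAC subrr add0r normcN (le_trans (cauchy_schwarz _ _))//.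
  apply: (@le_trans _ _ (r * r)); first by rewrite ler_pM ?hnorm_ge0.
  move: rdl; rewrite le_min => /andP[r1 rd].
  by rewrite (le_trans _ rd)// -[leRHS]mulr1 ler_wpM2l.
(* The relabeling pairs f_j with an eigenvector whose overlap with it is at least kappa. *)
exists (fun j => e ((s^-1)%g j)), (fun j => a ((s^-1)%g j)); split.
- by move=> i j; rewrite eo (inj_eq perm_inj).
- by move=> i; rewrite Se.
- move=> u uo; apply: be => i; have := uo (s i); rewrite permK//.
move=> tau eps hS j; set i := (s^-1)%g j.
have sij : s i = j by rewrite permKV.
have Se0 : '[S' (f j), e i] = (d j)%:C * U i j + '[S' (f j), x i].
  rewrite -{1}[e i](subrK (P i)) inDr addrC; congr (_ + _).
  rewrite in_sumr (bigD1 j)//= inZr S'd eqxx mulr1 mxE -inC mulrC.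
  by rewrite big1 ?addr0// => k kj; rewrite inZr S'd eq_sym (negPf kj) !mulr0.
(* The expansion of S at f_j is paired with e_i: S f_j yields a_i U_ij, S0 f_j vanishes, and S' f_j
   yields d_j U_ij up to its pairing with x_i. *)
have key : (a i - tau * d j)%:C * U i j =
  '[S (f j) - S0 (f j) - tau%:C *: S' (f j), e i] + tau%:C * '[S' (f j), x i].
  rewrite S0f subr0 inBl inZl Se0 mulrDr opprD addrA subrK.
  rewrite Ss Se inZr conjCR mxE rmorphB rmorphM mulrBl mulrA//.
have kU : kappa <= normc (U i j) by rewrite -sij; exact: hs.
have : `|a i - tau * d j| * normc (U i j) <= eps + `|tau| * (K' * r).
  rewrite -[X in X * _]normcR -normcM key (le_trans (normcD _ _))//.
  apply: lerD.
    by rewrite (le_trans (cauchy_schwarz _ _))// e1 mulr1 (le_trans (hS _))// f1 mulr1.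
  rewrite normcM normcR; apply: ler_wpM2l => //.
  rewrite (le_trans (cauchy_schwarz _ _))//; apply: ler_pM; rewrite ?hnorm_ge0//.
  by rewrite (le_trans (S'K _))// f1 mulr1.
move=> h; have {h} : `|a i - tau * d j| * kappa <= eps + `|tau| * (K' * r).
  by apply: le_trans h; apply: ler_wpM2l.
rewrite -ler_pdivlMr// => h; apply: (le_trans h).
rewrite mulrAC ler_pM2r ?invr_gt0// /r.
have eps0 : 0 <= eps.
  by have := hS (f j); rewrite f1 mulr1; exact: le_trans (hnorm_ge0 _).
have := mulr_ge0 (normr_ge0 tau) eta0.
have gi0 : 0 <= K' / g by rewrite divr_ge0// ltW.
have -> : 2 * K' / g = 2 * (K' / g) by rewrite mulrA.
have -> : K' * (2 * eta / g) = 2 * (K' / g) * eta by field; rewrite gt_eqF.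
by nra.
Qed.

End Splitting.

(** * Orthonormal bases of finite-dimensional subspaces *)

Section OrthonormalBases.
Variable R : realType.
Variable H : innerType R.
Local Notation C := R[i].
Variables (N : set H) (m : nat).
Hypothesis Nm : has_dim N m.

Lemma has_dim_subspace : lsubspace N.
Proof.
have [b [_ ->]] := Nm; split.
  by exists (fun=> 0); rewrite big1// => i _; rewrite scale0r.
move=> a _ _ [c ->] [d ->]; exists (fun i => a * c i + d i).
rewrite scaler_sumr -big_split; apply: eq_bigr => i _ /=.
by rewrite scalerDl scalerA.
Qed.

(** Otherwise a nonzero combination of the f_j would be orthogonal to a basis of N, hence to
    itself. *)
Lemma orthonormal_le_dim k (f : 'I_k -> H) : orthonormal_fam f ->
  (forall j, N (f j)) -> (k <= m)%N.
Proof.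
move=> fo Nf; rewrite leqNgt; apply/negP => mk; have [b [_ Nb]] := Nm.
have [c [[j cj] co]] := exists_orth f b mk; set v := \sum_j _ in co.
have : N v by apply: sub_sum has_dim_subspace _ => i; apply: subZ has_dim_subspace _.
rewrite Nb => -[d vd]; suff v0 : v = 0.
  by move: cj; rewrite (comb_eq0 fo v0 j) eqxx.
apply/hnorm0_eq0; rewrite le_eqVlt; apply/orP; left.
rewrite -sqrf_eq0 -re_inner {2}vd in_sumr big1// => i _.
by rewrite inZr co mulr0.
Qed.

Lemma orthonormal_span (f : 'I_m -> H) : orthonormal_fam f ->
  (forall j, N (f j)) -> forall u, N u -> u = \sum_j '[u, f j] *: f j.
Proof.
move=> fo Nf u Nu; apply/eqP; rewrite -subr_eq0; apply/eqP.
set w := u - _; apply: contrapT => /eqP w0.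
have Nw : N w.
  apply: subB has_dim_subspace Nu _; apply: sub_sum has_dim_subspace _ => i.
  exact: subZ has_dim_subspace _.
pose w1 := (hnorm w)^-1%:C *: w.
have := @orthonormal_le_dim m.+1 (fun i => if unlift ord0 i is Some j then f j else w1).
rewrite ltnn => h; apply: notF; apply: h.
  apply: fam_extend => //.
    exact: subZ (orthc_subspace f) (comb_rest fo u).
  rewrite /w1 hnormZR ger0_norm ?invr_ge0 ?hnorm_ge0//.
  by rewrite mulVf// hnorm_eq0.
move=> i; case: unliftP => [j _|_]; first exact: Nf.
exact: subZ has_dim_subspace _.
Qed.

(** In place of Gram-Schmidt, a longest orthonormal family is taken: if it had fewer than m members,
    some combination of the given basis would be orthogonal to it. *)
Lemma orthonormal_basis :
  exists f : 'I_m -> H, orthonormal_fam f /\ forall j, N (f j).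
Proof.
pose P k := exists f : 'I_k -> H, orthonormal_fam f /\ forall j, N (f j).
pose p k := `[< P k >].
have ep : exists k, p k by exists 0%N; apply/asboolP; exists (fun=> 0); split=> -[].
have pm k : p k -> (k <= m)%N by move/asboolP => -[f [fo Nf]]; exact: orthonormal_le_dim Nf.
case: (ex_maxnP ep pm) => k /asboolP[f [fo Nf]] kmax.
have km : k = m.
  apply/eqP; rewrite eqn_leq pm//=; last by apply/asboolP; exists f.
  rewrite leqNgt; apply/negP => ltkm; have [b [bi Nb]] := Nm.
  have [c [[j cj] co]] := exists_orth b f ltkm; set v := \sum_j _ in co.
  have v0 : v != 0 by apply/eqP => /bi/(_ j) cj0; rewrite cj0 eqxx in cj.
  have := kmax k.+1; rewrite ltnn => h; apply: notF; apply: h; apply/asboolP.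
  pose w1 := (hnorm v)^-1%:C *: v.
  exists (fun i => if unlift ord0 i is Some j then f j else w1); split.
    apply: fam_extend => //; first exact: subZ (orthc_subspace f) co.
    rewrite /w1 hnormZR ger0_norm ?invr_ge0 ?hnorm_ge0//.
    by rewrite mulVf// hnorm_eq0.
  move=> i; case: unliftP => [l _|_]; first exact: Nf.
  by apply: subZ has_dim_subspace _; rewrite Nb; exists c.
by case: _ / km in f fo Nf *; exists f.
Qed.

(** The matrix of S in an orthonormal basis is hermitian; the rows of its diagonalizing unitary
    matrix are the coordinates of the new basis. *)
Lemma orthonormal_diag (S : H -> H) : lin S ->
  (forall u v, N u -> N v -> '[S u, v] = '[u, S v]) ->
  exists (f : 'I_m -> H) (d : 'I_m -> R),
    [/\ orthonormal_fam f, forall j, N (f j) &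
        forall j k, '[S (f j), f k] = (d j)%:C * (j == k)%:R].
Proof.
move=> Sl Ss; have [b [bo Nb]] := orthonormal_basis.
pose A : 'M[C]_m := \matrix_(k, n) '[S (b k), b n].
have Aherm : A \is hermsymmx.
  apply/is_hermitianmxP; rewrite expr0 scale1r; apply/matrixP => k n.
  by rewrite !mxE -inC Ss.
have /hermitian_normalmx/orthomx_spectralP := Aherm.
set P := spectralmx A; set D := spectral_diag A => AE.
have PU : P \is unitarymx := spectral_unitarymx A.
have PP := unitarymxP PU.
have PAP : P *m A *m map_mx Num.conj P^T = diag_mx D.
  rewrite AE invmx_unitary// !mulmxA PP mul1mx -!mulmxA PP mulmx1 //.
have Dr : D \is a mxOver Num.real := hermitian_spectral_diag_real Aherm.
pose f j := \sum_k P j k *: b k.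
have Nf j : N (f j).
  by apply: sub_sum has_dim_subspace _ => k; exact: subZ has_dim_subspace _.
exists f, (fun j => re (D 0 j)); split=> // j k.
  rewrite comb_inner2//; have := congr1 (fun M : 'M[C]_m => M j k) PP.
  by rewrite !mxE => <-; apply: eq_bigr => l _; rewrite !mxE.
have -> : (re (D 0 j))%:C * (j == k)%:R = (diag_mx D) j k.
  have Dj : D 0 j = (re (D 0 j))%:C by rewrite RRe_real//; exact: (mxOverP Dr).
  by rewrite mxE -Dj mulr_natr; case: eqP => // ->.
rewrite -PAP mxE /f (lin_sum _ _ _ Sl) in_sumr; apply: eq_bigr => n _.
rewrite inZr !mxE in_suml mulrC; congr (_ * _); apply: eq_bigr => l _.
by rewrite (lin_onZ Sl)// inZl mxE.
Qed.

End OrthonormalBases.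

(** * Operator norms and limits along a family *)

Section OperatorNorm.
Variable R : realType.
Implicit Types E F G : innerType R.

(** Covers both norms in use: [hnorm] on the whole space and the graph norm on dom A^*, where
    homogeneity comes from linearity of A^*. *)
Record seminorm_on E (D : set E) (N : E -> R) : Prop := SeminormOn {
  sn_sub : lsubspace D;
  sn_ge0 : forall u, 0 <= N u;
  snZ : forall a u, D u -> N (a *: u) = normc a * N u }.

Lemma hnorm_seminorm E : seminorm_on [set: E] (@hnorm R E).
Proof. by split; [|move=> u; exact: hnorm_ge0|move=> a u _; exact: hnormZ]. Qed.

Lemma sn0 E (D : set E) N : seminorm_on D N -> N 0 = 0.
Proof.
move=> sN; rewrite -(scale0r 0) (snZ sN); last exact: sub0 (sn_sub sN).
by rewrite -[0 : R[i]]/((0 : R)%:C) normcR normr0 mul0r.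
Qed.

Lemma opnorm_bound E F (D : set E) (N : E -> R) (f : E -> F) : seminorm_on D N ->
  bounded_on D N f -> forall u, D u -> hnorm (f u) <= opnorm_on D N f * N u.
Proof.
move=> sN [fl [M hM]] u Du.
(* Such u cannot be normalized; any bound from [bounded_on] gives f u = 0. *)
have [N0|N0] := eqVneq (N u) 0.
  by rewrite N0 mulr0; have := hM u Du; rewrite N0 mulr0.
have Np : 0 < N u by rewrite lt_def N0 (sn_ge0 sN).
rewrite -ler_pdivrMr//; apply: ub_le_sup.
  exists `|M| => _ [v [Dv Nv] <-]; rewrite (le_trans (hM v Dv))//.
  rewrite (le_trans (ler_norm _))// normrM (ger0_norm (sn_ge0 sN v)).
  by rewrite -[leRHS]mulr1 ler_wpM2l.
exists ((N u)^-1%:C *: u).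
  split; first exact: subZ (sn_sub sN) Du.
  by rewrite (snZ sN)// normcR gtr0_norm ?invr_gt0// mulVf.
by rewrite (lin_onZ fl)// hnormZR gtr0_norm ?invr_gt0// mulrC.
Qed.

Lemma opnorm_le E F (D : set E) (N : E -> R) (f : E -> F) (e : R) :
  seminorm_on D N -> 0 <= e -> (forall u, D u -> hnorm (f u) <= e * N u) ->
  `|opnorm_on D N f| <= e.
Proof.
move=> sN e0 h.
pose A := [set hnorm (f u) | u in [set u | D u /\ N u <= 1]].
have A0 : A (hnorm (f 0)).
  by exists 0 => //; split; [exact: sub0 (sn_sub sN) | rewrite (sn0 sN)].
have Ae x : A x -> x <= e.
  move=> [u [Du Nu] <-]; rewrite (le_trans (h u Du))// -[leRHS]mulr1.
  by rewrite ler_wpM2l.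
rewrite ger0_norm; first by apply: ge_sup => //; exists (hnorm (f 0)).
by apply: le_trans (hnorm_ge0 (f 0)) _; apply: ub_le_sup => //; exists e.
Qed.

Section Filters.
Variables (Fl : set_system R) (FFl : Filter Fl).

(** Convergence of the operator norm to 0 without the supremum: it can be tested on vectors and
    needs no prior boundedness of [f t]. *)
Definition small E F (D : set E) (N : E -> R) (f : R -> E -> F) : Prop :=
  forall e : R, 0 < e -> \forall t \near Fl, forall u, D u -> hnorm (f t u) <= e * N u.

Definition ubnd E F (D : set E) (N : E -> R) (f : R -> E -> F) : Prop :=
  exists2 M : R, 0 < M & \forall t \near Fl, forall u, D u -> hnorm (f t u) <= M * N u.

Lemma opnorm_small E F (D : set E) N (f : R -> E -> F) : seminorm_on D N ->
  (\forall t \near Fl, bounded_on D N (f t)) ->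
  opnorm_on D N (f t) @[t --> Fl] --> (0 : R) -> small D N f.
Proof.
move=> sN fb /cvgrPdist_le fc e e0; near=> t => u Du.
have tb : bounded_on D N (f t) by near: t.
rewrite (le_trans (opnorm_bound sN tb Du))//.
rewrite ler_wpM2r ?(sn_ge0 sN)// (le_trans (ler_norm _))//.
rewrite -normrN -sub0r; near: t; exact: fc.
Unshelve. all: by end_near. Qed.

Lemma small_opnorm E F (D : set E) N (f : R -> E -> F) : seminorm_on D N ->
  small D N f -> opnorm_on D N (f t) @[t --> Fl] --> (0 : R).
Proof.
move=> sN fs; apply/cvgrPdist_le => e e0; near=> t.
rewrite sub0r normrN; apply: opnorm_le => //; first exact: ltW.
by near: t; exact: fs.
Unshelve. all: by end_near. Qed.

Lemma smallS E F (D : set E) N (f g : R -> E -> F) :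
  (\forall t \near Fl, forall u, D u -> hnorm (g t u) <= hnorm (f t u)) ->
  small D N f -> small D N g.
Proof.
move=> fg fs e e0; near=> t => u Du; apply: (@le_trans _ _ (hnorm (f t u))).
  by move: u Du; near: t.
by move: u Du; near: t; exact: fs.
Unshelve. all: by end_near. Qed.

Lemma smallD E F (D : set E) N (f g : R -> E -> F) :
  small D N f -> small D N g -> small D N (fun t u => f t u + g t u).
Proof.
move=> fs gs e e0; have e2 : 0 < e / 2 by rewrite divr_gt0.
near=> t => u Du; rewrite (le_trans (hnorm_triangle _ _))//.
rewrite [e]splitr mulrDl lerD//.
  by move: u Du; near: t; exact: fs.
by move: u Du; near: t; exact: gs.
Unshelve. all: by end_near. Qed.

Lemma smallB E F (D : set E) N (f g : R -> E -> F) :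
  small D N f -> small D N g -> small D N (fun t u => f t u - g t u).
Proof.
move=> fs gs; apply: smallD => //; apply: smallS gs.
by near=> t => u _; rewrite hnormN.
Unshelve. all: by end_near. Qed.

Lemma small_compr E (E' : innerType R) F (D : set E) N (D' : set E') N' 
  (k : R -> E' -> E) (f : R -> E -> F) M :
  0 < M -> (\forall t \near Fl, forall u, D' u -> D (k t u) /\ N (k t u) <= M * N' u) ->
  small D N f -> small D' N' (fun t u => f t (k t u)).
Proof.
move=> M0 kM fs e e0; have eM : 0 < e / M by rewrite divr_gt0.
near=> t => u Du.
have [Dk Nk] : D (k t u) /\ N (k t u) <= M * N' u by move: u Du; near: t.
apply: (@le_trans _ _ (e / M * N (k t u))).
  by move: (k t u) Dk; near: t; exact: fs.
by rewrite -mulrA ler_pM2l// ler_pdivrMl.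
Unshelve. all: by end_near. Qed.

Lemma small_ubnd E F (D : set E) N (f : R -> E -> F) (g : E -> F) M : (forall u, 0 <= N u) ->
  (forall u, D u -> hnorm (g u) <= M * N u) ->
  small D N (fun t u => f t u - g u) -> ubnd D N f.
Proof.
move=> N0 gM fs; exists (`|M| + 1); first by rewrite ltr_wpDl.
near=> t => u Du; rewrite -[f t u](subrK (g u)) (le_trans (hnorm_triangle _ _))//.
rewrite addrC mulrDl lerD//.
  by rewrite (le_trans (gM u Du))// ler_wpM2r// ler_norm.
by move: u Du; near: t; exact: fs.
Unshelve. all: by end_near. Qed.

End Filters.

Lemma adjoint_small (Fl : set_system R) (FFl : Filter Fl) E F (f : R -> E -> F)
    (f0 : E -> F) (g : R -> F -> E) (g0 : F -> E) :
  (\forall t \near Fl, adjoint_pair (f t) (g t)) -> adjoint_pair f0 g0 ->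
  small Fl setT (@hnorm R E) (fun t u => f t u - f0 u) ->
  small Fl setT (@hnorm R F) (fun t u => g t u - g0 u).
Proof.
move=> fg fg0 fs e e0; near=> t => u _.
have e0' := ltW e0.
apply: (adjoint_pair_bnd (f := fun u => f t u - f0 u) (g := fun u => g t u - g0 u) e0').
  move=> x y; rewrite inBl inBr fg0; congr (_ - _).
  by have : adjoint_pair (f t) (g t); [near: t | exact].
by move=> x; have : forall u, setT u -> hnorm (f t u - f0 u) <= e * hnorm u; [near: t; exact: fs | exact].
Unshelve. all: by end_near. Qed.

(** * Neighborhoods of a time in [0, 1] *)

Section Time.
Variable t0 : R.

Lemma near_nbhs01 (P : R -> Prop) : (\forall t \near nbhs t0, 0 <= t <= 1 -> P t) ->
  \forall t \near nbhs01 t0, P t.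
Proof.
move=> h; rewrite /nbhs01 near_withinE; apply: filterS h => t h.
by rewrite /= in_itv /=; exact: h.
Qed.

Lemma nbhs01_I : \forall t \near nbhs01 t0, 0 <= t <= 1.
Proof. by apply: near_nbhs01; near=> t. Unshelve. all: by end_near. Qed.

Lemma nbhs01_dnbhs01 (P : R -> Prop) : (\forall t \near nbhs01 t0, P t) ->
  \forall t \near dnbhs01 t0, P t.
Proof.
rewrite /nbhs01 /dnbhs01 !near_withinE => h.
by apply: filterS h => t h _ It; exact: h.
Qed.

Lemma dnbhs01_nbhs01 (P : R -> Prop) : (\forall t \near dnbhs01 t0, P t) -> P t0 ->
  \forall t \near nbhs01 t0, P t.
Proof.
rewrite /nbhs01 /dnbhs01 !near_withinE => h P0.
apply: filterS h => t h It; have [->//|tt0] := eqVneq t t0.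
exact: h.
Qed.

Lemma dnbhs01_neq : \forall t \near dnbhs01 t0, t != t0.
Proof.
rewrite /dnbhs01 !near_withinE; near=> t => //.
Unshelve. all: by end_near. Qed.

Lemma nbhs01_dist (e : R) : 0 < e -> \forall t \near nbhs01 t0, `|t - t0| <= e.
Proof.
move=> e0; apply: near_nbhs01; apply/nbhs_ballP; exists e => //= t.
by rewrite /ball /= distrC => /ltW.
Qed.

(** The punctured filter is proper, also at the endpoints: a step of length at most 1/2 towards the
    farther endpoint stays in [0, 1]. *)
Lemma dnbhs01_ex (P : R -> Prop) : 0 <= t0 <= 1 ->
  (\forall t \near dnbhs01 t0, P t) -> exists t, P t.
Proof.
move=> /andP[t00 t01]; rewrite /dnbhs01 !near_withinE.
move=> /nbhs_ballP[e /= e0 h].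
pose d := Num.min (e / 2) (1 / 2).
have d0 : 0 < d by rewrite lt_min !divr_gt0.
have de : d < e by rewrite gt_min; apply/orP; left; lra.
have d2 : d <= 1 / 2 by rewrite ge_min lexx orbT.
have [th|th] := lerP t0 (1 / 2).
  exists (t0 + d); apply: h; rewrite /ball /= ?in_itv /=.
  - by rewrite opprD addrA subrr sub0r normrN gtr0_norm.
  - by rewrite -subr_eq0 addrAC subrr add0r gt_eqF.
  - by apply/andP; split; lra.
exists (t0 - d); apply: h; rewrite /ball /= ?in_itv /=.
- by rewrite opprB addrC subrK gtr0_norm.
- by rewrite -subr_eq0 addrAC subrr add0r oppr_eq0 gt_eqF.
- by apply/andP; split; lra.
Qed.

End Time.
End OperatorNorm.

(** * Lagrangian frames and boundary triplets *)

Section LagrangianFrame.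
Variable R : realType.
Variable h : innerType R.
Hypothesis ch : hcomplete [set: h].
Variables (X Y : h -> h).
Hypotheses (Xb : bounded_op X) (Yb : bounded_op Y).
Hypothesis XYc : forall x, X (adj Y x) = Y (adj X x).
Hypothesis XYr : ~ Spec (full (block_op X Y)) 0.

Let Xl : lin X := Xb.1.
Let Yl : lin Y := Yb.1.
Let Xp : adjoint_pair X (adj X) := adj_pair ch Xb.
Let Yp : adjoint_pair Y (adj Y) := adj_pair ch Yb.
Let Xsl : lin (adj X) := adjoint_pair_lin Xp.
Let Ysl : lin (adj Y) := adjoint_pair_lin Yp.

(** Parametrizes the Lagrangian subspace ker [X, Y]; on that kernel [W] is its inverse. *)
Definition frame (x : h) : h * h := (- adj Y x, adj X x).

Lemma frame_lin : lin frame.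
Proof.
apply: linP => a u v; rewrite /frame; congr pair.
  by rewrite /= (Ysl.2 a u v)// opprD scalerN.
by rewrite /= (Xsl.2 a u v).
Qed.

Lemma block_bij : set_bij setT setT (block_op X Y) /\
  exists2 K, 0 < K & forall f g, block_op X Y f = g -> hnorm f <= K * hnorm g.
Proof.
move/contrapT: XYr => [bij ib].
have E0 : (op_shift (full (block_op X Y)) 0 : h * h -> h * h) = block_op X Y.
  by apply/funext => f /=; rewrite scale0r subr0.
have bij' : set_bij setT setT (block_op X Y) by rewrite -E0.
split=> //; have [K K0 hK] := bnd_ex ib; exists K => // f g fg.
have [_ inj _] := bij'.
suff <- : resolvent (full (block_op X Y)) 0 g = f by exact: hK.
rewrite /resolvent /op_inv; case: xgetP => [x -> [_]|/(_ f)].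
  by rewrite E0 -fg => /inj; rewrite !inE; apply.
by case; split=> //; rewrite E0.
Qed.

(** [frame x] is the adjoint of the block operator applied to (0, x). Solving block f = (0, x) with
    |f| <= K |x| gives |x|^2 = <f, frame x>. *)
Lemma frame_below : exists2 c, 0 < c & forall x, c * hnorm x <= hnorm (frame x).
Proof.
have [[_ _ surj] [K K0 hK]] := block_bij.
exists K^-1; first by rewrite invr_gt0.
move=> x; rewrite mulrC ler_pdivrMr//.
have [x0|x0] := eqVneq (hnorm x) 0; first by rewrite x0 mulr_ge0 ?hnorm_ge0// ltW.
have [f _ fx] := surj (0, x) I.
have nx : hnorm ((0, x) : h * h) = hnorm x.
  by apply/eqP; rewrite -(@eqrXn2 _ 2) ?hnorm_ge0// hnorm_prod /= hnorm0 expr0n add0r.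
have : (hnorm x ^+ 2)%:C = '[f, frame x].
  rewrite sqr_hnorm prod_innerE /= inNr -Xp -Yp -inNl -inDl.
  by move: fx => [_ <-].
move=> /(congr1 (@normc R)); rewrite normcR ger0_norm ?sqr_ge0// expr2 => hx.
have xp : 0 < hnorm x by rewrite lt_def x0 hnorm_ge0.
rewrite -(ler_pM2r xp) hx (le_trans (cauchy_schwarz _ _))//.
rewrite mulrC -[leRHS]mulrA; apply: ler_wpM2l; first exact: hnorm_ge0.
by rewrite -nx; exact: hK.
Qed.

Let M x := X (adj X x) + Y (adj Y x).

Lemma gram_selfadj : adjoint_pair M M.
Proof.
move=> u v; rewrite /M inDl inDr (Xp (adj X u)) (Yp (adj Y u)).
by rewrite (adjoint_pairC Xp) (adjoint_pairC Yp).
Qed.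

(** M is self-adjoint with <M u, u> = |frame u|^2 >= c^2 |u|^2, so 0 is in its resolvent set and
    [inverse M] is the resolvent there. *)
Lemma gram_inv : adjoint_pair (inverse M) (inverse M) /\ forall x, M (inverse M x) = x.
Proof.
have Msa : selfadj (full M).
  split.
  - by apply: adjoint_pair_lin gram_selfadj.
  - by move=> u v _ _; exact: gram_selfadj.
  - move=> v w hv; split=> //=; apply: inner_eq => u.
    by rewrite -gram_selfadj; exact: hv.
have [c c0 hc] := frame_below.
have b0 : below (full M) 0 (c ^+ 2).
  move=> u _ /=; rewrite scale0r subr0.
  have [->|u0] := eqVneq u 0; first by rewrite hnorm0 mulr0 hnorm_ge0.
  have up : 0 < hnorm u by rewrite hnorm_gt0.
  rewrite -(ler_pM2r up) -mulrA -expr2 -exprMn.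
  apply: (@le_trans _ _ (hnorm (frame u) ^+ 2)).
    by apply: le_sqr; rewrite ?hc// mulr_ge0 ?hnorm_ge0// ltW.
  have : (hnorm (frame u) ^+ 2)%:C = '[M u, u].
    by rewrite sqr_hnorm prod_innerE /= inNl inNr opprK addrC inDl Xp Yp.
  move=> /(congr1 (@normc R)); rewrite normcR ger0_norm ?sqr_ge0// => ->.
  exact: cauchy_schwarz.
have rs : resolvent_set (full M) 0 by apply: below_resolvent_set b0; rewrite ?exprn_gt0.
have E0 : op_shift (full M) 0 = full M.
  by rewrite /op_shift /full; congr Operator; apply/funext => x /=; rewrite scale0r subr0.
have Ei : inverse M = resolvent (full M) 0 by rewrite /inverse /resolvent E0.
split.
  have := res_adj Msa rs; rewrite conjC0 -Ei; exact.
by move=> x; have := (resP rs x).2; rewrite Ei /= scale0r subr0.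
Qed.

(** The block operator is injective and sends both sides to (0, - Y f_1 + X f_2); the first
    component of the right side vanishes by the commutation relation. *)
Lemma W_frame f : row_op X Y f = 0 -> f = frame (W X Y f).
Proof.
move=> f0; have [[_ inj _] _] := block_bij; apply: inj; rewrite ?inE//.
rewrite /block_op /= -[X f.1 + _]/(row_op X Y f) f0; congr pair.
  by rewrite (lin_onN Xl)// XYc addNr.
rewrite (lin_onN Yl)// opprK [RHS]addrC.
exact: esym (gram_inv.2 (- Y f.1 + X f.2)).
Qed.

Lemma frame_inj : injective frame.
Proof.
move=> x y xy; have [c c0 hc] := frame_below.
apply/eqP; rewrite -subr_eq0; apply/eqP/hnorm0_eq0.
have := hc (x - y); rewrite (lin_onB frame_lin)// xy subrr hnorm0.
by rewrite pmulr_rle0.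
Qed.

Lemma W_adj : adjoint_pair (W X Y) (adj (W X Y)).
Proof.
suff h' : adjoint_pair (W X Y) (fun x => frame (inverse M x)) by rewrite (adjE h').
move=> f x; have [iM _] := gram_inv.
rewrite /W iM inDl inNl prod_innerE /= inNr Xp Yp addrC.
by [].
Qed.

End LagrangianFrame.

(** * The graph norm and boundary triplets *)

Section BoundaryTriplet.
Variable R : realType.
Variables (H h : hilbertType R).
Variable A : operator H H.
Hypothesis A_dense : dense (dom A).

Local Notation Hp := (dom (adjoint A)).
Local Notation gN := (graph_norm (adjoint A)).

Lemma graph_normE u : gN u = hnorm ((u, adjoint A u) : (H * H)%type).
Proof. by []. Qed.

Lemma adjoint_linear : linear_on Hp (adjoint A).
Proof.
have dA w : (forall u, dom A u -> '[u, w] = 0) -> w = 0 by exact: dense_orth.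
have key a u v : Hp u -> Hp v -> Hp (a *: u + v) /\
    adjoint A (a *: u + v) = a *: adjoint A u + adjoint A v.
  move=> Hu Hv; apply: adjointE => // x Dx.
  by rewrite !inDr !inZr (adjoint_rep Hu)// (adjoint_rep Hv).
split; last by move=> a u v Hu Hv; exact: (key a u v Hu Hv).2.
split; last by move=> a u v Hu Hv; exact: (key a u v Hu Hv).1.
by exists 0 => u Du; rewrite !in0r.
Qed.

Lemma graph_seminorm : seminorm_on Hp gN.
Proof.
split; first exact: adjoint_linear.1.
  by move=> u; exact: sqrtr_ge0.
move=> a u Hu; rewrite !graph_normE (lin_onZ adjoint_linear)//.
rewrite -hnormZ; congr hnorm.
Qed.

Lemma graph_norm_le u : gN u <= hnorm u + hnorm (adjoint A u).
Proof. exact: (hnorm_pair ((u, adjoint A u) : (H * H)%type)). Qed.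

(** A self-adjoint extension B of A satisfies B = B^* and is therefore a restriction of A^*. *)
Lemma extension_adjoint (B : operator H H) u : selfadj B -> extends A B -> dom B u ->
  Hp u /\ adjoint A u = B u.
Proof.
move=> Bsa [AB ABE] Du; apply: adjointE; first by move=> w; exact: dense_orth.
by move=> v Dv; rewrite -ABE// (sa_sym Bsa)//; exact: AB.
Qed.

Lemma green (T : H -> h * h) u v :
  boundary_triplet A (fun u => (T u).1) (fun u => (T u).2) -> Hp u -> Hp v ->
  '[adjoint A u, v] - '[u, adjoint A v] = '[J (T u), T v].
Proof.
move=> [_ _ G] Hu Hv; rewrite G// prod_innerE /= inNl.
by [].
Qed.

Lemma triplet_linear (T : H -> h * h) :
  boundary_triplet A (fun u => (T u).1) (fun u => (T u).2) -> linear_on Hp T.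
Proof.
move=> [Tl _ _]; suff -> : T = (fun u => ((T u).1, (T u).2)) by [].
by apply/funext => u; case: (T u).
Qed.

End BoundaryTriplet.

Section Differences.
Variables (R : realType) (E F : innerType R) (D : set E) (N : E -> R).
Hypothesis sN : seminorm_on D N.
Implicit Types f g : E -> F.

Lemma bounded_on_sub f g :
  bounded_on D N f -> bounded_on D N g -> bounded_on D N (fun u => f u - g u).
Proof.
move=> [fl [M fM]] [gl [K gK]]; split.
  split; first exact: fl.1.
  by move=> a u v Du Dv; rewrite fl.2// gl.2// opprD addrACA scalerBr.
exists (M + K) => u Du; rewrite (le_trans (hnorm_triangleB _ _))// mulrDl.
by rewrite lerD ?fM ?gK.
Qed.

Lemma bounded_on_scale (a : R[i]) f :
  bounded_on D N f -> bounded_on D N (fun u => a *: f u).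
Proof.
move=> [fl [M fM]]; split.
  split; first exact: fl.1.
  by move=> b u v Du Dv; rewrite fl.2// scalerDr !scalerA mulrC.
exists (normc a * M) => u Du; rewrite hnormZ -mulrA; apply: ler_nc; exact: fM.
Qed.

Variables (f : R -> E -> F) (t0 : R).
Hypothesis It0 : 0 <= t0 <= 1.
Hypothesis fb : forall t, 0 <= t <= 1 -> bounded_on D N (f t).

Lemma continuous_on_small : continuous_on01 D N f t0 ->
  small (nbhs01 t0) D N (fun t u => f t u - f t0 u).
Proof.
apply: opnorm_small => //; near=> t; apply: bounded_on_sub; last exact: fb.
by apply: fb; near: t; exact: nbhs01_I.
Unshelve. all: by end_near. Qed.

Lemma derivative_on_small f' : derivative_on01 D N f t0 f' ->
  small (dnbhs01 t0) D N (fun t u => diff_quot (f ^~ u) t0 t - f' u).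
Proof.
move=> [f'b]; apply: opnorm_small => //; near=> t; apply: bounded_on_sub => //.
apply: bounded_on_scale; apply: bounded_on_sub; last exact: fb.
by apply: fb; near: t; apply: nbhs01_dnbhs01; exact: nbhs01_I.
Unshelve. all: by end_near. Qed.

Lemma derivative_on_small_diff f' : derivative_on01 D N f t0 f' ->
  small (nbhs01 t0) D N (fun t u => f t u - f t0 u).
Proof.
move=> fd e e0; have [[_ [M f'M]] _] := fd; have fs := derivative_on_small fd.
have k0 : 0 < 1 + `|M| by rewrite ltr_wpDr.
have ek : 0 < e / (1 + `|M|) by rewrite divr_gt0.
apply: dnbhs01_nbhs01; last first.
  by move=> u _; rewrite subrr hnorm0 mulr_ge0 ?(sn_ge0 sN)// ltW.
near=> t => u Du.
have tt0 : t != t0 by near: t; exact: dnbhs01_neq.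
have ht : `|t - t0| <= e / (1 + `|M|) by near: t; apply: nbhs01_dnbhs01; exact: nbhs01_dist.
(* Error 1 suffices: the quotient is then bounded by 1 + |M|, and the factor t - t0 provides the
   smallness. *)
have q1 : hnorm (diff_quot (f ^~ u) t0 t - f' u) <= 1 * N u.
  by move: u Du; near: t; exact: fs.
have q2 : hnorm (diff_quot (f ^~ u) t0 t) <= (1 + `|M|) * N u.
  rewrite -[diff_quot _ _ _](subrK (f' u)) (le_trans (hnorm_triangle _ _))// mulrDl lerD//.
  rewrite (le_trans (f'M _ Du))// ler_wpM2r ?(sn_ge0 sN)//; exact: ler_norm.
have -> : f t u - f t0 u = (t - t0)%:C *: diff_quot (f ^~ u) t0 t.
  by rewrite /diff_quot scalerA -rmorphM divff ?subr_eq0// rmorph1 scale1r.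
rewrite hnormZR (le_trans (ler_pM _ _ ht q2))// ?hnorm_ge0//.
by rewrite mulrA divfK// gt_eqF.
Unshelve. all: by end_near. Qed.

End Differences.

(** * Small sesquilinear forms *)

Section WeakCalculus.
Variables (R : realType) (Fl : set_system R) (FFl : Filter Fl).
Implicit Types E F G : innerType R.

(** By [small_of_weak] it gives norm smallness of operators, so limits can be taken in the weak
    Krein formula without handling its adjoints. *)
Definition wsmall E F (B : R -> E -> F -> R[i]) : Prop :=
  forall e : R, 0 < e -> \forall t \near Fl, forall u v,
    normc (B t u v) <= e * hnorm u * hnorm v.

Lemma wsmallD E F (B C : R -> E -> F -> R[i]) :
  wsmall B -> wsmall C -> wsmall (fun t u v => B t u v + C t u v).
Proof.
move=> Bs Cs e e0; have e2 : 0 < e / 2 by rewrite divr_gt0.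
near=> t => u v; rewrite (le_trans (normcD _ _))//.
rewrite [e]splitr 2!mulrDl lerD//.
  by move: u v; near: t; exact: Bs.
by move: u v; near: t; exact: Cs.
Unshelve. all: by end_near. Qed.

Lemma wsmall_eq E F (B C : R -> E -> F -> R[i]) :
  (\forall t \near Fl, forall u v, C t u v = B t u v) -> wsmall B -> wsmall C.
Proof.
move=> BC Bs e e0; near=> t => u v.
have -> : C t u v = B t u v by move: u v; near: t.
by move: u v; near: t; exact: Bs.
Unshelve. all: by end_near. Qed.

Lemma wsmallN E F (B : R -> E -> F -> R[i]) :
  wsmall B -> wsmall (fun t u v => - B t u v).
Proof.
move=> Bs e e0; near=> t => u v; rewrite normcN.
by move: u v; near: t; exact: Bs.
Unshelve. all: by end_near. Qed.

Lemma small_of_weak E F (f : R -> E -> F) :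
  wsmall (fun t u v => '[f t u, v]) -> small Fl setT (@hnorm R E) f.
Proof.
move=> fs e e0; near=> t => u _; apply: hnorm_le_rep.
  by rewrite mulr_ge0 ?hnorm_ge0// ltW.
move=> v; rewrite inC normcC; move: u v; near: t; exact: fs.
Unshelve. all: by end_near. Qed.

Lemma wsmall_small_ubnd E F G (b : R -> E -> G) (a : R -> F -> G) :
  small Fl setT (@hnorm R E) b -> ubnd Fl setT (@hnorm R F) a ->
  wsmall (fun t u v => '[b t u, a t v]).
Proof.
move=> bs [M M0 aM] e e0; have eM : 0 < e / M by rewrite divr_gt0.
near=> t => u v; rewrite (le_trans (cauchy_schwarz _ _))//.
have h1 : hnorm (b t u) <= e / M * hnorm u.
  by have : forall u, setT u -> hnorm (b t u) <= e / M * hnorm u; [near: t; exact: bs | exact].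
have h2 : hnorm (a t v) <= M * hnorm v.
  by have : forall v, setT v -> hnorm (a t v) <= M * hnorm v; [near: t; exact: aM | exact].
rewrite (le_trans (ler_pM (hnorm_ge0 _) (hnorm_ge0 _) h1 h2))//.
rewrite mulrACA mulrA divfK ?gt_eqF//.
Unshelve. all: by end_near. Qed.

Lemma wsmall_ubnd_small E F G (b : R -> E -> G) (a : R -> F -> G) :
  ubnd Fl setT (@hnorm R E) b -> small Fl setT (@hnorm R F) a ->
  wsmall (fun t u v => '[b t u, a t v]).
Proof.
move=> bM as_ e e0; near=> t => u v; rewrite inC normcC mulrAC; move: v u.
near: t; exact: (wsmall_small_ubnd as_ bM).
Unshelve. all: by end_near. Qed.

Lemma wsmall_diff E F G (b : R -> E -> G) (b0 : E -> G) (a : R -> F -> G) (a0 : F -> G) M :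
  small Fl setT (@hnorm R E) (fun t u => b t u - b0 u) ->
  ubnd Fl setT (@hnorm R F) a ->
  (forall u, hnorm (b0 u) <= M * hnorm u) ->
  small Fl setT (@hnorm R F) (fun t u => a t u - a0 u) ->
  wsmall (fun t u v => '[b t u, a t v] - '[b0 u, a0 v]).
Proof.
move=> bs aM b0M as_.
apply: (@wsmall_eq _ _ (fun t u v => '[b t u - b0 u, a t v] + '[b0 u, a t v - a0 v])).
  by apply: nearW => t u v; rewrite inBl inBr addrA subrK.
apply: wsmallD; first exact: wsmall_small_ubnd.
apply: (wsmall_ubnd_small (b := fun=> b0)) => //.
exists (`|M| + 1); first by rewrite ltr_wpDl.
apply: nearW => t u _; rewrite (le_trans (b0M u))// ler_hn//.
by rewrite ler_wpDr// ler_norm.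
Qed.

End WeakCalculus.

(** * Krein's formula *)

Section Family.
Variables (R : realType) (H h : hilbertType R) (A : operator H H).
Hypotheses (A_dense : dense (dom A)).
Variables (T : R -> H -> h * h) (V : R -> H -> H).
Variables (AA : R -> operator H H) (X Y : R -> h -> h).
Local Notation Hp := (dom (adjoint A)).
Local Notation gN := (graph_norm (adjoint A)).
Local Notation I01 t := (0 <= t <= 1 :> R).
Hypotheses
  (T_bounded : forall t : R, 0 <= t <= 1 -> bounded_on Hp gN (T t))
  (T_triplet : forall t : R, 0 <= t <= 1 ->
     boundary_triplet A (fun u => (T t u).1) (fun u => (T t u).2))
  (V_selfadjoint : forall t : R, 0 <= t <= 1 ->
     bounded_op (V t) /\ self_adjoint (full (V t)))
  (XY_bounded : forall t : R, 0 <= t <= 1 -> bounded_op (X t) /\ bounded_op (Y t))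
  (AA_extension : forall t : R, 0 <= t <= 1 ->
     [/\ self_adjoint (AA t), extends A (AA t) &
         dom (AA t) = [set u | Hp u /\ row_op (X t) (Y t) (T t u) = 0]])
  (XY_commute : forall t : R, 0 <= t <= 1 ->
     forall x, X t (adj (Y t) x) = Y t (adj (X t) x))
  (XY_regular : forall t : R, 0 <= t <= 1 ->
     ~ Spec (full (block_op (X t) (Y t))) 0).

Local Notation Ht t := (add_op (AA t) (V t)).
Local Notation Rt t z := (resolvent (Ht t) z).
Local Notation Wt t := (W (X t) (Y t)).
Local Notation Ft t := (frame (X t) (Y t)).

Let cH := @hilbert_complete R H.
Let ch := @hilbert_complete R h.
Let gS : seminorm_on Hp gN := graph_seminorm A_dense.
Let hS := hnorm_seminorm H.

Section Static.
Variable t : R.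
Hypothesis It : 0 <= t <= 1.

Lemma V_pair : adjoint_pair (V t) (V t).
Proof. exact/selfadj_full/self_adjoint_selfadj/(V_selfadjoint It).2. Qed.

Lemma AA_sa : selfadj (AA t).
Proof. by case: (AA_extension It) => /self_adjoint_selfadj. Qed.

Lemma H_sa : selfadj (Ht t).
Proof. exact: selfadj_add AA_sa V_pair. Qed.

Lemma dom_Hp u : dom (AA t) u -> Hp u.
Proof. by case: (AA_extension It) => _ _ -> []. Qed.

Lemma dom_adjoint u : dom (AA t) u -> adjoint A u = AA t u.
Proof.
by case: (AA_extension It) => _ e _ Du; case: (extension_adjoint A_dense AA_sa e Du).
Qed.

Lemma dom_row u : dom (AA t) u -> row_op (X t) (Y t) (T t u) = 0.
Proof. by case: (AA_extension It) => _ _ -> []. Qed.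

Lemma X_pair : adjoint_pair (X t) (adj (X t)).
Proof. exact: adj_pair (XY_bounded It).1. Qed.
Lemma Y_pair : adjoint_pair (Y t) (adj (Y t)).
Proof. exact: adj_pair (XY_bounded It).2. Qed.

Lemma dom_frame u : dom (AA t) u -> T t u = Ft t (Wt t (T t u)).
Proof.
move=> Du; have [Xb Yb] := XY_bounded It.
exact: W_frame (XY_commute It) (XY_regular It) _ (dom_row Du).
Qed.

Lemma T_linear : linear_on Hp (T t).
Proof. exact: triplet_linear (T_triplet It). Qed.

Lemma res_set_conj z : resolvent_set (Ht t) z -> resolvent_set (Ht t) (Num.conj z).
Proof.
move=> rz; have [c c0 bz] := res_below rz.
exact: below_resolvent_set H_sa _ _ cH c0 (below_conj H_sa bz).
Qed.

(** The resolvent is bounded into the graph norm because A^* R f = f + z R f - V R f. *)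
Lemma TR_bounded z : resolvent_set (Ht t) z -> bounded_op (fun f => T t (Rt t z f)).
Proof.
move=> rz; have dR f : dom (AA t) (Rt t z f) := res_dom rz f.
have Rl := res_lin rz; have [C C0 RC] := bnd_ex (res_bounded rz).
have [K K0 VK] := bnd_ex (V_selfadjoint It).1.
have [Tl [M TM]] := T_bounded It.
apply: (@bounded_opP _ _ _ _ (`|M| * (C + (1 + normc z * C + K * C)))).
  apply: linP => a u v; rewrite Rl.2// Tl.2//; exact: dom_Hp.
move=> f; rewrite (le_trans (TM _ (dom_Hp (dR f))))//.
rewrite (le_trans (ler_norm _))// normrM -mulrA ler_wpM2l// ger0_norm ?(sn_ge0 gS)//.
rewrite (le_trans (graph_norm_le _ _))// mulrDl lerD ?RC// (dom_adjoint (dR f)).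
have -> : AA t (Rt t z f) = f + z *: Rt t z f - V t (Rt t z f).
  by have := res_eq rz f => /= <-; rewrite addrK.
rewrite (le_trans (hnorm_triangleB _ _))// 2!mulrDl mul1r lerD//.
  rewrite (le_trans (hnorm_triangle _ _))// lerD2l hnormZ -mulrA; exact/ler_nc/RC.
rewrite (le_trans (VK _))// -mulrA; apply: ler_wpM2l; [exact: ltW | exact: RC].
Qed.

End Static.

Section Krein.
Variables (s t : R).
Hypotheses (Is : 0 <= s <= 1) (It : 0 <= t <= 1).

Lemma krein_form u v : dom (AA s) u -> dom (AA t) v ->
  '[Ht s u, v] - '[u, Ht t v] =
  '[V s u - V t u, v]
  + '[X t (adj (Y s) (Wt s (T s u))) - Y t (adj (X s) (Wt s (T s u))), Wt t (T t v)]
  + '[J (T t u - T s u), T t v].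
Proof.
move=> Du Dv; set p := Wt s _; set q := Wt t _.
have G := green (T_triplet It) (dom_Hp Is Du) (dom_Hp It Dv).
(* Both traces are frames, so their symplectic pairing reduces to the coefficient X_t Y_s^* - Y_t
   X_s^* of Krein's formula. *)
have JE : '[J (T s u), T t v] = '[X t (adj (Y s) p) - Y t (adj (X s) p), q].
  rewrite (dom_frame Is Du) (dom_frame It Dv) -/p -/q prod_innerE /= inNr opprK.
  by rewrite inBl (X_pair It) (Y_pair It) addrC.
(* The Green identity is used with [T t], while u satisfies the boundary condition of [T s];
   exchanging the traces costs this term. *)
have -> : '[J (T t u - T s u), T t v] = '[J (T t u), T t v] - '[J (T s u), T t v].
  rewrite -inBl; congr '[_, _]; rewrite /J /=; congr pair.
  by rewrite /= opprD.
rewrite JE -G (dom_adjoint Is Du) (dom_adjoint It Dv) /= inDl inDr inBl (V_pair It).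
by ring.
Qed.

Lemma krein_weak z : resolvent_set (Ht t) z -> resolvent_set (Ht s) z ->
  forall f g, let u := Rt s z f in let v := Rt t (Num.conj z) g in
  '[Rt t z f - u, g] =
  '[V s u - V t u, v]
  + '[X t (adj (Y s) (Wt s (T s u))) - Y t (adj (X s) (Wt s (T s u))), Wt t (T t v)]
  + '[J (T t u - T s u), T t v].
Proof.
move=> rt rs f g u v; have rt' := res_set_conj It rt.
rewrite -krein_form; last 2 first.
- exact: (res_dom rs).
- exact: (res_dom rt').
rewrite (res_eq rs) (res_eq rt') inBl (res_adj (H_sa It) rt rt') -/v -/u.
by rewrite inDl inDr inZl inZr conjCK opprD addrACA subrr addr0.
Qed.

Lemma krein_formula z : resolvent_set (Ht t) z -> resolvent_set (Ht s) z ->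
  forall f, let u := Rt s z f in
  let TRadj := adj (fun f => T t (Rt t (Num.conj z) f)) in
  Rt t z f - u =
  Rt t z (V s u - V t u)
  + TRadj (adj (Wt t) (X t (adj (Y s) (Wt s (T s u))) - Y t (adj (X s) (Wt s (T s u)))))
  + TRadj (J (T t u - T s u)).
Proof.
move=> rt rs f u TRadj; apply: inner_eql => g; rewrite krein_weak//.
have rt' := res_set_conj It rt.
have TRp := adjoint_pairC (adj_pair cH (TR_bounded It rt')).
have [Xb Yb] := XY_bounded It.
have Wp := adjoint_pairC (W_adj ch Xb Yb (XY_regular It)).
by rewrite 2!inDl (res_adj (H_sa It) rt rt') !TRp Wp.
Qed.

End Krein.

(** * Continuity of the resolvent *)

Section Dynamics.
Variable t0 : R.
Hypothesis It0 : 0 <= t0 <= 1.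
Local Notation F0 := (nbhs01 t0).
Local Notation sm := (small F0 setT (@hnorm R _)).

(** The input of all continuity lemmas. It is known first at i, with C = 1, and later at every point
    of the resolvent set at t0 ([good_of_res]). *)
Definition good (z : R[i]) : Prop := exists2 C : R, 0 < C &
  \forall t \near F0, resolvent_set (Ht t) z /\ bnd (Rt t z) C.

Section Continuity.
Hypotheses
  (Tc : small F0 Hp gN (fun t u => T t u - T t0 u))
  (Vc : sm (fun t u => V t u - V t0 u))
  (Xc : sm (fun t u => X t u - X t0 u)) (Yc : sm (fun t u => Y t u - Y t0 u)).

Let IF : \forall t \near F0, 0 <= t <= 1 := nbhs01_I t0.

Lemma T_ubnd : ubnd F0 Hp gN T.
Proof.
have [_ [M TM]] := T_bounded It0.
by apply: (@small_ubnd _ _ _ _ _ Hp gN T (T t0) M) => //; exact: (sn_ge0 gS).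
Qed.

Lemma V_ubnd : ubnd F0 setT (@hnorm R H) V.
Proof.
have [M M0 VM] := bnd_ex (V_selfadjoint It0).1.
by apply: (@small_ubnd _ _ _ _ _ setT (@hnorm R H) V (V t0) M) => // u; exact: hnorm_ge0.
Qed.

Lemma Xadj_small : sm (fun t x => adj (X t) x - adj (X t0) x).
Proof.
apply: (adjoint_small _ _ (X_pair It0) Xc).
by apply: filterS IF => t It; exact: X_pair.
Qed.

Lemma Yadj_small : sm (fun t x => adj (Y t) x - adj (Y t0) x).
Proof.
apply: (adjoint_small _ _ (Y_pair It0) Yc).
by apply: filterS IF => t It; exact: Y_pair.
Qed.

Lemma frame_small : sm (fun t x => Ft t x - Ft t0 x).
Proof.
move=> e e0; have e2 : 0 < e / 2 by rewrite divr_gt0.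
near=> t => x _; rewrite (le_trans (hnorm_pair _))//= [e]splitr mulrDl lerD//.
  rewrite opprK addrC hnormBC -opprB hnormN hnormBC.
  by move: x; near: t; have := Yadj_small e2; apply: filterS => t h' x; exact: h'.
by move: x; near: t; have := Xadj_small e2; apply: filterS => t h' x; exact: h'.
Unshelve. all: by end_near. Qed.

(** The lower bound at t0 loses at most half under a small perturbation. It controls W_t T_t u
    without estimating the inverse of X_t X_t^* + Y_t Y_t^* uniformly. *)
Lemma frame_lower : exists2 c : R, 0 < c &
  \forall t \near F0, forall x, c * hnorm x <= hnorm (Ft t x).
Proof.
have [Xb Yb] := XY_bounded It0.
have [c c0 hc] := frame_below ch Xb Yb (XY_regular It0).
have c2 : 0 < c / 2 by rewrite divr_gt0.
exists (c / 2) => //; near=> t => x.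
have : hnorm (Ft t x - Ft t0 x) <= c / 2 * hnorm x.
  by have : forall x, setT x -> hnorm (Ft t x - Ft t0 x) <= c / 2 * hnorm x;
    [near: t; exact: frame_small | exact].
have := hc x; have := hnorm_sub (Ft t0 x) (Ft t x); rewrite (hnormBC (Ft t0 x)).
move: (hnorm (_ - _)) => p; lra.
Unshelve. all: by end_near. Qed.

Section AtPoint.
Variable z : R[i].
Hypothesis gz : good z.

Lemma good_conj : good (Num.conj z).
Proof.
have [C C0 hC] := gz; exists C => //; near=> t.
have It : 0 <= t <= 1 by near: t.
have [rz RC] : resolvent_set (Ht t) z /\ bnd (Rt t z) C by near: t.
have rz' := res_set_conj It rz; split=> //.
exact: adjoint_pair_bnd (ltW C0) (res_adj (H_sa It) rz rz') RC.
Unshelve. all: by end_near. Qed.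

Lemma good_res : \forall t \near F0, resolvent_set (Ht t) z.
Proof. by have [C _ hC] := gz; apply: filterS hC => t []. Qed.

Lemma good_at : resolvent_set (Ht t0) z.
Proof.
have := good_res; rewrite /nbhs01 near_withinE => /nbhs_singleton; apply.
by rewrite /= in_itv.
Qed.

Lemma R_ubnd : ubnd F0 setT (@hnorm R H) (fun t => Rt t z).
Proof. by have [C C0 hC] := gz; exists C => //; apply: filterS hC => t [_ RC] u _; exact: RC. Qed.

Lemma AR_eq t f : 0 <= t <= 1 -> resolvent_set (Ht t) z ->
  adjoint A (Rt t z f) = f + z *: Rt t z f - V t (Rt t z f).
Proof.
move=> It rz; rewrite (dom_adjoint It (res_dom rz f)).
by have := res_eq rz f => /= <-; rewrite addrK.
Qed.

Lemma R_dom t f : 0 <= t <= 1 -> resolvent_set (Ht t) z -> Hp (Rt t z f).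
Proof. by move=> It rz; exact: dom_Hp (res_dom rz f). Qed.

Lemma R_graph : exists2 C : R, 0 < C & \forall t \near F0, forall f : H, setT f ->
  Hp (Rt t z f) /\ gN (Rt t z f) <= C * hnorm f.
Proof.
have [C C0 hC] := R_ubnd; have [K K0 VK] := V_ubnd.
exists (C + (1 + normc z * C + K * C)).
  by rewrite ltr_wpDr// !addr_ge0// ?mulr_ge0 ?normc_ge0// ltW.
near=> t => f _.
have It : 0 <= t <= 1 by near: t.
have rz : resolvent_set (Ht t) z by near: t; exact: good_res.
have RC : forall f, setT f -> hnorm (Rt t z f) <= C * hnorm f by near: t.
have VKt : forall f, setT f -> hnorm (V t f) <= K * hnorm f by near: t.
split; first exact: R_dom.
rewrite (le_trans (graph_norm_le _ _))// mulrDl lerD ?RC// AR_eq//.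
rewrite (le_trans (hnorm_triangleB _ _))// 2!mulrDl mul1r lerD//.
  by rewrite (le_trans (hnorm_triangle _ _))// lerD2l hnormZ -mulrA; exact/ler_nc/RC.
rewrite (le_trans (VKt _ I))// -mulrA; apply: ler_wpM2l; [exact: ltW | exact: RC].
Unshelve. all: by end_near. Qed.

Lemma TR_ubnd : ubnd F0 setT (@hnorm R H) (fun t f => T t (Rt t z f)).
Proof.
have [C C0 hC] := R_graph; have [M M0 TM] := T_ubnd.
exists (M * C); first exact: mulr_gt0.
near=> t => f _.
have [Hf Gf] : Hp (Rt t z f) /\ gN (Rt t z f) <= C * hnorm f.
  by have : forall f, setT f -> Hp (Rt t z f) /\ gN (Rt t z f) <= C * hnorm f; [near: t | exact].
have TMt : forall u, Hp u -> hnorm (T t u) <= M * gN u by near: t.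
by rewrite (le_trans (TMt _ Hf))// -mulrA ler_pM2l.
Unshelve. all: by end_near. Qed.

Lemma WTR_ubnd : ubnd F0 setT (@hnorm R H) (fun t f => Wt t (T t (Rt t z f))).
Proof.
have [C C0 hC] := TR_ubnd; have [c c0 hc] := frame_lower.
exists (c^-1 * C); first by rewrite mulr_gt0// invr_gt0.
near=> t => f _.
have It : 0 <= t <= 1 by near: t.
have rz : resolvent_set (Ht t) z by near: t; exact: good_res.
have h1 : forall f, setT f -> hnorm (T t (Rt t z f)) <= C * hnorm f by near: t.
have h2 : forall x, c * hnorm x <= hnorm (Ft t x) by near: t.
rewrite -mulrA ler_pdivlMl//; apply: le_trans (h2 _) _.
by rewrite -(dom_frame It (res_dom rz f)); exact: h1.
Unshelve. all: by end_near. Qed.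

End AtPoint.

(* The boundary term of Krein's formula vanishes to first order because
   X_{t0} Y_{t0}^* = Y_{t0} X_{t0}^*. *)
Lemma XY_increment t x : X t (adj (Y t0) x) - Y t (adj (X t0) x) =
  (X t (adj (Y t0) x) - X t0 (adj (Y t0) x)) - (Y t (adj (X t0) x) - Y t0 (adj (X t0) x)).
Proof. by rewrite (XY_commute It0) opprB addrA subrK. Qed.

Lemma J_lin : lin (@J R h).
Proof.
apply: linP => a f g; rewrite /J; congr pair.
by rewrite /= opprD scalerN.
Qed.

Lemma bnd_cst (E G : innerType R) (k : E -> G) (M : R) : bnd k M -> 0 < M ->
  \forall t \near F0, forall u : E, setT u -> setT (k u) /\ hnorm (k u) <= M * hnorm u.
Proof. by move=> kM M0; apply: nearW => t u _; split => //; exact: kM. Qed.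

(** In Krein's formula with s = t0 the left entries are increments of V, X, Y, T applied to data at
    t0, hence small; of the right entries, which move with t, only uniform bounds are needed. *)
Lemma R_cont z : good z -> sm (fun t f => Rt t z f - Rt t0 z f).
Proof.
move=> gz; have gz' := good_conj gz; have rz0 := good_at gz.
apply: small_of_weak.
apply: (@wsmall_eq _ _ _ _ _ (fun t f g =>
  let u := Rt t0 z f in let v := Rt t (Num.conj z) g in
  let p := Wt t0 (T t0 u) in
  '[V t0 u - V t u, v]
  + '[X t (adj (Y t0) p) - Y t (adj (X t0) p), Wt t (T t v)]
  + '[J (T t u - T t0 u), T t v])).
  near=> t => f g; apply: krein_weak => //; near: t; [exact: IF | exact: good_res].
have [C C0 RC] := bnd_ex (res_bounded rz0).
have [C1 C10 TRC] := bnd_ex (TR_bounded It0 rz0).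
have [Xb Yb] := XY_bounded It0.
have [c c0 hc] := frame_below ch Xb Yb (XY_regular It0).
have WTR0 : bnd (fun f => Wt t0 (T t0 (Rt t0 z f))) (c^-1 * C1).
  move=> f; rewrite -mulrA ler_pdivlMl//; apply: le_trans (hc _) _.
  by rewrite -(dom_frame It0 (res_dom rz0 f)); exact: TRC.
have cC0 : 0 < c^-1 * C1 by rewrite mulr_gt0// invr_gt0.
apply: wsmallD; first apply: wsmallD.
- apply: wsmall_small_ubnd (R_ubnd gz').
  apply: (@small_compr _ _ _ H H H setT (@hnorm R H) setT (@hnorm R H)
            (fun=> Rt t0 z) (fun t u => V t0 u - V t u) C) => //; first exact: bnd_cst.
  by apply: smallS Vc; apply: nearW => t u _; rewrite hnormBC.
- apply: wsmall_small_ubnd (WTR_ubnd gz').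
  apply: (@small_compr _ _ _ h H h setT (@hnorm R h) setT (@hnorm R H)
            (fun=> fun f => Wt t0 (T t0 (Rt t0 z f)))
            (fun t p => X t (adj (Y t0) p) - Y t (adj (X t0) p)) (c^-1 * C1)) => //.
    exact: bnd_cst.
  have -> : (fun t p => X t (adj (Y t0) p) - Y t (adj (X t0) p)) =
            (fun t x => (X t (adj (Y t0) x) - X t0 (adj (Y t0) x)) -
                        (Y t (adj (X t0) x) - Y t0 (adj (X t0) x))).
    by apply/funext => t; apply/funext => x; exact: XY_increment.
  have [Mx Mx0 XM] := bnd_ex Xb; have [My My0 YM] := bnd_ex Yb.
  apply: smallB.
    apply: (@small_compr _ _ _ h h h setT (@hnorm R h) setT (@hnorm R h)
              (fun=> adj (Y t0)) (fun t u => X t u - X t0 u) My) => //.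
    by apply: bnd_cst => //; exact: adj_bnd Yb.1 (ltW My0) YM.
  apply: (@small_compr _ _ _ h h h setT (@hnorm R h) setT (@hnorm R h)
            (fun=> adj (X t0)) (fun t u => Y t u - Y t0 u) Mx) => //.
  by apply: bnd_cst => //; exact: adj_bnd Xb.1 (ltW Mx0) XM.
apply: wsmall_small_ubnd (TR_ubnd gz').
have [G G0 hG] := R_graph gz.
have hG0 : forall f : H, setT f -> Hp (Rt t0 z f) /\ gN (Rt t0 z f) <= G * hnorm f.
  by move: hG; rewrite /nbhs01 near_withinE => /nbhs_singleton; apply; rewrite /= in_itv.
apply: (@small_compr _ _ _ H H (h * h)%type Hp gN setT (@hnorm R H)
          (fun=> Rt t0 z) (fun t u => J (T t u - T t0 u)) G) => //; first exact: nearW.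
by apply: smallS Tc; apply: nearW => t u _; rewrite hnorm_J.
Unshelve. all: by end_near. Qed.

(** T_t is controlled by the graph norm only, so continuity of T_t R_t requires this stronger
    continuity; it follows from the formula for A^* R_t. *)
Lemma R_graph_cont z : good z -> forall e : R, 0 < e -> \forall t \near F0,
  forall f : H, setT f -> Hp (Rt t z f - Rt t0 z f) /\
    gN (Rt t z f - Rt t0 z f) <= e * hnorm f.
Proof.
move=> gz e e0; have rz0 := good_at gz.
have [C C0 RC] := bnd_ex (res_bounded rz0).
have [K K0 VK] := V_ubnd.
pose L := 1 + normc z + K.
have L0 : 0 < L by rewrite ltr_wpDl// addr_ge0// normc_ge0.
pose d := e / (L + C); have LC0 : 0 < L + C by rewrite addr_gt0.
have d0 : 0 < d by rewrite divr_gt0.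
near=> t => f _.
have It : 0 <= t <= 1 by near: t.
have rz : resolvent_set (Ht t) z by near: t; exact: good_res.
have h1 : forall f, setT f -> hnorm (Rt t z f - Rt t0 z f) <= d * hnorm f.
  by near: t; exact: R_cont.
have h2 : forall u, setT u -> hnorm (V t u - V t0 u) <= d * hnorm u.
  by near: t; exact: Vc.
have VKt : forall f, setT f -> hnorm (V t f) <= K * hnorm f by near: t.
have Hd := R_dom f It rz; have Hd0 := R_dom f It0 rz0.
have Al := adjoint_linear A_dense.
split; first exact: subB Al.1 Hd Hd0.
rewrite (le_trans (graph_norm_le _ _))// (lin_onB Al)// !AR_eq//.
set u := Rt t z f in h1 *; set u0 := Rt t0 z f in h1 *.
have -> : f + z *: u - V t u - (f + z *: u0 - V t0 u0) =
    z *: (u - u0) - V t (u - u0) - (V t u0 - V t0 u0).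
  rewrite (lin_onB (V_selfadjoint It).1.1)// scalerBr -[RHS]addrA -opprD addrA subrK.
  rewrite -(addrA f (z *: u)) -(addrA f (z *: u0)) opprD addrACA subrr add0r !opprB.
  by rewrite addrACA [RHS]addrACA; congr (_ + _); exact: addrC.
have b1 : hnorm (u - u0) <= d * hnorm f by exact: h1.
have b2 : hnorm (z *: (u - u0)) <= normc z * (d * hnorm f) by rewrite hnormZ; exact: ler_nc.
have b3 : hnorm (V t (u - u0)) <= K * (d * hnorm f).
  by rewrite (le_trans (VKt _ I))// ler_pM2l.
have b4 : hnorm (V t u0 - V t0 u0) <= d * (C * hnorm f).
  by rewrite (le_trans (h2 _ I))// ler_pM2l//; exact: RC.
have b5 := hnorm_triangleB (z *: (u - u0) - V t (u - u0)) (V t u0 - V t0 u0).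
have b6 := hnorm_triangleB (z *: (u - u0)) (V t (u - u0)).
have -> : e * hnorm f = (L + C) * (d * hnorm f) by rewrite /d; field; rewrite gt_eqF.
rewrite /L; lra.
Unshelve. all: by end_near. Qed.

Lemma TR_cont z : good z -> sm (fun t f => T t (Rt t z f) - T t0 (Rt t0 z f)).
Proof.
move=> gz e e0; have rz0 := good_at gz.
have [M M0 TM] := T_ubnd; have [G G0 hG] := R_graph gz.
have hG0 : forall f : H, setT f -> Hp (Rt t0 z f) /\ gN (Rt t0 z f) <= G * hnorm f.
  by move: hG; rewrite /nbhs01 near_withinE => /nbhs_singleton; apply; rewrite /= in_itv.
have e2M : 0 < e / 2 / M by rewrite !divr_gt0.
have e2G : 0 < e / 2 / G by rewrite !divr_gt0.
near=> t => f _.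
have It : 0 <= t <= 1 by near: t.
have rz : resolvent_set (Ht t) z by near: t; exact: good_res.
have TMt : forall u, Hp u -> hnorm (T t u) <= M * gN u by near: t.
have h1 : forall f : H, setT f -> Hp (Rt t z f - Rt t0 z f) /\
    gN (Rt t z f - Rt t0 z f) <= e / 2 / M * hnorm f.
  by near: t; exact: R_graph_cont.
have h2 : forall u, Hp u -> hnorm (T t u - T t0 u) <= e / 2 / G * gN u.
  by near: t; exact: Tc.
have -> : T t (Rt t z f) - T t0 (Rt t0 z f) =
   T t (Rt t z f - Rt t0 z f) + (T t (Rt t0 z f) - T t0 (Rt t0 z f)).
  by rewrite (lin_onB (T_linear It)) ?addrA ?subrK//; exact: R_dom.
rewrite (le_trans (hnorm_triangle _ _))// [e]splitr mulrDl lerD//.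
  have [Hd Gd] := h1 f I; rewrite (le_trans (TMt _ Hd))//.
  by rewrite -ler_pdivlMl// mulrA [M^-1 * _]mulrC.
have [Hd Gd] := hG0 f I; rewrite (le_trans (h2 _ Hd))//.
by rewrite -mulrA ler_pM2l ?divr_gt0// ler_pdivrMl.
Unshelve. all: by end_near. Qed.

(** Continuity of W_t itself is bypassed: F_t applied to the difference equals the increment of T_t
    R_t minus (F_t - F_{t0}) p, and F_t is uniformly bounded below. *)
Lemma WTR_cont z : good z -> sm (fun t f => Wt t (T t (Rt t z f)) - Wt t0 (T t0 (Rt t0 z f))).
Proof.
move=> gz e e0; have rz0 := good_at gz.
have [C C0 hC] := WTR_ubnd gz; have [c c0 hc] := frame_lower.
have hC0 : forall f : H, setT f -> hnorm (Wt t0 (T t0 (Rt t0 z f))) <= C * hnorm f.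
  by move: hC; rewrite /nbhs01 near_withinE => /nbhs_singleton; apply; rewrite /= in_itv.
have ce : 0 < c * e / 2 by rewrite divr_gt0// mulr_gt0.
have ceC : 0 < c * e / 2 / C by rewrite !divr_gt0// mulr_gt0.
near=> t => f _.
have It : 0 <= t <= 1 by near: t.
have rz : resolvent_set (Ht t) z by near: t; exact: good_res.
have h1 : forall f : H, setT f ->
    hnorm (T t (Rt t z f) - T t0 (Rt t0 z f)) <= c * e / 2 * hnorm f.
  by near: t; exact: TR_cont.
have h2 : forall x : h, setT x -> hnorm (Ft t x - Ft t0 x) <= c * e / 2 / C * hnorm x.
  by near: t; exact: frame_small.
have h3 : forall x, c * hnorm x <= hnorm (Ft t x) by near: t.
have [Xb Yb] := XY_bounded It.
rewrite -(ler_pM2l c0) (le_trans (h3 _))//.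
rewrite (lin_onB (frame_lin ch Xb Yb))// -(dom_frame It (res_dom rz f)).
set p := Wt t0 _.
have -> : T t (Rt t z f) - Ft t p = (T t (Rt t z f) - T t0 (Rt t0 z f)) - (Ft t p - Ft t0 p).
  by rewrite (dom_frame It0 (res_dom rz0 f)) -/p opprB addrA subrK.
rewrite (le_trans (hnorm_triangleB _ _))// mulrA [c * e]splitr mulrDl lerD ?h1//.
rewrite (le_trans (h2 _ I))// -[leLHS]mulrA ler_pM2l// ler_pdivrMl//; exact: hC0.
Unshelve. all: by end_near. Qed.

Lemma good_i : good 'i%C.
Proof.
exists 1 => //; apply: filterS IF => t It.
have b1 : below (Ht t) 'i%C 1.
  by move=> u Du; have := sa_nonreal (H_sa It) 'i%C Du; rewrite /= normr1.
have ri : resolvent_set (Ht t) 'i%C := below_resolvent_set (H_sa It) cH ltr01 b1.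
by split=> //; have := res_bnd_of_below ri ltr01 b1; rewrite invr1.
Qed.

(* The resolvent at i is norm-continuous, and a lower bound for H_t - w can be
   read off from it since (H_t - w) R_t(i) = 1 + (i - w) R_t(i). *)
Lemma resolvent_near w : resolvent_set (Ht t0) w ->
  exists d C : R, [/\ 0 < d, 0 < C & \forall t \near F0, forall w' : R[i],
    normc (w' - w) <= d -> resolvent_set (Ht t) w' /\ bnd (Rt t w') C].
Proof.
move=> rw; have [c c0 bw] := res_below rw.
pose l := normc (w - 'i%C); have l0 : 0 <= l by exact: normc_ge0.
(* At t0 one has |(H_{t0} - w) u0| >= k |(H_{t0} - i) u0|. Passing from t0 to t costs k/2 and moving
   w to w' costs k/4, which leaves k/4. *)
pose k := (1 + l / c)^-1.
have k0 : 0 < k by rewrite invr_gt0 ltr_wpDr// divr_ge0// ltW.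
pose e := k / 2 / (l + 1).
have e0 : 0 < e by rewrite !divr_gt0// ltr_wpDl.
have k4 : 0 < k / 4 by rewrite divr_gt0.
exists (k / 4), (k / 4)^-1; split; rewrite ?invr_gt0//.
near=> t => w' ww'.
have It : 0 <= t <= 1 by near: t.
have ri : resolvent_set (Ht t) 'i%C by near: t; apply: good_res good_i.
have ri0 : resolvent_set (Ht t0) 'i%C by apply: good_at good_i.
have Re : forall f, setT f -> hnorm (Rt t 'i%C f - Rt t0 'i%C f) <= e * hnorm f.
  by near: t; apply: (R_cont good_i).
have b' : below (Ht t) w' (k / 4).
  (* The domains at t and t0 differ, so u is compared with the vector u0 that has the same image f
     under H_{t0} - i. *)
  move=> u Du; set f := Ht t u - 'i%C *: u.
  have uE : u = Rt t 'i%C f by rewrite (resK ri).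
  pose u0 := Rt t0 'i%C f; have Du0 : dom (Ht t0) u0 := res_dom ri0 f.
  have fu0 : Ht t0 u0 - 'i%C *: u0 = f := (resP ri0 f).2.
  have uf : hnorm u <= hnorm f.
    by have := sa_nonreal (H_sa It) 'i%C Du; rewrite /= normr1 mul1r.
  have h1 : hnorm f <= k^-1 * hnorm (Ht t0 u0 - w *: u0).
    have -> : f = (Ht t0 u0 - w *: u0) + (w - 'i%C) *: u0.
      by rewrite -fu0 scalerBl addrA subrK.
    rewrite (le_trans (hnorm_triangle _ _))// /k invrK mulrDl mul1r lerD2l hnormZ -/l.
    rewrite -mulrA; apply: ler_wpM2l => //.
    by rewrite ler_pdivlMl//; exact: bw.
  have h2 : Ht t u - w *: u = (Ht t0 u0 - w *: u0) + ('i%C - w) *: (u - u0).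
    have -> : Ht t u = f + 'i%C *: u by rewrite subrK.
    have -> : Ht t0 u0 = f + 'i%C *: u0 by rewrite -fu0 subrK.
    rewrite -(addrA f ('i%C *: u)) -(addrA f ('i%C *: u0)) -!scalerBl -[RHS]addrA.
    by rewrite -scalerDr [u0 + _]addrC subrK.
  have h3 : hnorm (('i%C - w) *: (u - u0)) <= k / 2 * hnorm f.
    rewrite hnormZ -normcN opprB -/l.
    apply: (@le_trans _ _ (l * (e * hnorm f))).
      by apply: ler_wpM2l => //; rewrite {1}uE; exact: Re.
    rewrite mulrA; apply: ler_hn; rewrite /e mulrCA -[leRHS]mulr1.
    by apply: ler_wpM2l; [exact: ltW (divr_gt0 k0 _) | rewrite ler_pdivrMr ?ltr_wpDl// mul1r lerDl].
  have h4 : Ht t u - w' *: u = (Ht t u - w *: u) - (w' - w) *: u.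
    by rewrite scalerBl opprB addrA subrK.
  have h5 := hnorm_sub (Ht t u - w *: u) ((w' - w) *: u).
  rewrite -h4 hnormZ in h5.
  have h6 : normc (w' - w) * hnorm u <= k / 4 * hnorm u by exact: ler_hn.
  have h7 := hnorm_sub (Ht t0 u0 - w *: u0) (- (('i%C - w) *: (u - u0))).
  rewrite opprK -h2 hnormN in h7.
  move: h1; rewrite ler_pdivlMl// => h1.
  have h8 : k * hnorm u <= k * hnorm f by rewrite ler_pM2l.
  lra.
have rw' := below_resolvent_set (H_sa It) cH k4 b'.
by have := res_bnd_of_below rw' k4 b'.
Unshelve. all: by end_near. Qed.

Lemma good_of_res z : resolvent_set (Ht t0) z -> good z.
Proof.
move=> rz; have [d [C [d0 C0 hd]]] := resolvent_near rz; exists C => //.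
apply: filterS hd => t; apply; rewrite subrr.
by rewrite -[0 : R[i]]/((0 : R)%:C) normcR normr0 ltW.
Qed.

(** * Derivative of the resolvent *)

Section Derivative.
Variables (T' : H -> h * h) (V' : H -> H) (X' Y' : h -> h).
Local Notation G0 := (dnbhs01 t0).
Local Notation smd := (small G0 setT (@hnorm R _)).
Hypotheses (T'b : bounded_on Hp gN T') (V'b : bounded_op V')
  (X'b : bounded_op X') (Y'b : bounded_op Y').
Hypotheses
  (Td : small G0 Hp gN (fun t u => diff_quot (T ^~ u) t0 t - T' u))
  (Vd : smd (fun t u => diff_quot (V ^~ u) t0 t - V' u))
  (Xd : smd (fun t u => diff_quot (X ^~ u) t0 t - X' u))
  (Yd : smd (fun t u => diff_quot (Y ^~ u) t0 t - Y' u)).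

Definition Rdot (z : R[i]) (f : H) : H :=
  let u := Rt t0 z f in
  let w := Wt t0 (T t0 u) in
  let TRadj := adj (fun f => T t0 (Rt t0 (Num.conj z) f)) in
  - Rt t0 z (V' u)
  + TRadj (adj (Wt t0) (X' (adj (Y t0) w) - Y' (adj (X t0) w)))
  + TRadj (J (T' u)).

Lemma Rdot_weak z f g : resolvent_set (Ht t0) z ->
  let u := Rt t0 z f in let v := Rt t0 (Num.conj z) g in
  let p := Wt t0 (T t0 u) in
  '[Rdot z f, g] = - '[V' u, v] + '[X' (adj (Y t0) p) - Y' (adj (X t0) p), Wt t0 (T t0 v)]
    + '[J (T' u), T t0 v].
Proof.
move=> rz u v p; have rz' := res_set_conj It0 rz.
have TRp := adjoint_pairC (adj_pair cH (TR_bounded It0 rz')).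
have [Xb Yb] := XY_bounded It0.
have Wp := adjoint_pairC (W_adj ch Xb Yb (XY_regular It0)).
by rewrite /Rdot 2!inDl inNl (res_adj (H_sa It0) rz rz') !TRp Wp.
Qed.

Lemma small_punctured (E F : innerType R) (D : set E) N (f : R -> E -> F) :
  small F0 D N f -> small G0 D N f.
Proof. by move=> fs e e0; apply: nbhs01_dnbhs01; exact: fs. Qed.

Lemma ubnd_punctured (E F : innerType R) (D : set E) N (f : R -> E -> F) :
  ubnd F0 D N f -> ubnd G0 D N f.
Proof. by move=> [M M0 fM]; exists M => //; exact: nbhs01_dnbhs01. Qed.

(** After division by t - t0, each term of the weak Krein formula pairs a difference quotient,
    applied to data at t0, with a family continuous at t0, and [wsmall_diff] takes the limit. *)
Lemma R_deriv z : resolvent_set (Ht t0) z ->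
  smd (fun t f => diff_quot (fun t => Rt t z f) t0 t - Rdot z f).
Proof.
move=> rz0; have gz := good_of_res rz0; have gz' := good_conj gz.
have rz0' := res_set_conj It0 rz0.
have [C C0 RC] := bnd_ex (res_bounded rz0).
have [C1 C10 TRC] := bnd_ex (TR_bounded It0 rz0).
have [Xb Yb] := XY_bounded It0.
have [c c0 hc] := frame_below ch Xb Yb (XY_regular It0).
have WTR0 : bnd (fun f => Wt t0 (T t0 (Rt t0 z f))) (c^-1 * C1).
  move=> f; rewrite -mulrA ler_pdivlMl//; apply: le_trans (hc _) _.
  by rewrite -(dom_frame It0 (res_dom rz0 f)); exact: TRC.
have cC0 : 0 < c^-1 * C1 by rewrite mulr_gt0// invr_gt0.
have [G G0' hG] := R_graph gz.
have hG0 : forall f : H, setT f -> Hp (Rt t0 z f) /\ gN (Rt t0 z f) <= G * hnorm f.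
  by move: hG; rewrite /nbhs01 near_withinE => /nbhs_singleton; apply; rewrite /= in_itv.
have bndd (E K : innerType R) (k : E -> K) (M : R) : bnd k M -> 0 < M ->
  \forall t \near G0, forall u : E, setT u -> setT (k u) /\ hnorm (k u) <= M * hnorm u.
  by move=> kM M0; apply: nearW => t u _; split => //; exact: kM.
have [Mx Mx0 XM] := bnd_ex Xb; have [My My0 YM] := bnd_ex Yb.
have Xsb := adj_bnd ch Xb.1 (ltW Mx0) XM.
have Ysb := adj_bnd ch Yb.1 (ltW My0) YM.
have [Kv Kv0 VK] := bnd_ex V'b; have [Kx Kx0 XK] := bnd_ex X'b; have [Ky Ky0 YK] := bnd_ex Y'b.
apply: small_of_weak.
pose u f := Rt t0 z f; pose p f := Wt t0 (T t0 (u f)).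
pose v t g := Rt t (Num.conj z) g.
apply: (@wsmall_eq _ _ _ _ _ (fun t f g =>
  - ('[diff_quot (V ^~ (u f)) t0 t, v t g] - '[V' (u f), v t0 g])
  + ('[diff_quot (X ^~ (adj (Y t0) (p f))) t0 t - diff_quot (Y ^~ (adj (X t0) (p f))) t0 t,
       Wt t (T t (v t g))] -
     '[X' (adj (Y t0) (p f)) - Y' (adj (X t0) (p f)), Wt t0 (T t0 (v t0 g))])
  + ('[J (diff_quot (T ^~ (u f)) t0 t), T t (v t g)] - '[J (T' (u f)), T t0 (v t0 g)]))).
  near=> t => f g.
  have It : 0 <= t <= 1 by near: t; apply: nbhs01_dnbhs01; exact: IF.
  have rz : resolvent_set (Ht t) z by near: t; apply: nbhs01_dnbhs01; exact: good_res.
  rewrite inBl Rdot_weak// /diff_quot inZl krein_weak// -/(u f) -/(p f) -/(v t g) -/(v t0 g).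
  rewrite XY_increment.
  rewrite [J (_ *: _)](lin_onZ J_lin)// -scalerBr !inZl -(opprB (V t _)) inNl.
  move: ((t - t0)^-1%:C) => q; by ring.
apply: wsmallD; first apply: wsmallD.
- apply: wsmallN; apply: (@wsmall_diff _ _ _ _ _ _ (fun t f => diff_quot (V ^~ (u f)) t0 t)
    (fun f => V' (u f)) v (v t0) (Kv * C)).
  + apply: (@small_compr _ _ _ H H H setT (@hnorm R H) setT (@hnorm R H)
            (fun=> u) (fun t x => diff_quot (V ^~ x) t0 t - V' x) C) => //.
    exact: bndd.
  + exact: ubnd_punctured (R_ubnd gz').
  + by move=> f; rewrite (le_trans (VK _))// -mulrA ler_pM2l//; exact: RC.
  + exact: small_punctured (R_cont gz').
- apply: (@wsmall_diff _ _ _ _ _ _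
    (fun t f => diff_quot (X ^~ (adj (Y t0) (p f))) t0 t - diff_quot (Y ^~ (adj (X t0) (p f))) t0 t)
    (fun f => X' (adj (Y t0) (p f)) - Y' (adj (X t0) (p f)))
    (fun t g => Wt t (T t (v t g))) (fun g => Wt t0 (T t0 (v t0 g)))
    ((Kx * My + Ky * Mx) * (c^-1 * C1))).
  + apply: (@small_compr _ _ _ h H h setT (@hnorm R h) setT (@hnorm R H) (fun=> p)
      (fun t x => diff_quot (X ^~ (adj (Y t0) x)) t0 t - diff_quot (Y ^~ (adj (X t0) x)) t0 t
       - (X' (adj (Y t0) x) - Y' (adj (X t0) x))) (c^-1 * C1)) => //.
      exact: bndd.
    have -> : (fun t x => diff_quot (X ^~ (adj (Y t0) x)) t0 t -
          diff_quot (Y ^~ (adj (X t0) x)) t0 t - (X' (adj (Y t0) x) - Y' (adj (X t0) x))) =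
       (fun t x => (diff_quot (X ^~ (adj (Y t0) x)) t0 t - X' (adj (Y t0) x)) -
          (diff_quot (Y ^~ (adj (X t0) x)) t0 t - Y' (adj (X t0) x))).
      by apply/funext => t; apply/funext => x; rewrite opprD addrACA -opprD.
    apply: smallB.
      apply: (@small_compr _ _ _ h h h setT (@hnorm R h) setT (@hnorm R h)
        (fun=> adj (Y t0)) (fun t x => diff_quot (X ^~ x) t0 t - X' x) My) => //.
      exact: bndd.
    apply: (@small_compr _ _ _ h h h setT (@hnorm R h) setT (@hnorm R h)
        (fun=> adj (X t0)) (fun t x => diff_quot (Y ^~ x) t0 t - Y' x) Mx) => //.
    exact: bndd.
  + exact: ubnd_punctured (WTR_ubnd gz').
  + move=> f; rewrite (le_trans (hnorm_triangleB _ _))//.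
    have hp : hnorm (p f) <= c^-1 * C1 * hnorm f := WTR0 f.
    have KM : 0 <= Kx * My + Ky * Mx by rewrite addr_ge0// mulr_ge0// ltW.
    rewrite -mulrA; apply: (@le_trans _ _ ((Kx * My + Ky * Mx) * hnorm (p f))); last first.
      by apply: ler_wpM2l.
    rewrite mulrDl lerD//.
      by rewrite (le_trans (XK _))// -mulrA ler_pM2l//; exact: Ysb.
    by rewrite (le_trans (YK _))// -mulrA ler_pM2l//; exact: Xsb.
  + exact: small_punctured (WTR_cont gz').
have [Kt Kt0 TK] : exists2 Kt : R, 0 < Kt & forall x, Hp x -> hnorm (T' x) <= Kt * gN x.
  have [_ [M TM]] := T'b; exists (`|M| + 1); first by rewrite ltr_wpDl.
  move=> x Hx; rewrite (le_trans (TM x Hx))//; apply: ler_wpM2r; first exact: (sn_ge0 gS).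
  by rewrite ler_wpDr// ler_norm.
apply: (@wsmall_diff _ _ _ _ _ _ (fun t f => J (diff_quot (T ^~ (u f)) t0 t))
    (fun f => J (T' (u f))) (fun t g => T t (v t g)) (fun g => T t0 (v t0 g)) (Kt * G)).
+ apply: (@small_compr _ _ _ H H (h * h)%type Hp gN setT (@hnorm R H)
          (fun=> u) (fun t x => J (diff_quot (T ^~ x) t0 t) - J (T' x)) G) => //.
    exact: nearW.
  apply: smallS Td; apply: nearW => t x _.
  by rewrite -(lin_onB J_lin)// hnorm_J.
+ exact: ubnd_punctured (TR_ubnd gz').
+ move=> f; rewrite hnorm_J; have [Hu Gu] := hG0 f I.
  by rewrite (le_trans (TK _ Hu))// -mulrA ler_pM2l.
+ exact: small_punctured (TR_cont gz').
Unshelve. all: by end_near. Qed.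

(** Difference quotients of symmetric operators are symmetric because 1/(t - t0) is real; for each
    error, one time t close to t0 suffices. *)
Lemma derivative_sym (f : R -> H -> H) (f' : H -> H) :
  (\forall t \near G0, adjoint_pair (f t) (f t)) -> adjoint_pair (f t0) (f t0) ->
  smd (fun t u => diff_quot (f ^~ u) t0 t - f' u) -> adjoint_pair f' f'.
Proof.
move=> fp fp0 fd u v; apply/eqP; rewrite -subr_eq0 -normc_eq0 eq_le normc_ge0 andbT.
apply: eps_le0 => e e0.
pose L := 2 * hnorm u * hnorm v + 1.
have L0 : 0 < L by rewrite ltr_wpDl// !mulr_ge0 ?hnorm_ge0.
have eL : 0 < e / L by rewrite divr_gt0.
have [t [tp td]] : exists t, adjoint_pair (f t) (f t) /\
    forall u, setT u -> hnorm (diff_quot (f ^~ u) t0 t - f' u) <= e / L * hnorm u.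
  by apply: (dnbhs01_ex It0); near=> t; split; near: t => //; exact: fd.
have E : '[diff_quot (f ^~ u) t0 t, v] = '[u, diff_quot (f ^~ v) t0 t].
  by rewrite /diff_quot inZl inZr conjCR inBl inBr tp fp0.
have -> : '[f' u, v] - '[u, f' v] = '[u, diff_quot (f ^~ v) t0 t - f' v] -
    '[diff_quot (f ^~ u) t0 t - f' u, v].
  by rewrite inBl inBr E; ring.
rewrite (le_trans (normcD _ _))// normcN.
have h1 := le_trans (cauchy_schwarz u (diff_quot (f ^~ v) t0 t - f' v))
  (ler_wpM2l (hnorm_ge0 u) (td v I)).
have h2 := le_trans (cauchy_schwarz (diff_quot (f ^~ u) t0 t - f' u) v)
  (ler_hn v (td u I)).
rewrite (le_trans (lerD h1 h2))//.
have -> : hnorm u * (e / L * hnorm v) + e / L * hnorm u * hnorm v =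
  e / L * (2 * hnorm u * hnorm v) by ring.
by rewrite -mulrA -[leRHS]mulr1 ler_pM2l// ler_pdivrMl// mulr1 /L lerDl.
Unshelve. all: by end_near. Qed.

Lemma V'_sym : adjoint_pair V' V'.
Proof.
apply: derivative_sym Vd; last exact: V_pair.
by apply: nbhs01_dnbhs01; apply: filterS IF => t It; exact: V_pair.
Qed.

Lemma Rdot_sym (x : R) : resolvent_set (Ht t0) x%:C -> adjoint_pair (Rdot x%:C) (Rdot x%:C).
Proof.
move=> rx; have sym t : 0 <= t <= 1 -> resolvent_set (Ht t) x%:C ->
    adjoint_pair (Rt t x%:C) (Rt t x%:C).
  move=> It r; have := res_set_conj It r; have := @res_adj _ _ _ (H_sa It) x%:C r.
  by rewrite conjCR.
apply: derivative_sym (R_deriv rx); last exact: sym.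
apply: nbhs01_dnbhs01; near=> t; apply: sym; first by near: t.
by near: t; exact: good_res (good_of_res rx).
Unshelve. all: by end_near. Qed.

(** Read off from a single time at which the difference quotient of the resolvent is within 1 of
    [Rdot]. *)
Lemma Rdot_bnd z : resolvent_set (Ht t0) z -> exists2 K, 0 <= K & bnd (Rdot z) K.
Proof.
move=> rz; have [t [[rt It] ht]] : exists t, (resolvent_set (Ht t) z /\ 0 <= t <= 1) /\
    forall f, setT f -> hnorm (diff_quot (fun t => Rt t z f) t0 t - Rdot z f) <= 1 * hnorm f.
  apply: (dnbhs01_ex It0); near=> t; split; last by near: t; exact: R_deriv.
  split; near: t; apply: nbhs01_dnbhs01; last exact: IF.
  exact: good_res (good_of_res rz).
have [M M0 hM] := bnd_ex (res_bounded rt); have [K K0 hK] := bnd_ex (res_bounded rz).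
exists (`|(t - t0)^-1| * (M + K) + 1).
  by rewrite addr_ge0// mulr_ge0// addr_ge0// ltW.
move=> f; have := hnorm_sub (Rdot z f) (diff_quot (fun t => Rt t z f) t0 t).
rewrite hnormBC; have := ht f I; rewrite mul1r => h1 h2.
have h3 : hnorm (diff_quot (fun t => Rt t z f) t0 t) <= `|(t - t0)^-1| * ((M + K) * hnorm f).
  rewrite hnormZR; apply: ler_wpM2l => //.
  by rewrite (le_trans (hnorm_triangleB _ _))// mulrDl lerD.
by rewrite mulrDl mul1r -mulrA; lra.
Unshelve. all: by end_near. Qed.

(** * Eigenvalue branches *)

Section Moebius.
Variables (l0 rho : R).
Hypothesis rho0 : 0 < rho.
Local Notation z := ((l0 + rho)%:C).

(* The symmetric bounded operator (H_t - l0) (H_t - l0 - rho)^-1. Its spectral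
   parameter a corresponds to the point [moebius a] of the spectrum of H_t. *)
Definition cayley (t : R) (f : H) : H := f + rho%:C *: Rt t z f.

Definition moebius (a : R) : R := l0 - a * rho / (1 - a).

Lemma moebiusK (a : R) : a != 1 ->
  (moebius a - l0) / (moebius a - l0 - rho) = a.
Proof.
move=> a1; have a10 : 1 - a != 0 by rewrite subr_eq0 eq_sym.
rewrite /moebius; field; rewrite a10 /= -[X in X != 0](_ : - rho = _).
  by rewrite oppr_eq0 gt_eqF.
by field.
Qed.

Lemma moebius_inj (a b : R) : a != 1 -> b != 1 -> moebius a = moebius b -> a = b.
Proof. by move=> a1 b1 ab; rewrite -(moebiusK a1) ab moebiusK. Qed.

Lemma moebius_inv (x : R) : x != l0 + rho ->
  let a := (x - l0) / (x - l0 - rho) in a != 1 /\ moebius a = x.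
Proof.
move=> xz a; have d0 : x - l0 - rho != 0 by rewrite -addrA -opprD subr_eq0.
have a1E : 1 - a = - rho / (x - l0 - rho) by rewrite /a; field.
have r0 : rho != 0 by rewrite gt_eqF.
have a1 : 1 - a != 0 by rewrite a1E mulf_neq0 ?oppr_eq0 ?invr_eq0.
split; first by rewrite eq_sym -subr_eq0.
by rewrite /moebius a1E /a; field; rewrite r0 d0.
Qed.

Section AtTime.
Variable t : R.
Hypotheses (It : 0 <= t <= 1) (rz : resolvent_set (Ht t) z).

Lemma cayley_sym : adjoint_pair (cayley t) (cayley t).
Proof.
have rz' := res_set_conj It rz; have := res_adj (H_sa It) rz rz'; rewrite conjCR => h' u v.
by rewrite /cayley inDl inDr inZl inZr conjCR h'.
Qed.

Lemma cayley_bnd : exists K, bnd (cayley t) K.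
Proof.
have [M M0 hM] := bnd_ex (res_bounded rz); exists (1 + rho * M) => f.
rewrite (le_trans (hnorm_triangle _ _))// mulrDl mul1r lerD2l hnormZR gtr0_norm//.
by rewrite -mulrA ler_pM2l.
Qed.

(** This factorization carries lower bounds and kernels between S_t at a and H_t at [moebius a]; the
    excluded value a = 1 corresponds to infinity. *)
Lemma cayley_shift (a : R) f : a != 1 ->
  cayley t f - a%:C *: f =
  (1 - a)%:C *: (Ht t (Rt t z f) - (moebius a)%:C *: Rt t z f).
Proof.
move=> a1; have a10 : 1 - a != 0 by rewrite subr_eq0 eq_sym.
set u := Rt t z f; have fE : f = Ht t u - z *: u by rewrite (resP rz f).2.
have -> : cayley t f = Ht t u - l0%:C *: u.
  by rewrite /cayley -/u {1}fE rmorphD scalerDl opprD addrA subrK.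
rewrite {1}fE scalerBr opprB addrA addrAC -[in X in X - _ + _](scale1r (Ht t u)).
rewrite [1 *: _ - _ - _]addrAC -scalerBl.
rewrite !scalerA scalerBr scalerA rmorphB rmorph1 -addrA; congr (_ + _).
rewrite addrC -scalerBl -scaleNr; congr (_ *: _).
rewrite (_ : 1 - _ = (1 - a)%:C); last by rewrite rmorphB rmorph1.
rewrite -!rmorphM -rmorphB -rmorphN; congr (_%:C).
by rewrite /moebius; field.
Qed.

Lemma cayley_below_res (a : R) : a != 1 ->
  bnd_below setT (fun f => cayley t f - a%:C *: f) -> resolvent_set (Ht t) (moebius a)%:C.
Proof.
move=> a1 [c c0 hc]; have [k k0 bz] := res_below rz.
have a10 : 0 < `|1 - a| by rewrite normr_gt0 subr_eq0 eq_sym.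
apply: (below_resolvent_set (H_sa It) cH (c := c * k / `|1 - a|)).
  by rewrite divr_gt0// mulr_gt0.
move=> u Du; rewrite mulrAC ler_pdivrMr// mulrC [leRHS]mulrC.
have := hc (Ht t u - z *: u) I; rewrite cayley_shift// (resK rz Du) hnormZR.
by apply: le_trans; rewrite [leLHS]mulrC -mulrA ler_pM2l//; exact: bz.
Qed.

Lemma res_cayley_below (a : R) : a != 1 -> resolvent_set (Ht t) (moebius a)%:C ->
  bnd_below setT (fun f => cayley t f - a%:C *: f).
Proof.
move=> a1 ra; have [k k0 bw] := res_below ra.
have a10 : 0 < `|1 - a| by rewrite normr_gt0 subr_eq0 eq_sym.
pose l := normc ((moebius a)%:C - z); have l0' : 0 <= l by exact: normc_ge0.
pose q := 1 + l / k; have q0 : 0 < q by rewrite ltr_wpDr// divr_ge0// ltW.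
exists (`|1 - a| / q); first by rewrite divr_gt0.
move=> f _; rewrite cayley_shift// hnormZR -mulrA ler_pM2l// ler_pdivrMl//.
set u := Rt t z f; have Du : dom (Ht t) u := res_dom rz f.
rewrite -{1}(resP rz f).2 -/u.
have -> : Ht t u - z *: u = (Ht t u - (moebius a)%:C *: u) + ((moebius a)%:C - z) *: u.
  by rewrite scalerBl addrA subrK.
rewrite (le_trans (hnorm_triangle _ _))// /q mulrDl mul1r lerD2l hnormZ -/l.
by rewrite -mulrA; apply: ler_wpM2l => //; rewrite ler_pdivlMl//; exact: bw.
Qed.

Lemma cayley_ker (a : R) : a != 1 ->
  eigen_ker (Ht t) (moebius a)%:C = [set f | cayley t f = a%:C *: f].
Proof.
move=> a1; have a10 : 1 - a != 0 by rewrite subr_eq0 eq_sym.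
have r0 : rho != 0 by rewrite gt_eqF.
have wz : (moebius a)%:C - z = (- rho / (1 - a))%:C.
  by rewrite -rmorphB; congr (_%:C); rewrite /moebius; field.
have wz0 : - rho / (1 - a) != 0 by rewrite mulf_neq0 ?oppr_eq0 ?invr_eq0.
apply/seteqP; split=> u /=.
  move=> [Du Hu].
  have Ru : u = (- rho / (1 - a))%:C *: Rt t z u.
    rewrite -(lin_onZ (res_lin rz))// -wz scalerBl -Hu resK//.
  have Ru' : Rt t z u = (- (1 - a) / rho)%:C *: u.
    rewrite [in RHS]Ru scalerA -rmorphM (_ : _ * _ = 1) ?rmorph1 ?scale1r//.
    by field; rewrite r0 a10.
  rewrite /cayley Ru' scalerA -rmorphM -[X in X + _]scale1r -scalerDl -(rmorph1 (real_complex R)) -rmorphD.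
  by congr (_%:C *: _); field.
move=> Su; have := cayley_shift u a1; rewrite Su subrr => /esym/eqP.
rewrite scaler_eq0 -[0 : R[i]]/((0 : R)%:C) (inj_eq (@complexI R)) (negPf a10) /=.
rewrite subr_eq0 => /eqP HR.
have uE : u = (- rho / (1 - a))%:C *: Rt t z u.
  have : (1 - a)%:C *: u = (- rho)%:C *: Rt t z u.
    rewrite rmorphB scalerBl rmorph1 scale1r -Su /cayley opprD addrA subrr add0r.
    by rewrite rmorphN scaleNr.
  move=> /(congr1 (fun v => ((1 - a)^-1)%:C *: v)); rewrite !scalerA -!rmorphM.
  by rewrite mulVf// rmorph1 scale1r [_^-1 * _]mulrC.
have Hl := sa_lin (H_sa It); have DR : dom (Ht t) (Rt t z u) := res_dom rz u.
split; first by rewrite uE; exact: subZ Hl.1 DR.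
have {}HR : Ht t (Rt t z u) = (moebius a)%:C *: Rt t z u := HR.
by rewrite uE (lin_onZ Hl)// HR !scalerA mulrC.
Qed.

End AtTime.
End Moebius.

Lemma nonreal_res (t : R) (w : R[i]) : 0 <= t <= 1 -> complex.Im w != 0 -> resolvent_set (Ht t) w.
Proof.
move=> It w0; have w0' : 0 < `|complex.Im w| by rewrite normr_gt0.
have b : below (Ht t) w `|complex.Im w| by move=> u Du; have := sa_nonreal (H_sa It) w Du.
by have := below_resolvent_set (H_sa It) cH w0' b.
Qed.

Lemma eigen_ker_res (t : R) (w : R[i]) : resolvent_set (Ht t) w -> 0 <= t <= 1 ->
  eigen_ker (Ht t) w = [set 0].
Proof.
move=> rw It; have [c c0 bw] := res_below rw.
have Hl := sa_lin (H_sa It).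
apply/seteqP; split=> u /=; last first.
  move=> ->; split; first exact: sub0 Hl.1.
  by rewrite (lin_on0 Hl) scaler0.
move=> [Du Hu]; apply: hnorm0_eq0; have := bw u Du.
by rewrite Hu subrr hnorm0 pmulr_rle0.
Qed.

Lemma has_dim_zero (E : innerType R) : has_dim [set (0 : E)] 0.
Proof.
exists (fun=> 0); split; first by move=> c _ [].
by apply/seteqP; split=> u /=; [move=> ->; exists (fun=> 0); rewrite big_ord0 | move=> [c ->]; rewrite big_ord0].
Qed.

Section Branches.
Variables (l0 rho : R) (m : nat).
Hypothesis iso : isolates (Spec (Ht t0)) l0%:C rho.
Hypothesis dimN : has_dim (eigen_ker (Ht t0) l0%:C) m.
Local Notation z := ((l0 + rho)%:C).
Local Notation S t := (cayley l0 rho t).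
Local Notation N := (eigen_ker (Ht t0) l0%:C).

Let rho0 : 0 < rho. Proof. exact: iso.1. Qed.

Lemma iso_res (x : R) : x != l0 -> `|x - l0| <= rho -> resolvent_set (Ht t0) x%:C.
Proof.
move=> xl xr; apply: contrapT => hs; have := iso.2 _ hs.
rewrite -rmorphB normcEC normcR lecR => /(_ xr) /complexI /eqP.
by rewrite (negPf xl).
Qed.

(** The pole lies on the boundary of the isolating disc, which [isolates] includes. *)
Lemma z_res : resolvent_set (Ht t0) z.
Proof.
apply: iso_res; first by rewrite -subr_eq0 addrAC subrr add0r gt_eqF.
by rewrite addrAC subrr add0r gtr0_norm.
Qed.

Let gz : good z := good_of_res z_res.

Lemma moebius0 : moebius l0 rho 0 = l0.
Proof. by rewrite /moebius mul0r mul0r subr0. Qed.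

Lemma neq1_of_small (a : R) : `|a| < 1 -> a != 1.
Proof. by move=> a1; apply/eqP => ae; move: a1; rewrite ae normr1 ltxx. Qed.

Lemma kerS : N = [set f | S t0 f = 0].
Proof.
rewrite -{1}moebius0 (cayley_ker rho0 It0 z_res); last by rewrite eq_sym oner_eq0.
by apply/seteqP; split=> f /=; rewrite scale0r.
Qed.

(** For 0 < |b| < 1/2 one has |b| <= 1 - b, so [moebius b] is at distance |b| rho / |1 - b| <= rho
    from l0 and lies in the resolvent set. *)
Lemma cayley_gap v : (forall n, N n -> '[v, n] = 0) -> 2^-1 * hnorm v <= hnorm (S t0 v).
Proof.
move=> hv; have Ss := cayley_sym It0 z_res; have [K SK] := cayley_bnd rho0 z_res.
apply: (orth_gap cH _ Ss SK) => //; last by move=> n Sn; apply: hv; rewrite kerS.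
apply: (square_gap _ Ss SK) => // b /andP[b0 b2].
have b1 : b != 1 by apply: neq1_of_small; lra.
have b10 : 1 - b != 0 by rewrite subr_eq0 eq_sym.
apply: (res_cayley_below z_res) => //; apply: iso_res.
  rewrite -subr_eq0 /moebius addrAC subrr add0r oppr_eq0.
  have bn0 : b != 0 by rewrite -normr_gt0.
  by rewrite !mulf_neq0 ?invr_eq0 ?(gt_eqF rho0).
rewrite /moebius addrAC subrr add0r normrN !normrM normfV (gtr0_norm rho0).
rewrite ler_pdivrMr ?normr_gt0// mulrC ler_pM2l//.
have : b < 2^-1 by apply: le_lt_trans b2; exact: ler_norm.
by move=> bb; rewrite [leRHS]ger0_norm; lra.
Qed.

Lemma branches : exists (u : 'I_m -> H) (d : 'I_m -> R) (a : 'I_m -> R -> R),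
  [/\ orthonormal_fam u, forall j, N (u j),
      forall j, rho%:C * '[Rdot z (u j), u j] = (d j)%:C &
  [/\ forall e : R, 0 < e -> \forall t \near F0, forall j, `|a j t| <= e,
      forall e : R, 0 < e -> \forall t \near G0, forall j, `|a j t / (t - t0) - d j| <= e,
      forall j, a j t0 = 0 &
      \forall t \near F0, exists e : 'I_m -> H,
        [/\ orthonormal_fam e, forall i, S t (e i) = (a i t)%:C *: e i &
            forall x, orthc e x -> 4^-1 * hnorm x <= hnorm (S t x)]]].
Proof.
pose S' f := rho%:C *: Rdot z f.
have S's : adjoint_pair S' S'.
  by move=> x y; rewrite /S' inZl inZr conjCR (Rdot_sym z_res).
have S'l := adjoint_pair_lin S's.
have [K' K'0 S'K] : exists2 K', 0 <= K' & bnd S' K'.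
  have [K K0 hK] := Rdot_bnd z_res; exists (rho * K); first by rewrite mulr_ge0// ltW.
  by move=> x; rewrite hnormZR gtr0_norm// -mulrA ler_pM2l.
have [u [d [uo Nu ud]]] := orthonormal_diag dimN S'l (fun x y _ _ => S's x y).
have S0u j : S t0 (u j) = 0 by have := Nu j; rewrite kerS.
have S0g x : orthc u x -> 2^-1 * hnorm x <= hnorm (S t0 x).
  move=> xu; apply: cayley_gap => n Nn; rewrite (orthonormal_span dimN uo Nu Nn).
  by rewrite in_sumr big1// => j _; rewrite inZr xu mulr0.
have h2 : 0 < 2^-1 :> R by rewrite invr_gt0.
have [eta0 [B [eta00 B0 hsplit]]] :=
  spectral_splitting cH h2 K'0 (cayley_sym It0 z_res) uo S0u S0g S'K ud.
pose eta t := opnorm_on [set: H] (@hnorm R H) (fun f => S t f - S t0 f).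
have Scont : sm (fun t f => S t f - S t0 f).
  move=> e e0; have er : 0 < e / rho by rewrite divr_gt0.
  near=> t => f _; rewrite /cayley opprD addrACA subrr add0r -scalerBr hnormZR gtr0_norm//.
  rewrite -ler_pdivlMl// mulrA [rho^-1 * e]mulrC.
  by have : forall f, setT f -> hnorm (Rt t z f - Rt t0 z f) <= e / rho * hnorm f;
    [near: t; exact: R_cont | exact].
have eta_cvg : eta t @[t --> F0] --> (0 : R) by exact: small_opnorm hS Scont.
have eta_small (e : R) : 0 < e -> \forall t \near F0, `|eta t| <= e.
  move=> e0; have /cvgrPdist_le/(_ e e0) := eta_cvg.
  by apply: filterS => t; rewrite sub0r normrN.
pose good_t t := [/\ 0 <= t <= 1, resolvent_set (Ht t) z & eta t <= eta0].
have good_near : \forall t \near F0, good_t t.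
  near=> t; split; first by near: t.
    by near: t; exact: good_res gz.
  rewrite (le_trans (ler_norm _))//; near: t; exact: eta_small.
have etaB t : good_t t -> bnd (fun f => S t f - S t0 f) (eta t).
  move=> [It rz _] f.
  have [K SK] := cayley_bnd rho0 rz; have [K0 SK0] := cayley_bnd rho0 z_res.
  have Sl := adjoint_pair_lin (cayley_sym It rz).
  have Sl0 := adjoint_pair_lin (cayley_sym It0 z_res).
  have b : bounded_on setT (@hnorm R H) (fun f => S t f - S t0 f).
    by apply: bounded_on_sub; [exact: bounded_opP SK | exact: bounded_opP SK0].
  by have := opnorm_bound hS b (u := f) I.
have eta_ge0 t : good_t t -> 0 <= eta t.
  (* A nonzero vector shows nonnegativity through [etaB]; on the zero space the value is computed
     directly. *)
  move=> gt; case: (pselect (exists x : H, x != 0)) => [[x x0]|h0].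
    have := le_trans (hnorm_ge0 _) (etaB t gt x).
    by rewrite pmulr_lge0// hnorm_gt0.
  have -> : eta t = 0.
    apply/eqP; rewrite -normr_le0; apply: (opnorm_le hS) => // x _.
    suff -> : x = 0 by rewrite hnorm0 mulr0 /cayley; have [It rz _] := gt;
      rewrite (lin_on0 (res_lin rz)) (lin_on0 (res_lin z_res)) scaler0 addr0 subrr hnorm0.
    by apply: contrapT => /eqP x0; apply: h0; exists x.
  by [].
pose Q t (a : 'I_m -> R) := exists e : 'I_m -> H,
  [/\ orthonormal_fam e, forall i, S t (e i) = (a i)%:C *: e i,
      forall x, orthc e x -> 4^-1 * hnorm x <= hnorm (S t x) &
      forall tau eps : R, bnd (fun f => S t f - S t0 f - tau%:C *: S' f) eps ->
          forall j, `|a j - tau * d j| <= B * (eps + `|tau| * eta t)].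
(* With the implication under the quantifier one choice function serves all t; outside [good_t] the
   labels are arbitrary. *)
have exQ t : exists a, good_t t -> Q t a.
  have [gt|ngt] := pselect (good_t t); last by exists (fun=> 0).
  have [It rz et] := gt; have [K SK] := cayley_bnd rho0 rz.
  have [|e [a [eo Se be ha]]] := hsplit (S t) K (eta t) (cayley_sym It rz) SK (etaB t gt).
    by rewrite eta_ge0.
  exists a => _; exists e; split=> // x xe.
  by have := be x xe; rewrite -invfM (_ : 2 * 2 = 4 :> R)//; ring.
have [a ha] := choice exQ.
have a_eta t : good_t t -> forall j, `|a t j| <= B * eta t.
  move=> gt j; have [e [_ _ _ h4]] := ha t gt.
  (* For tau = 0 the remainder is the whole increment S t - S t0, of norm at most [eta t]. *)
  have := h4 0 (eta t); rewrite normr0 mul0r addr0.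
  have b0 : bnd (fun f => S t f - S t0 f - 0%:C *: S' f) (eta t).
    by move=> f; rewrite scale0r subr0; exact: etaB.
  by move=> /(_ b0 j); rewrite mul0r subr0.
exists u, d, (fun j t => a t j); split=> //.
  by move=> j; rewrite -inZl ud eqxx mulr1.
split.
- move=> e e0; have eB : 0 < e / (B + 1) by rewrite divr_gt0// ltr_wpDl.
  near=> t => j; have gt : good_t t by near: t.
  rewrite (le_trans (a_eta t gt j))//.
  have : eta t <= e / (B + 1) by rewrite (le_trans (ler_norm _))//; near: t; exact: eta_small.
  rewrite ler_pdivlMr ?ltr_wpDl//; have := eta_ge0 t gt; lra.
- move=> e e0.
  (* In B (rho + 1), rho comes from the error of the difference quotient of the resolvent and 1 from
     the term |tau| eta; the last 1 makes [L] positive. *)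
  pose L := B * (rho + 1) + 1; have L0 : 0 < L by rewrite ltr_wpDl// mulr_ge0// addr_ge0// ltW.
  have eL : 0 < e / L by rewrite divr_gt0.
  near=> t => j; have tt0 : t != t0 by near: t; exact: dnbhs01_neq.
  have gt : good_t t by near: t; exact: nbhs01_dnbhs01.
  have et : eta t <= e / L.
    rewrite (le_trans (ler_norm _))//; near: t; apply: nbhs01_dnbhs01; exact: eta_small.
  have dR : forall f, setT f ->
      hnorm (diff_quot (fun t => Rt t z f) t0 t - Rdot z f) <= e / L * hnorm f.
    by near: t; apply: (R_deriv z_res).
  have tau0 : t - t0 != 0 by rewrite subr_eq0.
  have ntau : 0 < `|t - t0| by rewrite normr_gt0.
  have b : bnd (fun f => S t f - S t0 f - (t - t0)%:C *: S' f) (rho * `|t - t0| * (e / L)).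
    move=> f; have -> : S t f - S t0 f - (t - t0)%:C *: S' f =
        (rho * (t - t0))%:C *: (diff_quot (fun t => Rt t z f) t0 t - Rdot z f).
      rewrite /cayley opprD addrACA subrr add0r -scalerBr /S' /diff_quot [RHS]scalerBr !scalerA.
      by rewrite -!rmorphM mulfK// [rho * _]mulrC.
    rewrite hnormZR normrM (gtr0_norm rho0) -[leRHS]mulrA; apply: ler_wpM2l.
      by rewrite mulr_ge0// ltW.
    exact: dR.
  have [e' [_ _ _ h4]] := ha t gt; have := h4 _ _ b j => h5.
  have -> : a t j / (t - t0) - d j = (a t j - (t - t0) * d j) / (t - t0).
    by rewrite mulrBl [(t - t0) * d j]mulrC mulfK.
  rewrite normrM normfV ler_pdivrMr// (le_trans h5)//.
  have h6 : `|t - t0| * eta t <= `|t - t0| * (e / L) by rewrite ler_pM2l.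
  apply: (@le_trans _ _ (B * (rho * `|t - t0| * (e / L) + `|t - t0| * (e / L)))).
    by apply: ler_wpM2l => //; rewrite lerD2l.
  have -> : B * (rho * `|t - t0| * (e / L) + `|t - t0| * (e / L)) =
            (B * (rho + 1) / L) * e * `|t - t0| by ring.
  apply: ler_wpM2r => //; rewrite -[leRHS]mul1r; apply: ler_wpM2r; first exact: ltW.
  by rewrite ler_pdivrMr// mul1r /L lerDl.
- move=> j; have gt0 : good_t t0.
    by move: good_near; rewrite /nbhs01 near_withinE => /nbhs_singleton; apply; rewrite /= in_itv.
  have et0 : eta t0 = 0.
    apply/eqP; rewrite -normr_le0; apply: (opnorm_le hS) => // x _.
    by rewrite subrr hnorm0 mul0r.
  by have := a_eta t0 gt0 j; rewrite et0 mulr0 normr_le0 => /eqP.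
near=> t; have gt : good_t t by near: t.
by have [e [h4 h5 h6 _]] := ha t gt; exists e.
Unshelve. all: by end_near. Qed.

(** R_{t0}(z) u = - u / rho, so in the weak form of [Rdot] both resolvents become scalars, whose
    product rho^-2 cancels. *)
Lemma derivative_formula (u : H) (d : R) : N u -> rho%:C * '[Rdot z u, u] = d%:C ->
  let phi := Wt t0 (T t0 u) in
  '[V' u, u] + '[X t0 (adj Y' phi) - Y t0 (adj X' phi), phi] + omega (T t0 u) (T' u) =
  (- (rho * d))%:C.
Proof.
move=> [Du Hu] hd phi; have [Xb Yb] := XY_bounded It0.
have Hpu : Hp u by exact: dom_Hp Du.
pose k : R := - rho^-1; have r0 : rho != 0 by rewrite gt_eqF.
have RU : Rt t0 z u = k%:C *: u.
  have := resK z_res Du; rewrite Hu -scalerBl -rmorphB opprD addrA subrr add0r.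
  rewrite (lin_onZ (res_lin z_res))// => /(congr1 (fun v => k%:C *: v)).
  by rewrite scalerA -rmorphM /k mulrNN mulVf// rmorph1 scale1r.
have Wl : lin (Wt t0) := adjoint_pair_lin_l (W_adj ch Xb Yb (XY_regular It0)).
have Tk : T t0 (k%:C *: u) = k%:C *: T t0 u by rewrite (lin_onZ (T_linear It0)).
have Wk : Wt t0 (k%:C *: T t0 u) = k%:C *: phi by rewrite (lin_onZ Wl).
have Xsl := adjoint_pair_lin (X_pair It0); have Ysl := adjoint_pair_lin (Y_pair It0).
have X'p := adj_pair ch X'b; have Y'p := adj_pair ch Y'b.
pose b := '[X' (adj (Y t0) phi) - Y' (adj (X t0) phi), phi].
pose c := '[J (T' u), T t0 u].
have key : '[Rdot z u, u] = (k ^+ 2)%:C * (- '[V' u, u] + b + c).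
  rewrite Rdot_weak; last exact: z_res.
  rewrite conjCR RU Tk Wk (lin_onZ V'b.1)// (lin_onZ Ysl)// (lin_onZ Xsl)//.
  rewrite (lin_onZ X'b.1)// (lin_onZ Y'b.1)// (lin_onZ T'b.1)// (lin_onZ J_lin)//.
  rewrite -scalerBr !inZl !inZr !conjCR -/b -/c expr2 rmorphM; ring.
have main : '[V' u, u] - b - c = (- (rho * d))%:C.
  have -> : (- (rho * d))%:C = - (rho%:C * (rho%:C * '[Rdot z u, u])).
    by rewrite hd rmorphN rmorphM.
  rewrite key; have kr : rho%:C * (rho%:C * (k ^+ 2)%:C) = 1.
    by rewrite -!rmorphM (_ : rho * (rho * k ^+ 2) = 1) ?rmorph1// /k; field.
  by rewrite !mulrA -[rho%:C * _ * _]mulrA kr mul1r; ring.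
have vC : Num.conj '[V' u, u] = '[V' u, u] by rewrite -inC V'_sym.
(* The stated boundary terms are minus the conjugates of [b] and [c]; since <V' u, u> and the total
   in [main] are real, conjugation changes nothing. *)
have bC : '[X t0 (adj Y' phi) - Y t0 (adj X' phi), phi] = - Num.conj b.
  rewrite /b -inC inBl inBr !(X_pair It0) !(Y_pair It0).
  rewrite -(adjoint_pairC X'p) -(adjoint_pairC Y'p); ring.
have cC : omega (T t0 u) (T' u) = - Num.conj c.
  rewrite /c /omega -inC !prod_innerE /= inNl inNr; ring.
rewrite bC cC -vC -!rmorphB main; exact: conjCR.
Qed.

(** Chain rule with the derivative - rho of [moebius] at 0. *)
Lemma moebius_derivative (a : R -> R) (d : R) : a t0 = 0 ->
  (forall e : R, 0 < e -> \forall t \near F0, `|a t| <= e) ->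
  (forall e : R, 0 < e -> \forall t \near G0, `|a t / (t - t0) - d| <= e) ->
  scalar_derivative01 (fun t => (moebius l0 rho (a t))%:C) t0 (- (rho * d))%:C.
Proof.
move=> a0 as_ ad; rewrite /scalar_derivative01; apply/cvgrPdist_le => e e0.
have ee : e = (re e)%:C by rewrite [LHS]real_im0// ger0_Im// ltW.
have re0 : 0 < re e by move: e0; rewrite {1}ee ltcR.
(* The 2 bounds 1 / (1 - a t), and 1 + |d| collects the errors of the quotient and of d (a t). *)
pose L := 2 * rho * (1 + `|d|); have L0 : 0 < L by rewrite mulr_gt0 ?mulr_gt0// ltr_wpDr.
have eL : 0 < re e / L by rewrite divr_gt0.
near=> t; have tt0 : t != t0 by near: t; exact: dnbhs01_neq.
have h1 : `|a t| <= 2^-1 by near: t; apply: nbhs01_dnbhs01; apply: as_; rewrite invr_gt0.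
have h2 : `|a t| <= re e / L by near: t; apply: nbhs01_dnbhs01; exact: as_.
have h3 : `|a t / (t - t0) - d| <= re e / L by near: t; exact: ad.
have tau0 : t - t0 != 0 by rewrite subr_eq0.
have a1 : 2^-1 <= 1 - a t by have := ler_norm (a t); lra.
have a10 : 1 - a t != 0 by rewrite gt_eqF// (lt_le_trans _ a1)// invr_gt0.
rewrite /diff_quot a0 moebius0 -rmorphB -[_ *: _]rmorphM -rmorphB normcEC normcR ee lecR.
have -> : - (rho * d) - (t - t0)^-1 * (moebius l0 rho (a t) - l0) =
    rho * ((a t / (t - t0) - d) + d * a t) / (1 - a t).
  by rewrite /moebius; field; rewrite a10 tau0.
rewrite normrM normfV ler_pdivrMr ?normr_gt0// normrM (gtr0_norm rho0).
have h4 : `|a t / (t - t0) - d + d * a t| <= re e / L * (1 + `|d|).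
  rewrite (le_trans (ler_normD _ _))// mulrDr mulr1 lerD// normrM mulrC.
  by apply: ler_wpM2r.
have h5 : 2^-1 <= `|1 - a t| by rewrite (le_trans a1)// ler_norm.
apply: (@le_trans _ _ (rho * (re e / L * (1 + `|d|)))); first by rewrite ler_pM2l.
have -> : rho * (re e / L * (1 + `|d|)) = re e * 2^-1.
  rewrite /L; field; rewrite ?(gt_eqF rho0)//= gt_eqF// ltr_wpDr//.
by rewrite ler_pM2l.
Unshelve. all: by end_near. Qed.

(** [resolvent_near] is uniform in a neighborhood of each point, and compactness of the segment
    yields one neighborhood of t0 for all of them. *)
Lemma segment_res (p q : R) : (forall x, p <= x <= q -> resolvent_set (Ht t0) x%:C) ->
  \forall t \near F0, forall x, p <= x <= q -> resolvent_set (Ht t) x%:C.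
Proof.
move=> hpq.
have key (y : R) : resolvent_set (Ht t0) y%:C ->
    \forall x' \near y & t \near F0, resolvent_set (Ht t) x'%:C.
  move=> ry; have [d [C [d0 C0 hd]]] := resolvent_near ry.
  exists (ball y d, fun t => forall w, normc (w - y%:C) <= d ->
    resolvent_set (Ht t) w /\ bnd (Rt t w) C); first by split=> //; exact: nbhsx_ballx.
  move=> [x' s] [/= x'd /(_ x'%:C)] []//.
  by rewrite -rmorphB normcR distrC ltW.
have /compact_near_coveringP cov := @segment_compact R p q.
have := cov R F0 (fun t x => resolvent_set (Ht t) x%:C) _.
move=> /(_ _) h'; near=> t => x xpq.
have : `[p, q]%classic `<=` (fun x => resolvent_set (Ht t) x%:C).
  near: t; apply: h' => y; rewrite /= in_itv /= => /hpq; exact: key.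
by apply; rewrite /= in_itv.
Unshelve. all: by end_near. Qed.

(** Non-real points and real points at distance at least rho/8 from l0 are in the resolvent set. A
    real point closer than rho/8 is [moebius b] with |b| < 1/7 < 1/4, in the range governed by the
    eigenvectors e_i. *)
Lemma disc_spectrum t r (a : 'I_m -> R) (e : 'I_m -> H) :
  0 <= t <= 1 -> resolvent_set (Ht t) z -> orthonormal_fam e ->
  (forall i, S t (e i) = (a i)%:C *: e i) ->
  (forall x, orthc e x -> 4^-1 * hnorm x <= hnorm (S t x)) ->
  (forall j, `|a j| < 1) ->
  (forall j, `|moebius l0 rho (a j) - l0| < rho / 8) ->
  (forall j, `|moebius l0 rho (a j) - l0| <= r) ->
  (forall x, rho / 8 <= `|x - l0| <= r -> resolvent_set (Ht t) x%:C) ->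
  eigenvalues_in_disc (Ht t) l0%:C r (fun j => (moebius l0 rho (a j))%:C).
Proof.
move=> It rz eo Se be a1 al ar hres.
have Ss := cayley_sym It rz; have [K SK] := cayley_bnd rho0 rz.
have parts w : `|w - l0%:C| <= r%:C ->
    resolvent_set (Ht t) w /\ (forall j, (moebius l0 rho (a j))%:C != w) \/
    exists al : R, [/\ `|al| < 4^-1, al != 1 & w = (moebius l0 rho al)%:C].
  have [w0|w0] := eqVneq (complex.Im w) 0; last first.
    move=> _; left; split; first exact: nonreal_res.
    by move=> j; apply/eqP => wE; move: w0; rewrite -wE eqxx.
  rewrite (real_im0 w0); move: (re w) => x; rewrite -rmorphB normcEC normcR lecR => xr.
  have [h8|h8] := lerP (rho / 8) `|x - l0|.
    left; split; first by apply: hres; rewrite h8.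
    move=> j; rewrite (inj_eq (@complexI R)); apply/eqP => xE.
    by have := al j; rewrite xE ltNge h8.
  right; have xz : x != l0 + rho.
    apply/eqP => xE; move: h8; rewrite xE addrAC subrr add0r gtr0_norm//; have := rho0; lra.
  have [b1 bE] := moebius_inv rho0 xz.
  exists ((x - l0) / (x - l0 - rho)); split=> //; last by rewrite bE.
  rewrite normrM normfV ltr_pdivrMr; last first.
    by rewrite normr_gt0 -addrA -opprD subr_eq0.
  have : rho - `|x - l0| <= `|x - l0 - rho|.
    by have := lerB_dist rho (x - l0); rewrite (gtr0_norm rho0) distrC.
  have := rho0; lra.
split.
- by move=> j; rewrite -rmorphB normcEC normcR lecR.
- move=> w sw /parts[[rw _]|[b [b4 b1 wE]]]; first by case: sw.
  apply: contrapT => /forallNP hj; apply: sw; rewrite wE.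
  apply: (cayley_below_res It rz b1).
  apply: (eigen_basis_below cH Ss SK Se be b4) => j; apply/eqP => ab.
  by apply: (hj j); rewrite wE ab.
move=> w /parts[[rw wj]|[b [b4 b1 wE]]].
  rewrite (eigen_ker_res rw It).
  rewrite (_ : [set j | _ == w]%SET = finset.set0); last first.
    by apply/setP => j; rewrite !inE (negPf (wj j)).
  rewrite cards0; exact: has_dim_zero.
rewrite wE (cayley_ker rho0 It rz b1).
rewrite (_ : [set j | _ == _]%SET = [set j | a j == b]%SET); last first.
  apply/setP => j; rewrite !inE (inj_eq (@complexI R)).
  apply/eqP/eqP => [|-> //]; apply: moebius_inj => //.
  exact: neq1_of_small.
exact: (eigen_basis_dim Ss eo Se be b4).
Qed.

(** The labels are built from the fixed radius rho, but the disc may have any isolating radius r,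
    larger or smaller; only the neighborhood of t0 depends on r. *)
Lemma branch_properties : exists (u : 'I_m -> H) (lam : 'I_m -> R -> R[i]),
  let phi (j : 'I_m) := Wt t0 (T t0 (u j)) in
  [/\ forall j, N (u j), orthonormal_fam u,
      forall r : R, isolates (Spec (Ht t0)) l0%:C r ->
        \forall t \near F0, eigenvalues_in_disc (Ht t) l0%:C r (lam ^~ t),
      forall j, scalar_derivative01 (lam j) t0
        ('[V' (u j), u j] + '[X t0 (adj Y' (phi j)) - Y t0 (adj X' (phi j)), phi j]
         + omega (T t0 (u j)) (T' (u j))) &
      forall j (x : h), ((T t0 (u j)).1 = - adj (Y t0) x /\
        (T t0 (u j)).2 = adj (X t0) x) <-> x = phi j].
Proof.
have [u [d [a [uo Nu ud [as_ ad a0 ae]]]]] := branches.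
exists u, (fun j t => (moebius l0 rho (a j t))%:C) => phi; split=> //.
(* Branches within [x1] of l0 are in the disc of radius r and strictly closer than rho/8. *)
- move=> r [r0 isor]; pose x1 := Num.min (rho / 16) r.
  have x10 : 0 < x1 by rewrite lt_min r0 divr_gt0.
  (* For |a| below this threshold |1 - a| >= 1/2, so |a| rho / |1 - a| <= x1. *)
  have hx : 0 < Num.min 2^-1 (x1 / (2 * rho)) 
    by rewrite lt_min invr_gt0 ltr0n /= divr_gt0// mulr_gt0.
  have hK : forall p q : R, (forall x, p <= x <= q -> rho / 8 <= `|x - l0| <= r) ->
      \forall t \near F0, forall x, p <= x <= q -> resolvent_set (Ht t) x%:C.
    move=> p q hpq; apply: segment_res => x /hpq /andP[xl xr].
    apply: contrapT => hs; have := isor _ hs.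
    rewrite -rmorphB normcEC normcR lecR => /(_ xr) /complexI xl0.
    by move: xl; rewrite xl0 subrr normr0; have := rho0; lra.
  near=> t.
  have It : 0 <= t <= 1 by near: t.
  have rz : resolvent_set (Ht t) z by near: t; exact: good_res gz.
  have [e [eo Se be]] : exists e : 'I_m -> H,
        [/\ orthonormal_fam e, forall i, S t (e i) = (a i t)%:C *: e i &
            forall x, orthc e x -> 4^-1 * hnorm x <= hnorm (S t x)] by near: t.
  have asm : forall j, `|a j t| <= Num.min 2^-1 (x1 / (2 * rho)) by near: t; exact: as_.
  have mb j : `|moebius l0 rho (a j t) - l0| <= x1.
    have := asm j; rewrite le_min => /andP[h2 h3].
    have a1 : 2^-1 <= `|1 - a j t|.
      by rewrite (le_trans _ (lerB_dist _ _))// normr1; lra.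
    rewrite /moebius addrAC subrr add0r normrN !normrM normfV (gtr0_norm rho0).
    rewrite ler_pdivrMr; last by rewrite (lt_le_trans _ a1)// invr_gt0.
    move: h3; rewrite ler_pdivlMr ?mulr_gt0// => h3.
    have : x1 * 2^-1 <= x1 * `|1 - a j t| by rewrite ler_pM2l.
    lra.
  apply: (disc_spectrum It rz eo Se be).
  - by move=> j; have := asm j; rewrite le_min => /andP[]; lra.
  - move=> j; rewrite (le_lt_trans (mb j))// (@le_lt_trans _ _ (rho / 16))//.
      by rewrite ge_min lexx.
    by have := rho0; lra.
  - by move=> j; rewrite (le_trans (mb j))// ge_min lexx orbT.
  (* The real points with rho/8 <= |x - l0| <= r form two segments, each handled by compactness. *)
  have hl : forall x, l0 - r <= x <= l0 - rho / 8 -> resolvent_set (Ht t) x%:C.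
    near: t; apply: hK => x /andP[h1 h2]; rewrite ler0_norm; last by have := rho0; lra.
    by apply/andP; split; lra.
  have hr : forall x, l0 + rho / 8 <= x <= l0 + r -> resolvent_set (Ht t) x%:C.
    near: t; apply: hK => x /andP[h1 h2]; rewrite ger0_norm; last by have := rho0; lra.
    by apply/andP; split; lra.
  move=> x /andP[]; have [xl|xl] := lerP 0 (x - l0); rewrite ?(ger0_norm xl) ?(ltr0_norm xl) => h1 h2.
    by apply: hr; apply/andP; split; lra.
  by apply: hl; apply/andP; split; lra.
- move=> j; rewrite (derivative_formula (Nu j) (ud j)).
  apply: moebius_derivative => //.
    by move=> e /as_; apply: filterS => t h'; exact: h'.
  by move=> e /ad; apply: filterS => t h'; exact: h'.
move=> j x; have [Xb Yb] := XY_bounded It0.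
have TE := dom_frame It0 (Nu j).1; split=> [[h1 h2]|->].
  apply: (frame_inj ch Xb Yb (XY_regular It0)); rewrite -TE.
  by rewrite /frame -h1 -h2; case: (T t0 (u j)).
by rewrite {1 2}TE.
Unshelve. all: by end_near. Qed.

End Branches.

Lemma Rdot_bounded z : resolvent_set (Ht t0) z -> bounded_op (Rdot z).
Proof.
move=> rz; have rz' := res_set_conj It0 rz; have [K _ RK] := Rdot_bnd rz.
apply: bounded_opP RK; apply: linP => a f g; apply: inner_eql => v.
have [Xb Yb] := XY_bounded It0.
have Wl : lin (Wt t0) := adjoint_pair_lin_l (W_adj ch Xb Yb (XY_regular It0)).
have Rl := res_lin rz.
have Xsl := adjoint_pair_lin (X_pair It0); have Ysl := adjoint_pair_lin (Y_pair It0).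
have D f' : Hp (Rt t0 z f') by exact: (R_dom _ It0 rz).
rewrite [RHS]inDl [in RHS]inZl !Rdot_weak// Rl.2// (T_linear It0).2// Wl.2// V'b.1.2//.
rewrite Ysl.2// Xsl.2// X'b.1.2// Y'b.1.2// T'b.1.2// J_lin.2//.
rewrite !inBl !inDl !inZl; ring.
Qed.

Lemma isolated_branches (lam0 : R[i]) (m : nat) :
  isolated_eigenvalue (Ht t0) lam0 m ->
  exists (u : 'I_m -> H) (lam : 'I_m -> R -> R[i]),
    let phi (j : 'I_m) := Wt t0 (T t0 (u j)) in
    [/\ forall j, eigen_ker (Ht t0) lam0 (u j), orthonormal_fam u,
        forall r : R, isolates (Spec (Ht t0)) lam0 r ->
          \forall t \near F0, eigenvalues_in_disc (Ht t) lam0 r (lam ^~ t),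
        forall j, scalar_derivative01 (lam j) t0
          ('[V' (u j), u j] + '[X t0 (adj Y' (phi j)) - Y t0 (adj X' (phi j)), phi j]
           + omega (T t0 (u j)) (T' (u j))) &
        forall j (x : h), ((T t0 (u j)).1 = - adj (Y t0) x /\
          (T t0 (u j)).2 = adj (X t0) x) <-> x = phi j].
Proof.
move=> [_ sl [r isor] dimN].
have l0 : lam0 = (re lam0)%:C.
  apply: real_im0; have [//|/(nonreal_res It0)] := eqVneq (complex.Im lam0) 0.
  by move=> rl; case: sl.
by move: isor dimN; rewrite l0; exact: branch_properties.
Qed.

End Derivative.
End Continuity.
End Dynamics.
End Family.

Theorem theorem4p5 (R : realType) (H h : hilbertType R)
    (sepH : separable_space H) (seph : separable_space h)
    (A : operator H H)
    (A_linear : linear_on (dom A) A) (A_dense : dense (dom A))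
    (A_closed : closed_op A) (A_symmetric : symmetric_op A)
    (A_deficiency : equal_deficiency A)
    (T : R -> H -> h * h) (Q : R -> h * h -> h * h) (V : R -> H -> H)
    (T_bounded : forall t : R, 0 <= t <= 1 ->
       bounded_on (dom (adjoint A)) (graph_norm (adjoint A)) (T t))
    (T_triplet : forall t : R, 0 <= t <= 1 ->
       boundary_triplet A (fun u => (T t u).1) (fun u => (T t u).2))
    (Q_projection : forall t : R, 0 <= t <= 1 ->
       orthogonal_projection (Q t) /\ lagrangian (range (Q t)))
    (V_selfadjoint : forall t : R, 0 <= t <= 1 ->
       bounded_op (V t) /\ self_adjoint (full (V t)))
    (AA : R -> operator H H) (X Y : R -> h -> h)
    (XY_bounded : forall t : R, 0 <= t <= 1 ->
       bounded_op (X t) /\ bounded_op (Y t))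
    (AA_extension : forall t : R, 0 <= t <= 1 ->
       [/\ self_adjoint (AA t), extends A (AA t) &
           dom (AA t) = [set u | dom (adjoint A) u /\
                                 row_op (X t) (Y t) (T t u) = 0]])
    (AA_range : forall t : R, 0 <= t <= 1 ->
       T t @` dom (AA t) = range (Q t) /\
       range (Q t) = [set f | row_op (X t) (Y t) f = 0])
    (XY_commute : forall t : R, 0 <= t <= 1 ->
       forall x, X t (adj (Y t) x) = Y t (adj (X t) x))
    (XY_regular : forall t : R, 0 <= t <= 1 ->
       ~ Spec (full (block_op (X t) (Y t))) 0) :
  let Hp := dom (adjoint A) in
  let gN := graph_norm (adjoint A) in
  let Ht (t : R) := add_op (AA t) (V t) in
  let Rt (t : R) (z : R[i]) := resolvent (Ht t) z in
  let TRadj (t : R) (z : R[i]) := adj (fun f => T t (Rt t z^* f)) in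
  let Wt (t : R) := W (X t) (Y t) in
  let Z (t s : R) (g : h * h) := adj (Wt t) (X t (adj (Y s) (Wt s g))
                             - Y t (adj (X s) (Wt s g))) in
  [/\ forall (s t : R) (z : R[i]), 0 <= s <= 1 -> 0 <= t <= 1 ->
        ~ Spec (Ht t) z -> ~ Spec (Ht s) z ->
        forall f : H,
          Rt t z f - Rt s z f =
          Rt t z (V s (Rt s z f) - V t (Rt s z f))
          + TRadj t z (Z t s (T s (Rt s z f)))
          + TRadj t z (J (T t (Rt s z f) - T s (Rt s z f))),
      forall t0 : R, 0 <= t0 <= 1 ->
        continuous_on01 Hp gN T t0 -> continuous01 V t0 ->
        continuous01 X t0 -> continuous01 Y t0 ->
        forall z : R[i], ~ Spec (Ht t0) z ->
          (\forall t \near nbhs01 t0, ~ Spec (Ht t) z) /\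
          continuous01 (Rt ^~ z) t0 &
      forall (t0 : R) (T' : H -> h * h) (V' : H -> H) (X' Y' : h -> h),
        0 <= t0 <= 1 ->
        derivative_on01 Hp gN T t0 T' -> derivative01 V t0 V' ->
        derivative01 X t0 X' -> derivative01 Y t0 Y' ->
        (forall z : R[i], ~ Spec (Ht t0) z ->
          (\forall t \near nbhs01 t0, ~ Spec (Ht t) z) /\
          derivative01 (Rt ^~ z) t0 (fun f : H =>
            let u := Rt t0 z f in
            let w := Wt t0 (T t0 u) in
            - Rt t0 z (V' u)
            + TRadj t0 z (adj (Wt t0) (X' (adj (Y t0) w) - Y' (adj (X t0) w)))
            + TRadj t0 z (J (T' u)))) /\
        (forall (lam0 : R[i]) (m : nat),
          isolated_eigenvalue (Ht t0) lam0 m ->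
          exists (u : 'I_m -> H) (lam : 'I_m -> R -> R[i]),
            let phi (j : 'I_m) := Wt t0 (T t0 (u j)) in
            [/\ forall j : 'I_m, eigen_ker (Ht t0) lam0 (u j),
                forall j k : 'I_m, '[u j, u k] = (j == k)%:R,
                forall r : R, isolates (Spec (Ht t0)) lam0 r ->
                  \forall t \near nbhs01 t0,
                    eigenvalues_in_disc (Ht t) lam0 r (lam ^~ t),
                forall j : 'I_m, scalar_derivative01 (lam j) t0
                  ('[V' (u j), u j]
                   + '[X t0 (adj Y' (phi j)) - Y t0 (adj X' (phi j)), phi j]
                   + omega (T t0 (u j)) (T' (u j))) &
                forall (j : 'I_m) (x : h),
                  ((T t0 (u j)).1 = - adj (Y t0) x /\
                   (T t0 (u j)).2 = adj (X t0) x) <-> x = phi j])].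
Proof.
move=> Hp gN Ht Rt TRadj Wt Z.
have gS : seminorm_on Hp gN := graph_seminorm A_dense.
have hS E := @hnorm_seminorm R E.
have sV := fun t It => (V_selfadjoint t It).1.
have sX := fun t It => (XY_bounded t It).1.
have sY := fun t It => (XY_bounded t It).2.
have res t z : ~ Spec (Ht t) z <-> resolvent_set (Ht t) z.
  by split=> [/contrapT//|rz]; apply.
split.
- move=> s t z Is It /res rt /res rs f.
  by apply: (krein_formula A_dense T_bounded T_triplet V_selfadjoint XY_bounded
    AA_extension XY_commute XY_regular Is It rt rs).
- move=> t0 It0 Tc Vc Xc Yc z /res rz.
  have {}Tc := continuous_on_small gS It0 T_bounded Tc.
  have {}Vc := continuous_on_small (hS _) It0 sV Vc.
  have {}Xc := continuous_on_small (hS _) It0 sX Xc.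
  have {}Yc := continuous_on_small (hS _) It0 sY Yc.
  have gz := good_of_res A_dense T_bounded T_triplet V_selfadjoint XY_bounded
    AA_extension XY_commute XY_regular It0 Tc Vc Xc Yc rz.
  split; first by apply: filterS (good_res gz) => t /res.
  apply: small_opnorm; first exact: hS.
  by apply: (R_cont A_dense T_bounded T_triplet V_selfadjoint XY_bounded
    AA_extension XY_commute XY_regular It0 Tc Vc Xc Yc).
move=> t0 T' V' X' Y' It0 Td Vd Xd Yd.
have Tc := derivative_on_small_diff gS It0 T_bounded Td.
have Vc := derivative_on_small_diff (hS _) It0 sV Vd.
have Xc := derivative_on_small_diff (hS _) It0 sX Xd.
have Yc := derivative_on_small_diff (hS _) It0 sY Yd.
have Tds := derivative_on_small gS It0 T_bounded Td.
have Vds := derivative_on_small (hS _) It0 sV Vd.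
have Xds := derivative_on_small (hS _) It0 sX Xd.
have Yds := derivative_on_small (hS _) It0 sY Yd.
have [T'b _] := Td; have [V'b _] := Vd; have [X'b _] := Xd; have [Y'b _] := Yd.
split=> [z /res rz|lam0 m iso].
  have gz := good_of_res A_dense T_bounded T_triplet V_selfadjoint XY_bounded
    AA_extension XY_commute XY_regular It0 Tc Vc Xc Yc rz.
  split; first by apply: filterS (good_res gz) => t /res.
  split; first by apply: (Rdot_bounded A_dense T_bounded T_triplet V_selfadjoint XY_bounded
    AA_extension XY_commute XY_regular It0 Tc Vc Xc Yc T'b V'b X'b Y'b
    Tds Vds Xds Yds).
  apply: small_opnorm; first exact: hS.
  by apply: (R_deriv A_dense T_bounded T_triplet V_selfadjoint XY_bounded
    AA_extension XY_commute XY_regular It0 Tc Vc Xc Yc T'b V'b X'b Y'b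
    Tds Vds Xds Yds).
by apply: (isolated_branches A_dense T_bounded T_triplet V_selfadjoint XY_bounded
    AA_extension XY_commute XY_regular It0 Tc Vc Xc Yc T'b V'b X'b Y'b
    Tds Vds Xds Yds).
Qed.
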